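(* Let $n>n_0$, where $$n_0:=\max\{\lambda_{\min}(\sqrt{1+\alpha}+1)+\gamma_{\min},\ (\beta+1)\gamma_{\max}+1\},\qquad \beta:=3+2\|\rho\|_{L^\infty}^2,\qquad \alpha:=\frac{\|\Sigma\|_{L^\infty}+2\gamma_{\max}\|\rho\|_{L^\infty}}{\lambda_{\min}}.$$ Let $(P^n,M^n)\in L^\infty_{\mathcal F}(\Omega;C([0,T];\mathcal S^{2d}))\times L^2_{\mathcal F}(0,T;\mathcal S^{2d})$ be the unique solution of the backward stochastic Riccati differential equation $$\begin{aligned}-dP(t)=&\Bigg\{-\left(P(t)\begin{bmatrix}-I_d\\ \gamma\end{bmatrix}+\begin{bmatrix}0\\ I_d\end{bmatrix}\right)\Lambda^{-1}\left(\begin{bmatrix}-I_d&\gamma\end{bmatrix}P(t)+\begin{bmatrix}0&I_d\end{bmatrix}\right)+P(t)\begin{bmatrix}0&0\\0&-\rho(t)\end{bmatrix}\\&\quad+\begin{bmatrix}0&0\\0&-\rho(t)\end{bmatrix}P(t)+\begin{bmatrix}\Sigma(t)&0\\0&0\end{bmatrix}\Bigg\}\,dt-M(t)\,dW(t),\qquad P(T)=\begin{bmatrix}nI_d&I_d\\ I_d&0\end{bmatrix}.\end{aligned}$$ Then, for all $(t,x,y)\in[0,T)\times\mathbb R^d\times\mathbb R^d$, the value function $V^n$ of the unconstrained control problem (defined in the context) is of the linear-quadratic form $$V^n(t,x,y)=\frac12\begin{bmatrix}x^{\mathrm T}&y^{\mathrm T}\end{bmatrix}P^n(t)\begin{bmatrix}x\\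 y\end{bmatrix},$$ and the optimal control $\xi^{n,*}$ is given in feedback form by $$\xi^{n,*}(t,x,y)=-\Lambda^{-1}\left(\begin{bmatrix}-I_d&\gamma\end{bmatrix}P^n(t)+\begin{bmatrix}0&I_d\end{bmatrix}\right)\begin{bmatrix}x\\ y\end{bmatrix}.$$
   Context: Setting: $T\in(0,\infty)$, $d\in\mathbb N$; $(\Omega,\mathcal F,(\mathcal F_t)_{t\in[0,T]},\mathbb P)$ is a filtered probability space carrying a one-dimensional standard Brownian motion $W$; $(\mathcal F_t)$ is the filtration generated by $W$ completed by the null sets and $\mathcal F=\mathcal F_T$. All equations and inequalities are understood $\mathbb P$-a.s. $\mathcal S^d$ (resp. $\mathcal S^d_+$) is the set of symmetric (resp. symmetric nonnegative definite) $d\times d$ real matrices, $I_d$ the identity, $|\cdot|$ the Euclidean (Frobenius) norm. $L^2_{\mathcal F}(s,T;H)$ and $L^\infty_{\mathcal F}(s,T;H)$ are the spaces of $H$-valued adapted processes on $[s,T]$ that are square-integrable ($\mathbb E\int_s^T|f|^2dt<\infty$), resp. essentially bounded with norm $\|f\|_{L^\infty}=\operatorname{ess\,sup}_{t,\omega}|f(t,\omega)|$. $L^\infty_{\mathcal F}(\Omega;C([0,T];H))$ is the space of progressively measurable continuous processes with $\operatorname{ess\,sup}_\omega\max_t|f(t,\omega)|<\infty$. Data: $\Lambda\in\mathcal S^d$ positive definite with smallest and largest eigenvalues $\lambda_{\min},\lambda_{\max}$; $\gamma=\mathrm{diag}(\gamma_i)$ positive definite diagonal with smallest and largest entries $\gamma_{\min},\gamma_{\max}$;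 $\rho=\mathrm{diag}(\rho_i)$ and $\Sigma$ progressively measurable, essentially bounded $\mathcal S^d_+$-valued processes. State dynamics: for $\xi\in L^2_{\mathcal F}(t,T;\mathbb R^d)$ and initial state $X(t)=x$, $Y(t)=y$, $dX(s)=-\xi(s)\,ds$, $dY(s)=\{-\rho(s)Y(s)+\gamma\xi(s)\}\,ds$, $s\in[t,T]$. Unconstrained problem: $$V^n(t,x,y)=\operatorname*{ess\,inf}_{\xi\in L^2_{\mathcal F}(t,T;\mathbb R^d)}\mathbb E\Big\{\tfrac n2X(T)^{\mathrm T}X(T)+Y(T)^{\mathrm T}X(T)+\int_t^T\big[\tfrac12\xi(s)^{\mathrm T}\Lambda\xi(s)+Y(s)^{\mathrm T}\xi(s)+\tfrac12X(s)^{\mathrm T}\Sigma(s)X(s)\big]ds\,\Big|\,\mathcal F_t\Big\}.$$ A feedback control means the process $\xi(s)=\xi^{n,*}(s,X(s),Y(s))$ along the resulting state process. The BSRDE has a unique solution in the indicated space for every $n\ge\gamma_{\max}$. *)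

(* Defs.v *)
From HB Require Import structures.
From mathcomp Require Export all_boot all_order all_algebra.
From mathcomp Require Export all_classical all_reals all_analysis.
From mathcomp Require Export measurable_realfun ess_sup_inf.

Set Implicit Arguments.
Unset Strict Implicit.
Unset Printing Implicit Defensive.
Export Order.TTheory GRing.Theory Num.Theory.
Export numFieldNormedType.Exports.
Local Open Scope classical_set_scope.
Local Open Scope ring_scope.

Section Matrices.
Context {R : realType}.

Definition frob (m n : nat) (A : 'M[R]_(m, n)) : R :=
  Num.sqrt (\sum_i \sum_j A i j ^+ 2).

Definition dotp (m : nat) (u v : 'cV[R]_m) : R := (u^T *m v) 0 0.

Definition symmx (m : nat) (A : 'M[R]_m) : Prop := A^T = A.

Definition psdmx (m : nat) (A : 'M[R]_m) : Prop :=
  symmx A /\ forall v : 'cV[R]_m, 0 <= dotp v (A *m v).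

Definition pdmx (m : nat) (A : 'M[R]_m) : Prop :=
  symmx A /\ forall v : 'cV[R]_m, v != 0 -> 0 < dotp v (A *m v).

(* For a symmetric real matrix of positive size the set of eigenvalues is finite
   and nonempty, so the infimum is attained. *)
Definition eig_min (m : nat) (A : 'M[R]_m) : R :=
  inf [set a | eigenvalue A a].

Definition diag_min (m : nat) (A : 'M[R]_m) : R :=
  inf (range (fun i => A i i)).

Definition diag_max (m : nat) (A : 'M[R]_m) : R :=
  sup (range (fun i => A i i)).

End Matrices.

Section Probability.
Context {R : realType} {dO : measure_display} {Omega : measurableType dO}.
Variable P : probability Omega R.

(* The sigma-algebra at time t of the completed Brownian filtration is
   <<s brownian_gen W t>>; only the generators are recorded, so that
   g_sigma_algebraType (brownian_gen W t) is the measurable space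
   (Omega, F_t). *)
Definition brownian_gen (W : R -> Omega -> R) (t : R) : set (set Omega) :=
  [set A | exists s (B : set R),
     [/\ 0 <= s <= t, measurable B & A = W s @^-1` B]]
  `|` [set N | P.-negligible N].

(* Below, F t stands for a set of generators of the sigma-algebra F_t. *)
Variable F : R -> set (set Omega).

Definition F_measurable (t : R) (f : Omega -> R) : Prop :=
  measurable_fun [set: g_sigma_algebraType (F t)]
    (f : g_sigma_algebraType (F t) -> R).

Definition increment (W : R -> Omega -> R) (s t : R) (w : Omega) : R :=
  W t w - W s w.

Definition std_brownian (T : R) (W : R -> Omega -> R) : Prop :=
  [/\ forall t, 0 <= t <= T -> F_measurable t (W t),
      {ae P, forall w, W 0 w = 0},
      forall s t (A : set Omega) (B : set R), 0 <= s -> s < t -> t <= T ->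
        <<s F s >> A -> measurable B ->
        P (A `&` increment W s t @^-1` B)
        = (P A * P (increment W s t @^-1` B))%E,
      forall s t (B : set R), 0 <= s -> s < t -> t <= T -> measurable B ->
        P (increment W s t @^-1` B) = normal_prob 0 (Num.sqrt (t - s)) B
    & {ae P, forall w, {within `[0, T], continuous (fun t => W t w)}}].

Definition progressive (a T : R) (m n : nat)
    (f : R -> Omega -> 'M[R]_(m, n)) : Prop :=
  forall s, a <= s <= T -> forall i j,
    measurable_fun (`[a, s] `*` [set: g_sigma_algebraType (F s)])
      (fun z : R * g_sigma_algebraType (F s) => f z.1 z.2 i j).

Definition adapted (a T : R) (m n : nat)
    (f : R -> Omega -> 'M[R]_(m, n)) : Prop :=
  forall s, a <= s <= T -> forall i j, F_measurable s (fun w => f s w i j).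

Definition cont_process (a T : R) (m n : nat)
    (f : R -> Omega -> 'M[R]_(m, n)) : Prop :=
  progressive a T f /\
  forall w i j, {within `[a, T], continuous (fun s => f s w i j)}.

(* The space L^2_F(a, T; R^(m x n)); joint measurability is what gives a meaning
   to the double integral. *)
Definition L2_process (a T : R) (m n : nat)
    (f : R -> Omega -> 'M[R]_(m, n)) : Prop :=
  [/\ forall i j, measurable_fun (`[a, T] `*` [set: Omega])
                    (fun z : R * Omega => f z.1 z.2 i j),
      adapted a T f
    & (\int[P]_w \int[lebesgue_measure]_(s in `[a, T])
         (frob (f s w) ^+ 2)%R%:E < +oo)%E].

(* Essential supremum over [0, T] x Omega: extending |f| by 0 to all times does
   not change it. *)
Definition Linfty_norm (T : R) (m n : nat)
    (f : R -> Omega -> 'M[R]_(m, n)) : \bar R :=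
  ess_sup (lebesgue_measure \x P)%E
    (patch (cst 0%E) (`[0, T] `*` [set: Omega])
       (fun z : R * Omega => (frob (f z.1 z.2))%:E)).

(* The space L^oo_F(Omega; C([0, T]; R^(m x n))). *)
Definition bounded_cont_process (T : R) (m n : nat)
    (f : R -> Omega -> 'M[R]_(m, n)) : Prop :=
  cont_process 0 T f /\
  exists K : R, {ae P, forall w, forall t, 0 <= t <= T -> frob (f t w) <= K}.

Definition time_int (a b : R) (m n : nat) (f : R -> 'M[R]_(m, n)) :
    'M[R]_(m, n) :=
  \matrix_(i, j) (\int[lebesgue_measure]_(s in `[a, b]) f s i j).

(* The process sum_(i < sp_size) sp_val i * 1_(]sp_time i, sp_time i.+1]). *)
Record simple_process (T : R) := SimpleProcess {
  sp_size : nat;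
  sp_time : nat -> R;
  sp_val : nat -> Omega -> R;
  sp_time_range : forall i, 0 <= sp_time i <= T;
  sp_time_mono : forall i, sp_time i <= sp_time i.+1;
  sp_val_meas : forall i, F_measurable (sp_time i) (sp_val i);
  sp_val_bounded : exists K, forall i w, `|sp_val i w| <= K }.

Definition sp_eval (T : R) (H : simple_process T) (s : R) (w : Omega) : R :=
  \sum_(i < sp_size H)
    (if sp_time H i < s <= sp_time H i.+1 then sp_val H i w else 0).

Definition sp_integral (W : R -> Omega -> R) (T : R) (H : simple_process T)
    (t : R) (w : Omega) : R :=
  \sum_(i < sp_size H) sp_val H i w *
    (W (Num.min (sp_time H i.+1) t) w - W (Num.min (sp_time H i) t) w).

(* I is a continuous version of t |-> \int_0^t M dW, the L^2-limit of the
   integrals of simple processes converging to M in L^2; the scalar Brownian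
   motion acts entrywise on matrices. *)
Definition ito_integral (W : R -> Omega -> R) (T : R) (m n : nat)
    (M I : R -> Omega -> 'M[R]_(m, n)) : Prop :=
  cont_process 0 T I /\
  forall i j, exists H : nat -> simple_process T,
    (fun k => \int[P]_w \int[lebesgue_measure]_(s in `[0%R, T])
         ((sp_eval (H k) s w - M s w i j) ^+ 2)%R%:E)%E @ \oo --> 0%E /\
    forall t, 0 <= t <= T ->
      (fun k => \int[P]_w
         ((sp_integral W (H k) t w - I t w i j) ^+ 2)%R%:E)%E @ \oo --> 0%E.

(* C is a version of E[ Z | F_t ]. *)
Definition cond_exp (t : R) (Z C : Omega -> R) : Prop :=
  [/\ P.-integrable setT (EFin \o Z),
      P.-integrable setT (EFin \o C),
      F_measurable t C
    & forall A, <<s F t >> A ->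
        (\int[P]_(w in A) (C w)%:E = \int[P]_(w in A) (Z w)%:E)%E].

Definition is_ess_inf (S : set (Omega -> R)) (V : Omega -> \bar R) : Prop :=
  [/\ measurable_fun setT V,
      forall C, S C -> {ae P, forall w, (V w <= (C w)%:E)%E}
    & forall U : Omega -> \bar R, measurable_fun setT U ->
        (forall C, S C -> {ae P, forall w, (U w <= (C w)%:E)%E}) ->
        {ae P, forall w, (U w <= V w)%E}].

(* A chosen version of the essential infimum (unique up to null sets). *)
Definition ess_inf_family (S : set (Omega -> R)) : Omega -> \bar R :=
  xget (cst +oo%E) [set V | is_ess_inf S V].

Section Control.
Variables (T : R) (d : nat) (Lambda gamma : 'M[R]_d).
Variables (rho Sigma : R -> Omega -> 'M[R]_d).

Definition state_process (t : R) (x y : 'cV[R]_d)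
    (xi X Y : R -> Omega -> 'cV[R]_d) : Prop :=
  [/\ cont_process t T X, cont_process t T Y
    & {ae P, forall w, forall s, t <= s <= T ->
        X s w = x - time_int t s (fun r => xi r w) /\
        Y s w = y + time_int t s
                      (fun r => - (rho r w *m Y r w) + gamma *m xi r w)}].

Definition cost (n t : R) (xi X Y : R -> Omega -> 'cV[R]_d) (w : Omega) : R :=
  n / 2 * dotp (X T w) (X T w) + dotp (Y T w) (X T w)
  + \int[lebesgue_measure]_(s in `[t, T])
      (2^-1 * dotp (xi s w) (Lambda *m xi s w) + dotp (Y s w) (xi s w)
       + 2^-1 * dotp (X s w) (Sigma s w *m X s w)).

Definition admissible_costs (n t : R) (x y : 'cV[R]_d) : set (Omega -> R) :=
  [set C | exists xi X Y,
     [/\ L2_process t T xi, state_process t x y xi X Y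
       & cond_exp t (cost n t xi X Y) C]].

Definition value_function (n t : R) (x y : 'cV[R]_d) : Omega -> \bar R :=
  ess_inf_family (admissible_costs n t x y).

Definition optimal_control (n t : R) (x y : 'cV[R]_d)
    (xi : R -> Omega -> 'cV[R]_d) : Prop :=
  L2_process t T xi /\
  exists X Y C,
    [/\ state_process t x y xi X Y, cond_exp t (cost n t xi X Y) C
      & {ae P, forall w, value_function n t x y w = (C w)%:E}].

Definition bsrde_driver (p : 'M[R]_(d + d)) (t : R) (w : Omega) :
    'M[R]_(d + d) :=
  - ((p *m col_mx (- 1%:M) gamma + col_mx 0 1%:M) *m invmx Lambda
     *m (row_mx (- 1%:M) gamma *m p + row_mx 0 1%:M))
  + p *m block_mx 0 0 0 (- rho t w) + block_mx 0 0 0 (- rho t w) *m p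
  + block_mx (Sigma t w) 0 0 0.

(* (p, M) solves -dp = bsrde_driver p dt - M dW, p(T) = [n I, I; I, 0]. *)
Definition bsrde_solution (W : R -> Omega -> R) (n : R)
    (p M : R -> Omega -> 'M[R]_(d + d)) : Prop :=
  [/\ bounded_cont_process T p,
      L2_process 0 T M,
      forall t w, 0 <= t <= T -> symmx (p t w) /\ symmx (M t w),
      {ae P, forall w, p T w = block_mx n%:M 1%:M 1%:M 0}
    & exists2 I, ito_integral W T M I &
        {ae P, forall w, forall t, 0 <= t <= T ->
           p t w = p T w + time_int t T (fun s => bsrde_driver (p s w) s w)
                   - (I T w - I t w)}].

Definition feedback (p : R -> Omega -> 'M[R]_(d + d)) (t : R) (w : Omega)
    (x y : 'cV[R]_d) : 'cV[R]_d :=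
  - (invmx Lambda *m (row_mx (- 1%:M) gamma *m p t w + row_mx 0 1%:M)
     *m col_mx x y).

Definition beta : R := 3 + 2 * fine (Linfty_norm T rho) ^+ 2.

Definition alpha : R :=
  (fine (Linfty_norm T Sigma) + 2 * diag_max gamma * fine (Linfty_norm T rho))
  / eig_min Lambda.

Definition n0 : R :=
  Num.max (eig_min Lambda * (Num.sqrt (1 + alpha) + 1) + diag_min gamma)
          ((beta + 1) * diag_max gamma + 1).

End Control.
End Probability.

(* Main.v *)
Require Import Defs.
From mathcomp Require Import ring lra.

(** Let [z = (X, Y)] be a state with control [xi], let [p] solve the backward Riccati
    equation and let [N] be the martingale part of [p]. The state is absolutely
    continuous in time, so [z^T p z / 2] has no second-order term and its drift is the
    one given by the ordinary product rule. Added to the running cost, this drift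
    becomes the perfect square [(xi - fb)^T Lambda (xi - fb) / 2], with [fb] the
    feedback control ([square_identity]). Since [p] at the final time encodes the
    terminal cost, the cost of every admissible control is [z^T p z / 2] at time [t],
    plus the time integral of that square (the regret), plus a noise of mean zero
    given the past of [t] ([square_completion]). All three claims follow: the value
    is a lower bound, the control without regret attains it, and an optimal control
    must have no regret.

    The noise requires no stochastic integration of [z z^T]. Integrating by parts
    along each path expresses it through the increments [N T - N s] multiplied by the
    initial value and by the time derivative of [z z^T] ([abs_cont_ito]), and it is
    enough that such an increment has mean zero against everything known at time [s].
    This is the martingale property of [N], which [ito_martingale] derives from the
    approximation by simple integrals and from independence and symmetry of the
    Brownian increments. Integrability comes from the equation: [p] and its drift are
    bounded, hence so are the increments of [N], while [z] and its derivative are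
    square-integrable by the estimate [dissipative_bound].

    The closed-loop control exists because its state solves a linear equation with
    bounded random coefficients, which Picard iteration solves by progressively
    measurable processes ([linear_ode], [closed_loop]). *)

Set Implicit Arguments.
Unset Strict Implicit.
Unset Printing Implicit Defensive.
Local Open Scope classical_set_scope.
Local Open Scope ring_scope.

(** * Integrable, square-integrable and essentially bounded functions *)

Section Integrability.
Context {d : measure_display} {T : measurableType d} {R : realType}.
Variable mu : {measure set T -> \bar R}.
Implicit Types (D : set T) (f g : T -> R).

Definition L1 D f := mu.-integrable D (EFin \o f).

Definition L2 D f := measurable_fun D f /\ L1 D (fun x => f x ^+ 2).

Definition ess_bounded D f :=
  measurable_fun D f /\ exists K, {ae mu, forall x, D x -> `|f x| <= K}.

Lemma L1_measurable D f : measurable D -> L1 D f -> measurable_fun D f.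
Proof. by move=> mD /measurable_int /measurable_EFinP. Qed.

Lemma L1D D f g : measurable D -> L1 D f -> L1 D g ->
  L1 D (fun x => f x + g x).
Proof. by move=> mD hf hg; have := integrableD mD hf hg. Qed.

Lemma L1Z D k f : measurable D -> L1 D f -> L1 D (fun x => k * f x).
Proof. by move=> mD hf; have := integrableZl mD k hf. Qed.

Lemma L1N D f : measurable D -> L1 D f -> L1 D (fun x => - f x).
Proof. by move=> mD hf; have := integrableN hf. Qed.

Lemma L1B D f g : measurable D -> L1 D f -> L1 D g ->
  L1 D (fun x => f x - g x).
Proof. by move=> mD hf hg; apply: L1D => //; exact: L1N. Qed.

Lemma L10 D : L1 D (fun=> 0).
Proof. exact: integrable0. Qed.

Lemma L1_sum I (s : seq I) D (F : I -> T -> R) : measurable D ->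
  (forall i, L1 D (F i)) -> L1 D (fun x => \sum_(i <- s) F i x).
Proof.
move=> mD hF; elim: s => [|i s ih].
  by under [X in L1 D X]funext do rewrite big_nil; exact: L10.
by under [X in L1 D X]funext do rewrite big_cons; exact: L1D mD (hF i) ih.
Qed.

Lemma eq_L1 D f g : measurable D -> (forall x, D x -> f x = g x) ->
  L1 D f -> L1 D g.
Proof.
by move=> mD fg; apply: eq_integrable => // x /set_mem Dx /=; rewrite fg.
Qed.

Lemma L1S D E f : measurable D -> measurable E -> D `<=` E ->
  L1 E f -> L1 D f.
Proof. by move=> mD mE DE; exact: integrableS. Qed.

Lemma ae_le_L1 D f g : measurable D -> measurable_fun D f -> L1 D g ->
  {ae mu, forall x, D x -> `|f x| <= g x} -> L1 D f.
Proof.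
move=> mD mf Lg fg; apply/integrableP; split; first exact/measurable_EFinP.
have Lg' := integrable_abse Lg.
have /integrableP[mg] := Lg; apply: le_lt_trans.
apply: ae_ge0_le_integral => //; rewrite /comp.
- exact/measurable_EFinP/measurableT_comp.
- exact: measurableT_comp.
- apply: filterS fg => x h Dx /=; rewrite lee_fin.
  by rewrite (le_trans (h Dx))// ler_norm.
Qed.

Lemma le_L1 D f g : measurable D -> measurable_fun D f -> L1 D g ->
  (forall x, D x -> `|f x| <= g x) -> L1 D f.
Proof. by move=> mD mf Lg fg; apply: ae_le_L1 Lg _ => //; exact: aeW. Qed.

Lemma L1_norm D f : measurable D -> L1 D f -> L1 D (fun x => `|f x|).
Proof. by move=> mD Lf; have := integrable_norm Lf. Qed.

Lemma ess_boundedD D f g : measurable D -> ess_bounded D f ->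
  ess_bounded D g -> ess_bounded D (fun x => f x + g x).
Proof.
move=> mD [mf [K hK]] [mg [M hM]]; split; first exact: measurable_funD.
exists (K + M); apply: filterS2 hK hM => x h1 h2 Dx.
by rewrite (le_trans (ler_normD _ _))// lerD ?h1 ?h2.
Qed.

Lemma ess_boundedM D f g : measurable D -> ess_bounded D f ->
  ess_bounded D g -> ess_bounded D (fun x => f x * g x).
Proof.
move=> mD [mf [K hK]] [mg [M hM]]; split; first exact: measurable_funM.
exists (K * M); apply: filterS2 hK hM => x h1 h2 Dx.
by rewrite normrM ler_pM ?h1 ?h2.
Qed.

Lemma ess_bounded_cst D (k : R) : ess_bounded D (fun=> k).
Proof. by split => //; exists `|k|; apply: aeW. Qed.

Lemma L1_ess_bounded D f g : measurable D -> ess_bounded D f -> L1 D g ->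
  L1 D (fun x => f x * g x).
Proof.
move=> mD [mf [K hK]] Lg.
apply: (ae_le_L1 mD _ (L1Z K mD (L1_norm mD Lg))).
  by apply: measurable_funM => //; exact: L1_measurable.
by apply: filterS hK => x h Dx; rewrite normrM ler_wpM2r ?h.
Qed.

Lemma L2M D f g : measurable D -> L2 D f -> L2 D g -> L1 D (fun x => f x * g x).
Proof.
move=> mD [mf Lf] [mg Lg]; apply: (le_L1 mD _ (L1D mD Lf Lg)).
  exact: measurable_funM.
move=> x Dx; rewrite normrM -(normr_idP (sqr_ge0 (f x))).
rewrite -(normr_idP (sqr_ge0 (g x))) !normrX.
have := sqr_ge0 (`|f x| - `|g x|); have := normr_ge0 (f x).
have := normr_ge0 (g x); nra.
Qed.

Lemma L2D D f g : measurable D -> L2 D f -> L2 D g -> L2 D (fun x => f x + g x).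
Proof.
move=> mD hf hg; have Lfg := L2M mD hf hg.
move: hf hg => [mf Lf] [mg Lg]; split; first exact: measurable_funD.
apply: (eq_L1 mD _ (L1D mD (L1D mD Lf Lg) (L1Z 2 mD Lfg))) => x _; ring.
Qed.

Lemma L2_ess_bounded D f g : measurable D -> ess_bounded D f -> L2 D g ->
  L2 D (fun x => f x * g x).
Proof.
move=> mD bf [mg Lg]; split; first by apply: measurable_funM => //; case: bf.
have bff := ess_boundedM mD bf bf.
by apply: (eq_L1 mD _ (L1_ess_bounded mD bff Lg)) => x _; ring.
Qed.

Lemma L2N D f : measurable D -> L2 D f -> L2 D (fun x => - f x).
Proof.
move=> mD Lf; have := L2_ess_bounded mD (ess_bounded_cst D (-1)) Lf.
by under [X in L2 D X -> _]funext do rewrite mulN1r.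
Qed.

Lemma L20 D : measurable D -> L2 D (fun=> 0).
Proof.
move=> mD; split => //; apply: (eq_L1 mD _ (L10 D)) => x _.
by rewrite expr0n.
Qed.

Lemma L2_sum I (s : seq I) D (F : I -> T -> R) : measurable D ->
  (forall i, L2 D (F i)) -> L2 D (fun x => \sum_(i <- s) F i x).
Proof.
move=> mD hF; elim: s => [|i s ih].
  by under [X in L2 D X]funext do rewrite big_nil; exact: L20.
by under [X in L2 D X]funext do rewrite big_cons; exact: L2D mD (hF i) ih.
Qed.

Lemma ae_le_L2 D f g : measurable D -> measurable_fun D f -> L2 D g ->
  {ae mu, forall x, D x -> `|f x| <= g x} -> L2 D f.
Proof.
move=> mD mf [mg Lg] fg; split => //.
apply: (ae_le_L1 mD _ Lg); first exact: measurable_funX.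
by apply: filterS fg => x h Dx; rewrite normrX lerXn2r ?nnegrE ?(le_trans _ (h Dx)) ?h.
Qed.

Lemma Rintegral_sum I (s : seq I) D (F : I -> T -> R) : measurable D ->
  (forall i, L1 D (F i)) ->
  \int[mu]_(x in D) (\sum_(i <- s) F i x) =
  \sum_(i <- s) \int[mu]_(x in D) F i x.
Proof.
move=> mD hF; elim: s => [|i s ih].
  by rewrite big_nil; under eq_Rintegral do rewrite big_nil;
    rewrite Rintegral_cst// mul0r.
rewrite big_cons; under eq_Rintegral do rewrite big_cons.
by rewrite (RintegralD mD (hF i) (L1_sum s mD hF)) ih.
Qed.

Lemma RintegralZ D k f : measurable D -> L1 D f ->
  \int[mu]_(x in D) (k * f x) = k * \int[mu]_(x in D) f x.
Proof. by move=> mD Lf; rewrite RintegralZl. Qed.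

Lemma RintegralN D f : measurable D -> L1 D f ->
  \int[mu]_(x in D) (- f x) = - \int[mu]_(x in D) f x.
Proof.
by move=> mD Lf; under eq_Rintegral do rewrite -mulN1r; rewrite RintegralZ// mulN1r.
Qed.

Lemma ae_eq_Rintegral D f g : measurable D -> measurable_fun D f ->
  measurable_fun D g -> {ae mu, forall x, D x -> f x = g x} ->
  \int[mu]_(x in D) f x = \int[mu]_(x in D) g x.
Proof.
move=> mD mf mg fg; congr fine; apply: ae_eq_integral => //.
- exact/measurable_EFinP.
- exact/measurable_EFinP.
- by apply: filterS fg => x h Dx /=; rewrite h.
Qed.

Lemma L1E D f : measurable D -> L1 D f ->
  (\int[mu]_(x in D) (f x)%:E)%E = (\int[mu]_(x in D) f x)%:E.
Proof. by move=> mD Lf; rewrite fineK//; exact: integrable_fin_num. Qed.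

Lemma ae_le_Rintegral D f g : measurable D -> L1 D f -> L1 D g ->
  {ae mu, forall x, D x -> f x <= g x} ->
  \int[mu]_(x in D) f x <= \int[mu]_(x in D) g x.
Proof.
move=> mD Lf Lg fg.
have mf := L1_measurable mD Lf; have mg := L1_measurable mD Lg.
(* The integral is monotone for pointwise inequalities, so [g] is first replaced
   by [max f g], which it equals almost everywhere. *)
have mm : measurable_fun D (fun x => Num.max (f x) (g x)).
  exact: measurable_maxr.
have eg : {ae mu, forall x, D x -> g x = Num.max (f x) (g x)}.
  by apply: filterS fg => x h Dx; rewrite max_r ?h.
rewrite [leRHS](ae_eq_Rintegral mD mg mm eg); apply: le_Rintegral => //.
  apply: (ae_le_L1 mD mm (L1_norm mD Lg)).
  by apply: filterS eg => x h Dx; rewrite -h.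
by move=> x _; rewrite le_max lexx.
Qed.

End Integrability.

(** * Fubini on a slab of times *)

Section ProductSpace.
Context {R : realType} {dO : measure_display} {Omega : measurableType dO}.
Variable P : {sigma_finite_measure set Omega -> \bar R}.
Notation leb := (@lebesgue_measure R).
Notation prod_meas := (leb \x P)%E.

Lemma ae_prod_snd (Q : Omega -> Prop) : {ae P, forall w, Q w} ->
  {ae prod_meas, forall z : R * Omega, Q z.2}.
Proof.
move=> [N [mN N0 QN]]; exists (setT `*` N); split.
- exact: measurableX.
- by rewrite product_measure1E// -[X in (_ * X)%E]/(P N) N0 mule0.
- by move=> z /= hz; split => //; apply: QN.
Qed.

(** Only this direction of the section principle is available for an arbitrary
    [Q]: a set with null sections need not be measurable. *)
Lemma ae_prod_section (Q : R * Omega -> Prop) :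
  {ae prod_meas, forall z, Q z} ->
  {ae P, forall w, {ae leb, forall s, Q (s, w)}}.
Proof.
move=> [N [mN N0 QN]].
have h : (\int[P]_w (leb (ysection N w)) = 0)%E.
  rewrite -N0 -[in RHS](setIT N) -integral_indic//.
  rewrite (fubini_tonelli2 (fun z => (\1_N z)%:E))//; last first.
    exact/measurable_EFinP/measurable_indic.
  apply: eq_integral => w _; rewrite /fubini_G.
  transitivity (\int[leb]_x (\1_(ysection N w) x)%:E)%E.
    by rewrite integral_indic ?setIT//; exact: measurable_ysection.
  apply: eq_integral => x _; rewrite !indicE; congr (_%:E); congr (_%:R).
  by rewrite mem_ysection.
have m : measurable_fun setT (fun w => leb (ysection N w)).
  exact: measurable_fun_ysection.
have : ae_eq P setT (fun w => leb (ysection N w)) (cst 0%E).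
  apply/(ae_eq_integral_abs P measurableT m).
  by under eq_integral do rewrite gee0_abs//.
apply: filterS => w /(_ I) /= hw.
exists (ysection N w); split => //; first exact: measurable_ysection.
by move=> s /= hs; rewrite ysectionE /=; apply: QN.
Qed.

Variables (a b : R).
Notation I := (`[a, b]%classic).
Notation D := (`[a, b]%classic `*` [set: Omega] : set (measurableTypeR R * Omega)).

Lemma measurable_slab : measurable D.
Proof. exact: measurableX. Qed.
Hint Resolve measurable_slab : core.

Lemma measurable_time : @measurable _ (measurableTypeR R) I.
Proof. exact: measurable_itv. Qed.
Hint Resolve measurable_time : core.

(** Processes are only measurable on the slab, while Fubini's theorem is stated on
    the whole product; extending by zero outside the slab bridges the two. *)
Lemma slab_restrict (f : measurableTypeR R * Omega -> R) s w :
  (f \_ D) (s, w) = ((fun r => f (r, w)) \_ I) s.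
Proof.
by rewrite !patchE; congr (if _ then _ else _); apply/idP/idP;
  rewrite !inE /=; [case|].
Qed.

Lemma slab_restrict_out (f : measurableTypeR R * Omega -> R) s w :
  ~ I s -> (f \_ D) (s, w) = 0.
Proof. by move=> nI; rewrite slab_restrict patchE memNset. Qed.

Lemma slab_restrict_in (f : measurableTypeR R * Omega -> R) s w : I s ->
  (f \_ D) (s, w) = f (s, w).
Proof. by move=> Is; rewrite slab_restrict patchE mem_set. Qed.

Lemma L1_slab (f : measurableTypeR R * Omega -> R) : L1 prod_meas D f ->
  L1 prod_meas setT (f \_ D).
Proof.
move=> Lf; have := (integrable_mkcond (EFin \o f) measurable_slab).1 Lf.
by rewrite /L1 restrict_EFin.
Qed.

Lemma slab_L1 (f : measurableTypeR R * Omega -> R) : measurable_fun D f ->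
  (\int[P]_w \int[leb]_(s in I) (`|f (s, w)|)%:E < +oo)%E ->
  L1 prod_meas D f.
Proof.
move=> mf hf; apply: (integrable_mkcond (EFin \o f) measurable_slab).2.
have mr : measurable_fun setT ((EFin \o f) \_ D).
  by apply: (measurable_restrictT _ measurable_slab).1; exact/measurable_EFinP.
apply: (integrable21ltyP leb P mr).2; apply: le_lt_trans hf.
rewrite le_eqVlt; apply/orP; left; apply/eqP; apply: eq_integral => w _.
rewrite [RHS]integral_mkcond; apply: eq_integral => s _.
rewrite restrict_EFin /= slab_restrict !patchE.
by case: ifPn => //; rewrite normr0.
Qed.

Lemma slab_L1_lty (f : measurableTypeR R * Omega -> R) : L1 prod_meas D f ->
  (\int[P]_w \int[leb]_(s in I) (`|f (s, w)|)%:E < +oo)%E.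
Proof.
move=> /L1_slab Lf.
have mr : measurable_fun setT (EFin \o (f \_ D)) by exact: measurable_int Lf.
apply: le_lt_trans ((integrable21ltyP leb P mr).1 Lf).
rewrite le_eqVlt; apply/orP; left; apply/eqP; apply: eq_integral => w _.
rewrite [LHS]integral_mkcond; apply: eq_integral => s _.
rewrite /= slab_restrict !patchE.
by case: ifPn => //; rewrite normr0.
Qed.

Lemma slab_ae_L1 (f : measurableTypeR R * Omega -> R) : L1 prod_meas D f ->
  {ae P, forall w, L1 leb I (fun s => f (s, w))}.
Proof.
move=> /L1_slab Lf; have := ae_integrable2 Lf; apply: filterS => w hw.
apply: (integrable_mkcond (EFin \o (fun s => f (s, w))) measurable_time).2.
move: hw; apply: eq_integrable => //.
by move=> s _ /=; rewrite slab_restrict restrict_EFin.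
Qed.

Lemma slab_ae_L1_omega (f : measurableTypeR R * Omega -> R) : L1 prod_meas D f ->
  {ae leb, forall s, I s -> L1 P setT (fun w => f (s, w))}.
Proof.
move=> /L1_slab Lf; have := ae_integrable1 Lf; apply: filterS => s hs Is.
move: hs; apply: eq_integrable => // w _ /=.
by rewrite slab_restrict_in.
Qed.

Lemma Rintegral_slab (f : measurableTypeR R * Omega -> R) w :
  (fubini_G leb (EFin \o (f \_ D)) w) = (\int[leb]_(s in I) (f (s, w))%:E)%E.
Proof.
rewrite /fubini_G [RHS]integral_mkcond; apply: eq_integral => s _ /=.
by rewrite slab_restrict !patchE; case: ifPn.
Qed.

Lemma slab_measurable_integral (f : measurableTypeR R * Omega -> R) : L1 prod_meas D f ->
  measurable_fun setT (fun w => \int[leb]_(s in I) f (s, w)).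
Proof.
move=> /L1_slab Lf; apply: measurableT_comp => //.
have := measurable_fubini_G Lf.
by congr measurable_fun; apply/funext => w; exact: Rintegral_slab.
Qed.

Lemma slab_L1_integral (f : measurableTypeR R * Omega -> R) : L1 prod_meas D f ->
  L1 P setT (fun w => \int[leb]_(s in I) f (s, w)).
Proof.
move=> Lf; have Lf' := L1_slab Lf.
have mi := slab_measurable_integral Lf.
have mf' : measurable_fun setT (EFin \o (f \_ D)) by exact: measurable_int Lf'.
apply/integrableP; split; first exact/measurable_EFinP.
apply: le_lt_trans ((integrable21ltyP leb P mf').1 Lf').
apply: ae_ge0_le_integral => //.
- by apply: measurableT_comp => //; exact/measurable_EFinP.
- by move=> w _; exact: integral_ge0.
- have := @measurable_fun_fubini_tonelli_G _ _ _ _ _ leb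
    (abse \o (EFin \o (f \_ D))) (measurableT_comp _ mf') (fun=> abse_ge0 _).
  by apply.
apply: filterS (slab_ae_L1 Lf) => w hw _.
have -> : (EFin \o (fun w => \int[leb]_(s in I) f (s, w))) w =
    fubini_G leb (EFin \o (f \_ D)) w.
  by rewrite Rintegral_slab (L1E measurable_time hw).
by apply: le_abse_integral => //; exact: measurableT_comp mf' _.
Qed.

(** This is how a martingale property enters below: the integrand is known to have
    mean zero at almost every fixed time, and nothing is known path by path. *)
Lemma slab_integral_eq0 (f : measurableTypeR R * Omega -> R) :
  L1 prod_meas D f ->
  {ae leb, forall s, I s -> \int[P]_w f (s, w) = 0} ->
  \int[P]_w \int[leb]_(s in I) f (s, w) = 0.
Proof.
move=> Lf f0; have Lf' := L1_slab Lf; rewrite /Rintegral -[RHS]/(fine 0%E).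
congr fine; transitivity (\int[P]_w fubini_G leb (EFin \o (f \_ D)) w)%E.
  apply: ae_eq_integral => //.
  - by have /measurable_EFinP := slab_measurable_integral Lf.
  - exact: (measurable_fubini_G Lf').
  - apply: filterS (slab_ae_L1 Lf) => w hw _.
    by rewrite Rintegral_slab (L1E measurable_time hw).
rewrite -(Fubini Lf') -[RHS](integral0 leb setT).
apply: ae_eq_integral => //; first exact: (measurable_fubini_F Lf').
have ae1 := slab_ae_L1_omega Lf.
have FF := ae_filter_ringOfSetsType leb.
apply: filterS2 ae1 f0 => s hs f0 _ /=.
have [Is|nI] := pselect (I s).
  rewrite -[RHS]/(0%R%:E) -(f0 Is) -(L1E measurableT (hs Is)).
  by apply: eq_integral => w _ /=; rewrite slab_restrict_in.
rewrite (eq_integral (cst 0%E)) ?integral0// => w _ /=.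
by rewrite slab_restrict_out.
Qed.

Lemma slab_Fubini (f : measurableTypeR R * Omega -> R) : L1 prod_meas D f ->
  \int[P]_w \int[leb]_(s in I) f (s, w) =
  \int[leb]_(s in I) \int[P]_w f (s, w).
Proof.
move=> Lf; have Lf' := L1_slab Lf; rewrite /Rintegral.
congr fine; transitivity (\int[P]_w fubini_G leb (EFin \o (f \_ D)) w)%E.
  apply: ae_eq_integral => //.
  - by have /measurable_EFinP := slab_measurable_integral Lf.
  - exact: (measurable_fubini_G Lf').
  - apply: filterS (slab_ae_L1 Lf) => w hw _.
    by rewrite Rintegral_slab (L1E measurable_time hw).
have mF := measurable_fubini_F Lf'.
have eF s : I s ->
    fubini_F P (EFin \o (f \_ D)) s = (\int[P]_w (f (s, w))%:E)%E.
  move=> Is; apply: eq_integral => w _ /=.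
  by rewrite slab_restrict_in.
rewrite -(Fubini Lf') -[LHS]/(\int[leb]_s fubini_F P (EFin \o (f \_ D)) s)%E.
rewrite -(setUv I) integral_setU//; last 3 first.
- exact: measurableC.
- by rewrite setUv.
- exact/disj_setPCl.
rewrite [X in (_ + X)%E](_ : _ = 0%E) ?adde0; last first.
  rewrite (eq_integral (cst 0%E)) ?integral0// => s /set_mem nIs.
  rewrite /fubini_F (eq_integral (cst 0%E)) ?integral0// => w _ /=.
  by rewrite slab_restrict_out.
apply: ae_eq_integral => //.
- exact: measurable_funTS.
- have h := measurableT_comp (@fine_measurable R setT measurableT) mF.
  have /measurable_EFinP h' : measurable_fun I (fine \o fubini_F P (EFin \o (f \_ D))).
    exact: measurable_funTS.
  by apply: eq_measurable_fun h' => s /set_mem Is /=; rewrite eF.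
have ae1 := slab_ae_L1_omega Lf.
have FF := ae_filter_ringOfSetsType leb.
apply: filterS ae1 => s hs Is.
by rewrite eF// (L1E measurableT (hs Is)).
Qed.

Lemma slab_integralE (f : measurableTypeR R * Omega -> R) : L1 prod_meas D f ->
  \int[prod_meas]_(z in D) f z = \int[P]_w \int[leb]_(s in I) f (s, w).
Proof.
move=> Lf; have Lf' := L1_slab Lf; rewrite Rintegral_mkcond /Rintegral; congr fine.
rewrite -[LHS]/(\int[prod_meas]_z (EFin \o (f \_ D)) z)%E.
rewrite -(integral21_prod_meas1 Lf'); apply: ae_eq_integral => //.
- exact: (measurable_fubini_G Lf').
- by have /measurable_EFinP := slab_measurable_integral Lf.
- apply: filterS (slab_ae_L1 Lf) => w hw _.
  by rewrite Rintegral_slab (L1E measurable_time hw).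
Qed.

Lemma L1_time_cst (k : R) : L1 leb I (fun=> k).
Proof.
apply/integrableP; split; first exact/measurable_EFinP.
rewrite [X in (X < _)%E](@integral_cst _ _ _ leb _ measurable_time (`|k|%:E)).
by rewrite -[X in (_ * X)%E]/(leb I) lebesgue_measure_itv /=;
  case: ifP; rewrite -?EFinD -?EFinM ?mule0 ltry.
Qed.

Lemma slab_L1_prod (f : measurableTypeR R -> R) (g : Omega -> R) :
  L1 leb I f -> L1 P setT g -> L1 prod_meas D (fun z => f z.1 * g z.2).
Proof.
move=> Lf Lg; have mg := L1_measurable measurableT Lg.
have mf := L1_measurable measurable_time Lf.
have Lnf := L1_norm measurable_time Lf.
apply: slab_L1.
  apply: measurable_funM; last first.
    by apply: measurable_funTS; exact: measurableT_comp.
  apply: (measurable_comp measurable_time) => //.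
    by move=> _ [[s w] [Is _] <-].
  exact: measurable_funTS.
have Lc := L1Z (\int[leb]_(s in I) `|f s|) measurableT (L1_norm measurableT Lg).
apply: le_lt_trans (integrable_lty measurableT Lc).
rewrite le_eqVlt; apply/orP; left; apply/eqP; apply: eq_integral => w _.
rewrite [RHS]/= mulrC -RintegralZ// -L1E//; last exact: L1Z.
by apply: eq_integral => s _; rewrite normrM mulrC.
Qed.

Lemma slab_L1_snd (H : Omega -> R) : L1 P setT H ->
  L1 prod_meas D (fun z => H z.2).
Proof.
move=> /(slab_L1_prod (L1_time_cst 1)) /=.
by under [X in L1 _ _ X -> _]funext do rewrite mul1r.
Qed.

End ProductSpace.

(** * Absolutely continuous paths *)

Section AbsCont.
Context {R : realType}.
Notation leb := (@lebesgue_measure R).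
Implicit Types (a b s : R) (f g u v p J : R -> R).

Hint Resolve measurable_time : core.

Lemma L1_subitv a b c e f : a <= c -> e <= b ->
  L1 leb `[a, b] f -> L1 leb `[c, e] f.
Proof.
move=> ac eb; apply: L1S => // s /=; rewrite !in_itv /= => /andP[h1 h2].
by rewrite (le_trans ac h1) (le_trans h2 eb).
Qed.

Lemma Rintegral_itv_split a b s f : a <= s <= b -> L1 leb `[a, b] f ->
  \int[leb]_(r in `[a, b]) f r =
  \int[leb]_(r in `[a, s]) f r + \int[leb]_(r in `[s, b]) f r.
Proof.
move=> /andP[as_ sb] Lf.
rewrite -[X in _ + X](Rintegral_itv_obnd_cbnd (b := BRight b)); last first.
  apply: (L1S _ _ _ (L1_subitv as_ (lexx b) Lf)) => // r /=.
  by rewrite !in_itv /= => /andP[/ltW -> ->].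
by rewrite -(Rintegral_itvB (x := s) Lf) ?bnd_simp// addrC subrK.
Qed.

Lemma prim_continuous a b f : a <= b -> L1 leb `[a, b] f ->
  {within `[a, b], continuous (fun s => \int[leb]_(r in `[a, s]) f r)}.
Proof. exact: parameterized_integral_continuous. Qed.

Lemma prim_bound a b s f : L1 leb `[a, b] f -> s <= b ->
  `|\int[leb]_(r in `[a, s]) f r| <= \int[leb]_(r in `[a, b]) `|f r|.
Proof.
move=> Lf sb; have Lfs := L1_subitv (lexx a) sb Lf.
have [sa|as_] := ltP s a.
  rewrite (_ : `[a, s]%classic = set0) ?Rintegral_set0 ?normr0 ?Rintegral_ge0//.
  by rewrite set_itv_ge// bnd_simp -ltNge.
apply: (le_trans (le_normr_Rintegral _ Lfs)) => //.
have Lnf := L1_norm (measurable_time a b) Lf.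
rewrite (Rintegral_itv_split (s := s) _ Lnf) ?as_// lerDl.
exact: Rintegral_ge0.
Qed.

Lemma within_continuous_measurable a b u :
  {within `[a, b], continuous u} ->
  measurable_fun (`[a, b] : set (measurableTypeR R)) u.
Proof.
move=> cu; have mI : measurable (`[a, b]%classic : set R) by [].
exact: (subspace_continuous_measurable_fun mI cu).
Qed.

Lemma L1_mul_prim a b f g : a <= b -> L1 leb `[a, b] f -> L1 leb `[a, b] g ->
  L1 leb `[a, b] (fun s => f s * \int[leb]_(r in `[a, s]) g r).
Proof.
move=> ab Lf Lg.
have bG : ess_bounded leb `[a, b] (fun s => \int[leb]_(r in `[a, s]) g r).
  split; first exact: within_continuous_measurable (prim_continuous ab Lg).
  exists (\int[leb]_(r in `[a, b]) `|g r|); apply: aeW => s /=.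
  by rewrite in_itv /= => /andP[_ sb]; exact: prim_bound.
apply: (eq_L1 _ _ (L1_ess_bounded _ bG Lf)) => // s _.
by rewrite mulrC.
Qed.

(** Fubini for [f s * g r] on the triangle [r <= s]: integrating in [r] first gives
    the first summand, and integrating in [s] first gives the integral of
    [g r] times the integral of [f] over [[r, b]]. *)
Lemma integral_by_parts a b f g : a <= b ->
  L1 leb `[a, b] f -> L1 leb `[a, b] g ->
  \int[leb]_(s in `[a, b]) (f s * \int[leb]_(r in `[a, s]) g r) +
  \int[leb]_(s in `[a, b]) (g s * \int[leb]_(r in `[a, s]) f r) =
  (\int[leb]_(s in `[a, b]) f s) * \int[leb]_(s in `[a, b]) g s.
Proof.
move=> ab Lf Lg.
have Lg' : L1 leb setT (g \_ `[a, b]).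
  have := (@integrable_mkcond _ (measurableTypeR R) _ leb _ (EFin \o g)
    (measurable_time a b)).1 Lg.
  by rewrite /L1 restrict_EFin.
pose K (z : measurableTypeR R * measurableTypeR R) :=
  f z.1 * ((g \_ `[a, b]) z.2 * ((z.2 : R) <= z.1)%R%:R).
have Lfg := slab_L1_prod Lf Lg'.
have mle : measurable_fun setT
    (fun z : measurableTypeR R * measurableTypeR R => ((z.2 : R) <= z.1)%R%:R : R).
  have m1 : measurable_fun setT (fun z : measurableTypeR R * measurableTypeR R
      => (z.2 : R) <= z.1).
    by apply: measurable_fun_ler; [exact: measurable_snd|exact: measurable_fst].
  rewrite (_ : (fun z => _) = (fun z => if (z.2 : R) <= z.1 then 1 else 0)).
    exact: measurable_fun_ifT.
  by apply/funext => z; case: ifP.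
have LK : L1 (leb \x leb)%E (`[a, b]%classic `*` setT) K.
  have h := L1_norm (measurable_slab a b) Lfg.
  apply: (le_L1 _ _ h); first exact: measurable_slab.
    rewrite /K; under [X in measurable_fun _ X]funext do rewrite mulrA.
    apply: measurable_funM; last exact: measurable_funTS.
    exact: L1_measurable (measurable_slab _ _) Lfg.
  move=> z _; rewrite /K !normrM mulrA ler_piMr// ?mulr_ge0//.
  by case: ((z.2 : R) <= z.1); rewrite ?normr1 ?normr0.
have := slab_Fubini LK.
have -> : \int[leb]_(s in `[a, b]) \int[leb]_w K (s, w) =
   \int[leb]_(s in `[a, b]) (f s * \int[leb]_(r in `[a, s]) g r).
  apply: eq_Rintegral => s /set_mem /=; rewrite in_itv /= => /andP[as_ sb].
  have Lgs := L1_subitv (lexx a) sb Lg.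
  rewrite -RintegralZ// [RHS]Rintegral_mkcond.
  apply: eq_Rintegral => r _; rewrite /K /= !patchE.
  have [rs|sr] := leP r s; rewrite ?mulr1 ?mulr0.
    have -> : (r \in `[a, s]%classic) = (r \in `[a, b]%classic).
      by apply/idP/idP; rewrite !inE /= !in_itv /= => /andP[-> _] //=;
        rewrite (le_trans rs sb).
    by case: ifP; rewrite ?mulr0.
  rewrite memNset// /= in_itv /= => /andP[_].
  by rewrite leNgt sr.
have -> : \int[leb]_w \int[leb]_(s in `[a, b]) K (s, w) =
   \int[leb]_(r in `[a, b]) (g r * (\int[leb]_(s in `[a, b]) f s -
     \int[leb]_(s in `[a, r]) f s)).
  rewrite [RHS]Rintegral_mkcond; apply: eq_Rintegral => r _.
  rewrite !patchE; case: ifPn => [/set_mem/= |nr].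
    rewrite in_itv /= => /andP[ar rb].
    have Lfs := L1_subitv ar (lexx b) Lf.
    rewrite (Rintegral_itv_split (s := r) _ Lf) ?ar// addrC addKr.
    rewrite -RintegralZ// [LHS]Rintegral_mkcond [RHS]Rintegral_mkcond.
    apply: eq_Rintegral => s _; rewrite /K /= !patchE.
    rewrite (mem_set (_ : `[a, b]%classic r)); last by rewrite /= in_itv/= ar.
    have [rs|sr] := leP r s; rewrite ?mulr1 ?mulr0.
      have -> : (s \in `[a, b]%classic) = (s \in `[r, b]%classic).
        by apply/idP/idP; rewrite !inE /= !in_itv /= => /andP[h ->];
          rewrite ?rs ?(le_trans ar rs).
      by case: ifP => // _; rewrite mulrC.
    rewrite [in RHS]memNset ?if_same// /= in_itv /= => /andP[].
    by rewrite leNgt sr.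
  under eq_Rintegral do rewrite /K /= patchE (negbTE nr) mul0r mulr0.
  by rewrite Rintegral_cst// mul0r.
move=> <-.
have Lgf := L1_mul_prim ab Lg Lf.
have Lc := L1Z (\int[leb]_(s in `[a, b]) f s) (measurable_time a b) Lg.
under eq_Rintegral do rewrite mulrBr [X in X - _]mulrC.
by rewrite RintegralB// subrK RintegralZ.
Qed.

(** Absolute continuity in the form in which it is used: [u] is an indefinite
    integral on [[a, b]], with a chosen derivative [u']. *)
Definition abs_cont a b u u' := L1 leb `[a, b] u' /\
  forall s, a <= s <= b -> u s = u a + \int[leb]_(r in `[a, s]) u' r.

Lemma eq_abs_cont a b u u' v v' : a <= b ->
  (forall s, a <= s <= b -> u s = v s) ->
  (forall s, a <= s <= b -> u' s = v' s) ->
  abs_cont a b u u' -> abs_cont a b v v'.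
Proof.
move=> ab uv uv' [Lu hu]; split.
  by apply: (eq_L1 _ _ Lu) => // s /=; rewrite in_itv /= => /uv'.
move=> s /[dup] sI /andP[as_ sb]; rewrite -!uv ?lexx// hu//; congr (_ + _).
apply: eq_Rintegral => r /set_mem /=; rewrite in_itv /= => /andP[ar rs].
by rewrite uv'// ar (le_trans rs).
Qed.

Lemma prim_start a f : \int[leb]_(r in `[a, a]) f r = 0.
Proof. by rewrite set_itv1 Rintegral_set1. Qed.

Lemma abs_cont_prim a b f : L1 leb `[a, b] f ->
  abs_cont a b (fun s => \int[leb]_(r in `[a, s]) f r) f.
Proof. by move=> Lf; split => // s _; rewrite prim_start add0r. Qed.

Lemma abs_contS a b s u u' : s <= b -> abs_cont a b u u' -> abs_cont a s u u'.
Proof.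
move=> sb [Lu hu]; split; first exact: L1_subitv Lu.
by move=> r /andP[ar rs]; apply: hu; rewrite ar (le_trans rs).
Qed.

Lemma abs_cont_continuous a b u u' : a <= b -> abs_cont a b u u' ->
  {within `[a, b], continuous u}.
Proof.
move=> ab [Lu hu].
have cc : {within `[a, b], continuous
    (fun s => u a + \int[leb]_(r in `[a, s]) u' r)}.
  have cp := prim_continuous ab Lu.
  by move=> x; apply: cvgD; [exact: cvg_cst|exact: cp].
apply: subspace_eq_continuous cc => s /set_mem /=.
by rewrite in_itv /= => /hu.
Qed.

Lemma abs_cont_ess_bounded a b u u' : a <= b -> abs_cont a b u u' ->
  ess_bounded leb `[a, b] u.
Proof.
move=> ab hu; have cu := abs_cont_continuous ab hu.
split; first exact: within_continuous_measurable.
case: hu => Lu hu.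
exists (`|u a| + \int[leb]_(r in `[a, b]) `|u' r|); apply: aeW => s /=.
rewrite in_itv /= => sI; rewrite (hu _ sI) (le_trans (ler_normD _ _))// lerD2l.
by case/andP: sI => _ sb; exact: prim_bound.
Qed.

(** The product rule, which is integration by parts once the initial values of
    both factors are split off. *)
Lemma abs_cont_mul a b u u' v v' : a <= b ->
  abs_cont a b u u' -> abs_cont a b v v' ->
  abs_cont a b (fun s => u s * v s) (fun s => u' s * v s + u s * v' s).
Proof.
move=> ab hu hv; have mI := measurable_time a b.
have bu := abs_cont_ess_bounded ab hu; have bv := abs_cont_ess_bounded ab hv.
have L1uv : L1 leb `[a, b] (fun s => u' s * v s).
  by apply: (eq_L1 mI _ (L1_ess_bounded mI bv hu.1)) => s _; rewrite mulrC.
have L2uv : L1 leb `[a, b] (fun s => u s * v' s).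
  exact: L1_ess_bounded mI bu hv.1.
split; first exact: L1D.
move=> s /andP[as_ sb]; have {L1uv L2uv} mS := measurable_time a s.
case: (abs_contS sb hu) => Lu eu; case: (abs_contS sb hv) => Lv ev.
have -> : \int[leb]_(r in `[a, s]) (u' r * v r + u r * v' r) =
    \int[leb]_(r in `[a, s])
      ((v a * u' r + u' r * (\int[leb]_(q in `[a, r]) v' q)) +
       (u a * v' r + v' r * (\int[leb]_(q in `[a, r]) u' q))).
  apply: eq_Rintegral.
  move=> r /set_mem /=; rewrite in_itv /= => rI.
  by rewrite (eu r rI) (ev r rI); ring.
have L1p := L1_mul_prim as_ Lu Lv; have L2p := L1_mul_prim as_ Lv Lu.
have L3p := L1Z (v a) mS Lu; have L4p := L1Z (u a) mS Lv.
rewrite (RintegralD mS (L1D mS L3p L1p) (L1D mS L4p L2p)).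
rewrite (RintegralD mS L3p L1p) (RintegralD mS L4p L2p) !RintegralZ//.
have := integral_by_parts as_ Lu Lv.
have ss : a <= s <= s by rewrite as_ lexx.
rewrite (eu s ss) (ev s ss).
set A := \int[leb]_(x in _) (u' x * _); set B := \int[leb]_(x in _) (v' x * _).
set C := \int[leb]_(x in _) u' x; set E := \int[leb]_(x in _) v' x.
move=> h; have -> : (u a + C) * (v a + E) = u a * v a + u a * E + v a * C + C * E by ring.
by rewrite -h; ring.
Qed.

(** The product rule for an absolutely continuous [phi] and a semimartingale [p].
    Up to the drift [- g], the path [p] is [nu - J], where [J s] stands for the
    increment of a martingale from [s] to [b]. Since [phi] has finite variation the
    stochastic integral of [phi] can be avoided: by parts it becomes
    [phi a * J a] plus the Lebesgue integral of [q * J]. *)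
Lemma abs_cont_ito a b phi q g p J nu : a <= b -> abs_cont a b phi q ->
  L1 leb `[a, b] g -> L1 leb `[a, b] (fun s => q s * J s) ->
  (forall s, a <= s <= b -> p s = nu - J s - \int[leb]_(r in `[a, s]) g r) ->
  J b = 0 ->
  phi b * p b = phi a * p a + \int[leb]_(s in `[a, b]) (q s * p s - phi s * g s)
    + (phi a * J a + \int[leb]_(s in `[a, b]) (q s * J s)).
Proof.
move=> ab hphi Lg LqJ hp Jb; have mI := measurable_time a b.
have aI : a <= a <= b by rewrite lexx.
have bI : a <= b <= b by rewrite lexx ab.
have [LqG eqG] := abs_cont_mul ab hphi (abs_cont_prim Lg).
have [Lq ephi] := hphi.
have Lnq := L1Z nu mI Lq.
have -> : \int[leb]_(s in `[a, b]) (q s * p s - phi s * g s) =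
    \int[leb]_(s in `[a, b]) ((nu * q s - q s * J s) -
      (q s * \int[leb]_(r in `[a, s]) g r + phi s * g s)).
  apply: eq_Rintegral.
  move=> s /set_mem /=; rewrite in_itv /= => /hp ->; ring.
rewrite (RintegralB mI (L1B mI Lnq LqJ) LqG) (RintegralB mI Lnq LqJ).
rewrite RintegralZ//.
have := eqG b bI; rewrite prim_start => h1.
have := ephi b bI => h2.
rewrite (hp a aI) (hp b bI) Jb prim_start.
have -> : \int[leb]_(r in `[a, b]) q r = phi b - phi a by rewrite h2 addrC addKr.
move: h1; set X := \int[leb]_(r in _) (q _ * _ + _) => h1.
have -> : X = phi b * \int[leb]_(r in `[a, b]) g r by rewrite h1; ring.
ring.
Qed.

(** The damping term only decreases [u ^+ 2], whose derivative is therefore at most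
    [2 * `|u| * `|f|]. At a point [c] where [`|u|] is maximal this gives
    [u c ^+ 2 <= u a ^+ 2 + 2 * `|u c| * k], with [k] the integral of [`|f|], and a
    quadratic inequality of this kind forces the bound. *)
Lemma dissipative_bound a b u r f : a <= b ->
  abs_cont a b u (fun s => - (r s * u s) + f s) -> L1 leb `[a, b] f ->
  (forall s, a <= s <= b -> 0 <= r s) ->
  forall s, a <= s <= b ->
    `|u s| <= `|u a| + 2 * \int[leb]_(q in `[a, b]) `|f q|.
Proof.
move=> ab hu Lf r0.
have hu2 := abs_cont_mul ab hu hu.
have cu2 := abs_cont_continuous ab hu2.
have [c cI cmax] := EVT_max ab cu2.
have cmax' s : a <= s <= b -> `|u s| <= `|u c|.
  move=> sI; rewrite -(ler_pXn2r (n := 2)) ?nnegrE// !real_normK ?num_real//.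
  by rewrite !expr2; apply: cmax; rewrite in_itv.
have {}cI : a <= c <= b by rewrite in_itv in cI.
set k := \int[leb]_(q in `[a, b]) `|f q|.
have k0 : 0 <= k by exact: Rintegral_ge0.
suff h : `|u c| <= `|u a| + 2 * k by move=> s /cmax' /le_trans; apply.
have [_ /(_ c cI) e] := hu2.
have /andP[ac cb] := cI.
have mc := measurable_time a c.
have [Lu2 _] := abs_contS cb hu2.
have Lnf := L1_norm mc (L1_subitv (lexx a) cb Lf).
have h1 : \int[leb]_(q in `[a, c]) ((- (r q * u q) + f q) * u q + u q * (- (r q * u q) + f q))
    <= 2 * `|u c| * k.
  apply: (@le_trans _ _ (\int[leb]_(q in `[a, c]) (2 * `|u c| * `|f q|))).
    apply: le_Rintegral => //; first exact: L1Z.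
    move=> q /=; rewrite in_itv /= => /andP[aq qc].
    have qI : a <= q <= b by rewrite aq (le_trans qc).
    have h2 : u q * f q <= `|u c| * `|f q|.
      by rewrite (le_trans (ler_norm _))// normrM ler_wpM2r// cmax'.
    have h3 : 0 <= r q * u q ^+ 2 by rewrite mulr_ge0 ?sqr_ge0// r0.
    rewrite -mulrA; move: h2 h3; nra.
  rewrite RintegralZ// ler_wpM2l ?mulr_ge0//.
  rewrite [leRHS](Rintegral_itv_split cI); last exact: L1_norm.
  by rewrite lerDl Rintegral_ge0.
have h2 : `|u c| ^+ 2 <= `|u a| ^+ 2 + 2 * `|u c| * k.
  by rewrite !real_normK ?num_real// !expr2 e lerD2l.
have := cmax' a; rewrite lexx ab => /(_ isT) h3.
have := normr_ge0 (u a).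
move: h2 h3 k0; set x := `|u c|; set y := `|u a| => h2 h3 k0 y0.
rewrite leNgt; apply/negP => h4; nra.
Qed.

End AbsCont.

(** * Densities and the first moment of a centred normal law *)

Section Density.
Local Open Scope ereal_scope.
Context {d : measure_display} {T : measurableType d} {R : realType}.
Variables (mu nu : {measure set T -> \bar R}) (h : T -> R).
Hypothesis mh : measurable_fun setT h.
Hypothesis h0 : forall x, (0 <= h x)%R.
Hypothesis nuE : forall A, measurable A -> nu A = \int[mu]_(x in A) (h x)%:E.

Import HBNNSimple.

Let integral_density_nnsfun (f : {nnsfun T >-> R}) :
  \int[nu]_x (f x)%:E = \int[mu]_x ((f x)%:E * (h x)%:E).
Proof.
under [LHS]eq_integral do rewrite fimfunE -fsumEFin//.
rewrite [LHS]ge0_integral_fsum//; last 2 first.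
  - by move=> r; exact/measurable_EFinP/measurableT_comp.
  - by move=> n x _; rewrite EFinM nnfun_muleindic_ge0.
under [RHS]eq_integral.
  move=> x xD; rewrite fimfunE -fsumEFin// muleC ge0_mule_fsumr; last first.
    by move=> r; rewrite EFinM nnfun_muleindic_ge0.
  over.
rewrite [RHS]ge0_integral_fsum//; last 2 first.
  - move=> r; apply: emeasurable_funM; first exact/measurable_EFinP.
    by apply/measurable_EFinP; apply/measurableT_comp.
  - move=> n x _; apply: mule_ge0; first by rewrite lee_fin.
    by rewrite EFinM nnfun_muleindic_ge0.
apply: eq_fsbigr => r _.
have mr : measurable (f @^-1` [set r]) by [].
rewrite integralZl_indic_nnsfun//= integral_indic// setIT nuE//.
have [r0|r0] := leP 0%R r.
  rewrite -ge0_integralZl//; last 2 first.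
  - exact/measurable_EFinP/measurable_funTS.
  - by move=> x _; rewrite lee_fin.
  rewrite [LHS]integral_mkcond; apply: eq_integral => x _.
  rewrite patchE indicE; case: ifPn => _ /=.
    by rewrite mulr1 muleC.
  by rewrite mulr0 mule0.
rewrite preimage_nnfun0// integral_set0 mule0.
by rewrite (eq_integral (cst 0)) ?integral0// => x _; rewrite indic0 mulr0 mule0.
Qed.

(** Monotone convergence along simple functions, on which the claim is the
    hypothesis [nuE]. *)
Lemma ge0_integral_density (f : T -> \bar R) : measurable_fun setT f ->
  (forall x, 0 <= f x) -> \int[nu]_x f x = \int[mu]_x (f x * (h x)%:E).
Proof.
move=> mf f0; pose f_ := nnsfun_approx measurableT mf.
have cf x : EFin \o f_ ^~ x @ \oo --> f x by exact: cvg_nnsfun_approx.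
transitivity (lim (\int[nu]_x (f_ n x)%:E @[n --> \oo])).
  rewrite -monotone_convergence//=.
  - by apply: eq_integral => x _; apply/esym/cvg_lim => //; exact: cf.
  - by move=> n; exact/measurable_EFinP/measurable_funTS.
  - by move=> n x _; rewrite lee_fin.
  - by move=> x _ a b ab; rewrite lee_fin//; exact/lefP/nd_nnsfun_approx.
rewrite [RHS](_ : _ = lim (\int[mu]_x ((f_ n x)%:E * (h x)%:E) @[n --> \oo])).
  by apply: congr_lim; apply/funext => n /=; exact: integral_density_nnsfun.
rewrite -monotone_convergence//=.
- apply: eq_integral => x _; apply/esym/cvg_lim => //.
  by apply: cvgeZr => //; exact: cf.
- move=> n; apply: emeasurable_funM; last exact/measurable_EFinP.
  by apply/measurable_EFinP/measurable_funTS.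
- by move=> n x _; rewrite mule_ge0// lee_fin.
- move=> x _ a b ab; rewrite lee_wpmul2r ?lee_fin//.
  exact/lefP/nd_nnsfun_approx.
Qed.

End Density.

Section NormalMoments.
Context {R : realType} (s : R).
Hypothesis s0 : s != 0.
Notation leb := (@lebesgue_measure R).

Let N := normal_prob 0 s : probability _ R.

(** With [c := 1 / (4 s^2)] the exponent of the density is [- 2 c x^2], and [`|x|] is
    at most a constant times [1 + c x^2 <= exp (c x^2)]. This leaves a multiple of
    the density of the normal law of variance [2 s^2], which is integrable. *)
Lemma normal_prob_abs_moment : (\int[N]_x (`|x|)%:E < +oo)%E.
Proof.
have mh : measurable_fun setT (normal_pdf 0 s : measurableTypeR R -> R).
  exact: measurable_normal_pdf.
have h0 := normal_pdf_ge0 0 s.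
rewrite (@ge0_integral_density _ _ R leb N _ mh h0 (fun A _ => erefl))//; last first.
  by apply/measurable_EFinP; exact: normr_measurable.
pose s2 := Num.sqrt 2 * s.
have s20 : s2 != 0 by rewrite mulf_neq0// gt_eqF// sqrtr_gt0.
have mh2 : measurable_fun setT (normal_pdf 0 s2 : measurableTypeR R -> R).
  exact: measurable_normal_pdf.
pose c := (s ^+ 2 *+ 4)^-1.
have c0 : 0 < c by rewrite invr_gt0 pmulrn_lgt0// exprn_even_gt0.
pose K := (1 + c^-1) * normal_peak s / normal_peak s2.
have pk := normal_peak_gt0 s20; have pk1 := normal_peak_gt0 s0.
have LK := L1Z K measurableT (integrable_normal_pdf 0 s2 : L1 leb setT _).
apply: le_lt_trans (integrable_lty measurableT LK).
apply: ge0_le_integral => //.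
- by move=> x _; rewrite mule_ge0// lee_fin.
- apply: emeasurable_funM; apply/measurable_EFinP.
    exact: normr_measurable.
  exact: mh.
- apply/measurable_EFinP; apply: measurable_funM => //; exact: mh2.
move=> x _; rewrite -EFinM lee_fin !normal_pdfE// /normal_fun !subr0 /K.
have -> : s2 ^+ 2 *+ 2 = s ^+ 2 *+ 4.
  by rewrite exprMn sqr_sqrtr//; ring.
have -> : - x ^+ 2 / (s ^+ 2 *+ 2) = - (c * x ^+ 2) + - (c * x ^+ 2).
  by rewrite /c; field.
have -> : - x ^+ 2 / (s ^+ 2 *+ 4) = - (c * x ^+ 2).
  by rewrite /c mulrC mulrN.
rewrite expRD; set e := expR _.
have e0 : 0 < e by exact: expR_gt0.
rewrite [leRHS](_ : _ = normal_peak s * ((1 + c^-1) * e)); last first.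
  by field; rewrite !gt_eqF.
rewrite mulrCA ler_wpM2l//; first exact: ltW.
have h1 : 1 + c * x ^+ 2 <= e^-1 by rewrite -expRN opprK expR_ge1Dx.
have h2 : `|x| <= (1 + c^-1) * (1 + c * x ^+ 2).
  have -> : (1 + c^-1) * (1 + c * x ^+ 2) = 1 + c^-1 + c * x ^+ 2 + x ^+ 2.
    by field; rewrite gt_eqF.
  rewrite -(real_normK (num_real x)).
  have := normr_ge0 x; have : 0 < c^-1 by rewrite invr_gt0.
  have := sqr_ge0 (`|x| - 1); have : 0 <= c * `|x| ^+ 2.
    by rewrite mulr_ge0 ?sqr_ge0 ?ltW.
  nra.
have h3 : (1 + c * x ^+ 2) * e <= 1.
  by rewrite -[leRHS](mulVf (lt0r_neq0 e0)) ler_wpM2r// ltW.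
rewrite mulrA; apply: (@le_trans _ _ ((1 + c^-1) * ((1 + c * x ^+ 2) * e) * e)).
  by rewrite mulrA ler_wpM2r ?ler_wpM2r// ltW.
apply: ler_wpM2r; first exact: ltW.
by rewrite ler_piMr// addr_ge0// invr_ge0 ltW.
Qed.

Lemma normal_probN (A : set R) : measurable A ->
  normal_prob 0 s (-%R @^-1` A) = normal_prob 0 s A.
Proof.
move=> mA; rewrite /normal_prob.
have mN : measurable_fun setT (-%R : measurableTypeR R -> measurableTypeR R).
  exact: oppr_measurable.
transitivity (\int[pushforward leb (-%R : _ -> measurableTypeR R)]_(x in A)
    (normal_pdf 0 s x)%:E)%E; last first.
  by apply: eq_measure_integral => B mB _; exact: lebesgue_measureN.
rewrite ge0_integral_pushforward//; last 2 first.
- by apply/measurable_EFinP/measurable_funTS; exact: measurable_normal_pdf.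
- by move=> x _; rewrite lee_fin normal_pdf_ge0.
by apply: eq_integral => x _ /=; rewrite !normal_pdfE// /normal_fun !subr0 sqrrN.
Qed.

Lemma normal_prob_symmetric (f : measurableTypeR R -> \bar R) : measurable_fun setT f ->
  (forall x, 0 <= f x)%E ->
  (\int[N]_x f (- x)%R = \int[N]_x f x)%E.
Proof.
move=> mf f0.
have mN : measurable_fun setT (-%R : measurableTypeR R -> measurableTypeR R)
    by exact: oppr_measurable.
transitivity (\int[pushforward N (-%R : _ -> measurableTypeR R)]_x f x)%E.
  by rewrite ge0_integral_pushforward.
by apply: eq_measure_integral => B mB _; exact: normal_probN.
Qed.

End NormalMoments.

(** * Brownian increments are orthogonal to the past *)

Section Orthogonality.
Context {R : realType} {dO : measure_display} {Omega : measurableType dO}.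
Variable P : probability Omega R.
Variable G0 : set (set Omega).
Hypothesis G0_sub : forall A, <<s G0 >> A -> measurable A.

Lemma gen_measurable_fun (f : Omega -> R) :
  measurable_fun [set: g_sigma_algebraType G0]
    (f : g_sigma_algebraType G0 -> R) -> measurable_fun setT f.
Proof. by move=> mf mT Y mY; apply: G0_sub; exact: mf. Qed.

Import HBNNSimple.

(** Uniform approximation by simple functions passes from events to integrands. *)
(** From events to integrands: the claim is linear in [g], holds for simple
    functions, and passes to the limit by dominated convergence because the simple
    approximations of a nonnegative [g] stay below [g]. Only the product has to be
    integrable, so it serves both bounded integrands against Brownian increments
    and merely integrable ones against bounded martingale increments. *)
Lemma integral_mul_eq0 (X g : Omega -> R) :
  L1 P setT X ->
  measurable_fun [set: g_sigma_algebraType G0]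
    (g : g_sigma_algebraType G0 -> R) ->
  L1 P setT (fun w => g w * X w) ->
  (forall A, <<s G0 >> A -> \int[P]_(w in A) X w = 0) ->
  \int[P]_w (g w * X w) = 0.
Proof.
move=> LX; have mX := L1_measurable measurableT LX.
pose T' := g_sigma_algebraType G0.
suff main : forall h : Omega -> R, (forall w, 0 <= h w) ->
    measurable_fun [set: T'] (h : T' -> R) -> L1 P setT (fun w => h w * X w) ->
    (forall A, <<s G0 >> A -> \int[P]_(w in A) X w = 0) ->
    \int[P]_w (h w * X w) = 0.
  move=> mg LgX X0.
  have mp : measurable_fun [set: T'] (fun w : T' => Num.max (g w) 0).
    exact: measurable_maxr.
  have mn : measurable_fun [set: T'] (fun w : T' => Num.max (- g w) 0).
    by apply: measurable_maxr => //; exact: measurableT_comp.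
  have LnX := L1_norm measurableT LgX.
  have Lp : L1 P setT (fun w => Num.max (g w) 0 * X w).
    apply: (le_L1 measurableT _ LnX).
      by apply: measurable_funM => //; exact: gen_measurable_fun.
    move=> w _; rewrite !normrM ler_wpM2r//.
    by rewrite /Num.max; case: ifP; rewrite ?normr0.
  have Ln : L1 P setT (fun w => Num.max (- g w) 0 * X w).
    apply: (le_L1 measurableT _ LnX).
      by apply: measurable_funM => //; exact: gen_measurable_fun.
    move=> w _; rewrite !normrM ler_wpM2r// -(normrN (g w)).
    by rewrite /Num.max; case: ifP; rewrite ?normr0.
  have -> : (fun w => g w * X w) =
      (fun w => Num.max (g w) 0 * X w - Num.max (- g w) 0 * X w).
    apply/funext => w; rewrite -mulrBl; congr (_ * _).
    by rewrite /Num.max; case: ifP; case: ifP; lra.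
  rewrite RintegralB// (main (fun w => Num.max (g w) 0))//.
    rewrite (main (fun w => Num.max (- g w) 0))// ?subrr// => w.
    by rewrite le_max lexx orbT.
  by move=> w; rewrite le_max lexx orbT.
move=> h h0 mh LhX X0.
have mEh : measurable_fun [set: T'] (EFin \o h : T' -> \bar R).
  exact/measurable_EFinP.
pose h_ := nnsfun_approx (measurableT : measurable [set: T']) mEh.
have mh_ n : measurable_fun setT (h_ n : Omega -> R).
  by apply: gen_measurable_fun; exact: (@measurable_funPT _ _ _ _ (h_ n)).
have h0E w : [set: T'] w -> (0 <= (EFin \o h) w)%E by rewrite lee_fin.
have ch w : EFin \o h_ ^~ w @ \oo --> (h w)%:E.
  exact: cvg_nnsfun_approx.
have h_le n w : h_ n w <= h w.
  by rewrite -lee_fin /h_ nnsfun_approxE; exact: (le_approx n h0E).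
have L1i B : <<s G0 >> B -> L1 P setT (fun w => \1_B w * X w).
  move=> GB; apply: (le_L1 measurableT _ (L1_norm measurableT LX)).
    by apply: measurable_funM => //; apply: measurable_indic; exact: G0_sub.
  move=> w _; rewrite normrM indicE ler_piMl//.
  by case: (_ \in _); rewrite ?normr1 ?normr0.
have step n : \int[P]_w (h_ n w * X w) = 0.
  have mB y : <<s G0 >> ((h_ n) @^-1` [set y]).
    have m1 := @measurable_funPT _ _ _ _ (h_ n).
    by have := m1 measurableT [set y] (measurable_set1 y); rewrite setTI.
  have -> : (fun w => h_ n w * X w) = (fun w =>
      \sum_(y <- finmap.enum_fset (fset_set (range (h_ n))))
        (y * (\1_(h_ n @^-1` [set y]) w * X w))).
    apply/funext => w; rewrite (fimfunE (h_ n)) fsbig_finite//= mulr_suml.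
    by apply: eq_bigr => y _; rewrite mulrA.
  rewrite Rintegral_sum//; last by move=> y; apply: L1Z => //; exact: L1i.
  rewrite big1// => y _; rewrite RintegralZ//; last exact: L1i.
  have -> : \int[P]_w (\1_(h_ n @^-1` [set y]) w * X w) =
      \int[P]_(w in h_ n @^-1` [set y]) X w.
    rewrite [RHS]Rintegral_mkcond; apply: eq_Rintegral => w _.
    by rewrite patchE indicE; case: ifP; rewrite ?mul1r ?mul0r.
  by rewrite X0 ?mulr0.
have dom : {ae P, forall w n, [set: Omega] w ->
   (`|(h_ n w * X w)%:E| <= `|(h w * X w)%:E|)%E}.
  apply: aeW => w n _; rewrite lee_fin !normrM ler_wpM2r//.
  by rewrite !ger0_norm ?h_le.
have LEhX := integrable_abse LhX.
have := @dominated_convergence _ _ _ P setT measurableT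
  (fun n w => (h_ n w * X w)%:E) (fun w => (h w * X w)%:E)
  (fun w => `|(h w * X w)%:E|%E) _ _ _ LEhX dom.
case=> //.
- move=> n; apply/measurable_EFinP.
  by apply: measurable_funM => //; exact: mh_.
- exact: (measurable_int P LhX).
- apply: aeW => w _; under eq_fun do rewrite EFinM.
  by rewrite EFinM; apply: cvgeZr => //; exact: ch.
move=> _ _; rewrite [X in X @ _](_ : _ = cst 0%E); last first.
  apply/funext => n /=.
  have Ln : L1 P setT (fun w => h_ n w * X w).
    apply: (le_L1 measurableT _ (L1_norm measurableT LhX)).
      by apply: measurable_funM => //; exact: mh_.
    by move=> w _; rewrite !normrM ler_wpM2r// !ger0_norm ?h_le.
  by rewrite (L1E measurableT Ln) step.
move=> /(cvg_lim _) /=; rewrite lim_cst//.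
by rewrite /Rintegral => <-.
Qed.

End Orthogonality.

Section BrownianIncrements.
Context {R : realType} {dO : measure_display} {Omega : measurableType dO}.
Variables (P : probability Omega R) (T : R) (W : R -> Omega -> R).
Notation F := (brownian_gen P W).
Hypothesis hW : std_brownian P F T W.
Hypothesis hF : forall A : set Omega, measurable A <-> <<s F T >> A.

Lemma brownian_gen_mono s t : s <= t -> F s `<=` F t.
Proof.
move=> st A [[r [B [/andP[r0 rs] mB ->]]]|nA]; [left|by right].
by exists r, B; rewrite r0 (le_trans rs).
Qed.

Lemma filtration_mono s t : s <= t -> <<s F s >> `<=` <<s F t >>.
Proof. by move=> st; apply: sub_sigma_algebra2; exact: brownian_gen_mono. Qed.

Lemma filtration_sub t : t <= T -> forall A, <<s F t >> A -> measurable A.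
Proof. by move=> tT A hA; apply/hF; exact: filtration_mono hA. Qed.

Lemma F_measurable_mono s t (f : Omega -> R) : s <= t ->
  F_measurable F s f -> F_measurable F t f.
Proof.
by move=> st mf mT Y mY; apply: (filtration_mono st); exact: mf.
Qed.

Lemma F_measurable_fun t (f : Omega -> R) : t <= T ->
  F_measurable F t f -> measurable_fun setT f.
Proof. by move=> tT; apply: gen_measurable_fun; exact: filtration_sub. Qed.

Lemma brownian_measurable t : 0 <= t <= T -> measurable_fun setT (W t).
Proof.
by case: hW => h _ _ _ _ /[dup] tT /h; apply: F_measurable_fun; case/andP: tT.
Qed.

(** Independence says that on an event of the past the increment still has its
    normal law, rescaled by the probability of the event; two measures that agree
    on Borel sets have the same integrals. *)
Lemma increment_law s t A (f : R -> \bar R) : 0 <= s -> s < t -> t <= T ->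
  <<s F s >> A -> measurable_fun setT f -> (forall x, (0 <= f x)%E) ->
  (\int[P]_(w in A) f (increment W s t w) =
   P A * \int[normal_prob 0 (Num.sqrt (t - s))]_x f x)%E.
Proof.
move=> s0 st tT hA mf f0.
have mA : measurable A by apply: filtration_sub hA; rewrite (le_trans (ltW st)).
have mD : measurable_fun setT (increment W s t : Omega -> measurableTypeR R).
  apply: measurable_funB; apply: brownian_measurable.
    by rewrite tT (le_trans s0 (ltW st)).
  by rewrite s0 (le_trans (ltW st)).
have mfD : measurable_fun setT (f \o increment W s t).
  exact: measurableT_comp mf mD.
pose Q := mrestr P mA.
have QE B : measurable B -> Q B = (\int[P]_(x in B) (\1_A x)%:E)%E.
  by move=> mB; rewrite integral_indic// setIC.
have PA : P A \is a fin_num by exact: fin_num_measure.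
have k0 : 0 <= fine (P A) by exact: fine_ge0.
pose k := NngNum k0.
transitivity (\int[Q]_w (f \o increment W s t) w)%E.
  rewrite (@ge0_integral_density _ _ _ P Q (\1_A) _ _ QE)//; last first.
    by move=> w; exact: f0.
  rewrite [LHS]integral_mkcond; apply: eq_integral => w _.
  by rewrite patchE indicE; case: ifP; rewrite ?mule1 ?mule0.
transitivity (\int[pushforward Q (increment W s t : _ -> measurableTypeR R)]_x f x)%E.
  by rewrite ge0_integral_pushforward.
transitivity (\int[mscale k (normal_prob 0 (Num.sqrt (t - s)))]_x f x)%E.
  apply: eq_measure_integral => B mB _.
  case: hW => _ _ ind law _.
  transitivity (P (A `&` increment W s t @^-1` B)); first by rewrite setIC.
  by rewrite ind// law// -[P A]fineK.
by rewrite ge0_integral_mscale//= fineK.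
Qed.

Lemma increment_L1 s t : 0 <= s -> s <= t -> t <= T ->
  L1 P setT (increment W s t).
Proof.
move=> s0; rewrite le_eqVlt => /predU1P[<- tT|st tT].
  apply: (eq_L1 measurableT _ (L10 P setT)) => w _.
  by rewrite /increment subrr.
apply/integrableP; split.
  apply/measurable_EFinP; apply: measurable_funB; apply: brownian_measurable.
    by rewrite tT (le_trans s0 (ltW st)).
  by rewrite s0 (le_trans (ltW st)).
have := @increment_law s t setT (fun x => `|x%:E|%E) s0 st tT.
rewrite probability_setT mul1e => -> //.
- by apply: normal_prob_abs_moment; rewrite gt_eqF// sqrtr_gt0 subr_gt0.
- exact: (@measurableT _ (g_sigma_algebraType (F s))).
- by apply: measurableT_comp => //; apply/measurable_EFinP.
Qed.

(** The centred normal law is symmetric, so positive and negative parts cancel. *)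
Lemma increment_mean s t A : 0 <= s -> s <= t -> t <= T -> <<s F s >> A ->
  \int[P]_(w in A) increment W s t w = 0.
Proof.
move=> s0; rewrite le_eqVlt => /predU1P[<- _ _|st tT hA].
  rewrite (@eq_Rintegral _ _ _ _ _ (cst 0)).
    by rewrite /Rintegral integral0.
  by move=> w _; rewrite /increment subrr.
have mA : measurable A by apply: filtration_sub hA; rewrite (le_trans (ltW st)).
pose f (x : R) : \bar R := maxe x%:E 0%E.
have mf : measurable_fun (setT : set R) f.
  apply: measurable_maxe => //; exact/measurable_EFinP.
have f0 x : (0 <= f x)%E by rewrite /f le_max lexx orbT.
rewrite /Rintegral integralE.
have -> : (\int[P]_(x in A) (fun w => (increment W s t w)%:E)^\+ x =
    \int[P]_(w in A) f (increment W s t w))%E.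
  by apply: eq_integral => w _; rewrite funeposE.
have -> : (\int[P]_(x in A) (fun w => (increment W s t w)%:E)^\- x =
    \int[P]_(w in A) (f \o -%R) (increment W s t w))%E.
  by apply: eq_integral => w _; rewrite funenegE /f /= EFinN.
have mfN : measurable_fun (setT : set R) (f \o -%R).
  rewrite /f; apply: measurable_maxe => //.
  by apply/measurable_EFinP; exact: oppr_measurable.
have fN0 x : (0 <= (f \o -%R) x)%E by exact: f0.
rewrite !increment_law//.
have ns : Num.sqrt (t - s) != 0 by rewrite gt_eqF// sqrtr_gt0 subr_gt0.
rewrite (normal_prob_symmetric ns mf f0) subee//.
have PA : P A \is a fin_num by exact: fin_num_measure.
apply: fin_numM => //; rewrite ge0_fin_numE; last exact: integral_ge0.
apply: le_lt_trans (normal_prob_abs_moment ns).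
apply: ge0_le_integral => //.
- by apply/measurable_EFinP; exact: normr_measurable.
- by move=> x _; rewrite /f -EFin_max lee_fin ge_max ler_norm normr_ge0.
Qed.

End BrownianIncrements.

(** * The stochastic integral is a martingale *)

Lemma progressive_adapted (R : realType) (dO : measure_display)
    (Omega : measurableType dO) (F : R -> set (set Omega)) (a T : R) (m n : nat)
    (f : R -> Omega -> 'M[R]_(m, n)) : progressive F a T f -> adapted F a T f.
Proof.
move=> pf s sI i j; have as_ : a <= s by case/andP: sI.
have mf := pf s sI i j.
have mD : measurable (`[a, s] `*` [set: g_sigma_algebraType (F s)]).
  by apply: measurableX => //; exact: measurable_itv.
apply: (@measurable_comp _ _ _ _ _ _
  (`[a, s] `*` [set: g_sigma_algebraType (F s)])
  (fun z : R * g_sigma_algebraType (F s) => f z.1 z.2 i j) _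
  (fun w : g_sigma_algebraType (F s) => (s, w))) => //.
- by move=> _ [w _ <-]; split => //=; rewrite in_itv /= as_ lexx.
- exact: measurable_pair1.
Qed.

Section ItoMartingale.
Context {R : realType} {dO : measure_display} {Omega : measurableType dO}.
Variables (P : probability Omega R) (T : R) (W : R -> Omega -> R).
Notation F := (brownian_gen P W).
Hypothesis hW : std_brownian P F T W.
Hypothesis hF : forall A : set Omega, measurable A <-> <<s F T >> A.

Section SimpleProcess.
Variable H : simple_process F T.

Lemma sp_term_L1 i a b : 0 <= a -> a <= b -> b <= T ->
  L1 P setT (fun w => sp_val H i w * (W b w - W a w)).
Proof.
move=> a0 ab bT.
apply: (L1_ess_bounded measurableT _ (increment_L1 hW hF a0 ab bT)).
split.
  have /andP[_ tT] := sp_time_range H i.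
    exact: (F_measurable_fun hF tT (@sp_val_meas _ _ _ _ _ H i)).
by have [K hK] := sp_val_bounded H; exists K; apply: aeW => w _.
Qed.

Lemma sp_integral_L1 t : 0 <= t <= T -> L1 P setT (sp_integral W H t).
Proof.
move=> /andP[t0 tT]; apply: L1_sum => // i.
have /andP[i0 _] := sp_time_range H i.
apply: sp_term_L1; first by rewrite le_min i0.
  by rewrite le_min !ge_min lexx sp_time_mono ?orbT.
by rewrite ge_min tT orbT.
Qed.

(** Between [s] and [T] a term of a simple integral only sees the part of its time
    interval after [s]. *)
Lemma sp_increment i s w : s <= T ->
  W (Num.min (sp_time H i.+1) T) w - W (Num.min (sp_time H i) T) w -
  (W (Num.min (sp_time H i.+1) s) w - W (Num.min (sp_time H i) s) w) =
  W (Num.max (sp_time H i.+1) s) w - W (Num.max (sp_time H i) s) w.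
Proof.
move=> sT.
have /andP[_ t1] := sp_time_range H i.
have /andP[_ t2] := sp_time_range H i.+1.
rewrite (min_idPl t1) (min_idPl t2).
by have [h1|h1] := leP (sp_time H i) s; have [h2|h2] := leP (sp_time H i.+1) s; ring.
Qed.

(** Each term is an increment of the Brownian motion multiplied by a quantity known
    at the beginning of that increment. *)
Lemma sp_integral_martingale s A : 0 <= s <= T -> <<s F s >> A ->
  \int[P]_(w in A) (sp_integral W H T w - sp_integral W H s w) = 0.
Proof.
move=> /andP[s0 sT] hA; have mA : measurable A by exact: (filtration_sub hF sT).
pose X i w := sp_val H i w *
  (W (Num.max (sp_time H i.+1) s) w - W (Num.max (sp_time H i) s) w).
have LX i : L1 P setT (X i).
  have /andP[i0 _] := sp_time_range H i.
  have /andP[_ i1] := sp_time_range H i.+1.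
  apply: sp_term_L1; first by rewrite le_max i0.
    by rewrite ge_max !le_max lexx sp_time_mono ?orbT.
  by rewrite ge_max i1 sT.
transitivity (\int[P]_(w in A) \sum_(i < sp_size H) X i w).
  apply: eq_Rintegral => w _; rewrite /sp_integral -sumrB.
  by apply: eq_bigr => i _; rewrite -mulrBr sp_increment.
have LXA i : L1 P A (X i) by exact: (L1S mA measurableT _ (LX i)).
rewrite Rintegral_sum// big1// => i _.
have /andP[i0 iT] := sp_time_range H i.
have /andP[_ i1] := sp_time_range H i.+1.
set a := Num.max (sp_time H i) s.
set b := Num.max (sp_time H i.+1) s.
have a0 : 0 <= a by rewrite le_max i0.
have ab : a <= b by rewrite ge_max !le_max lexx sp_time_mono ?orbT.
have bT : b <= T by rewrite ge_max i1 sT.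
have e w : (\1_A w * sp_val H i w) * increment W a b w = (X i \_ A) w.
  by rewrite patchE indicE; case: ifP; rewrite ?mul1r ?mul0r.
rewrite Rintegral_mkcond.
transitivity (\int[P]_w ((\1_A w * sp_val H i w) * increment W a b w)).
  by apply: eq_Rintegral => w _; rewrite e.
have aT : a <= T by exact: le_trans bT.
apply: (integral_mul_eq0 (filtration_sub hF aT)).
- exact: (increment_L1 hW hF).
- apply: measurable_funM.
    apply: measurable_indic; apply: filtration_mono hA.
    by rewrite le_max lexx orbT.
  by apply: F_measurable_mono (@sp_val_meas _ _ _ _ _ H i); rewrite le_max lexx.
- have : L1 P setT (X i \_ A).
    have := (integrable_mkcond (EFin \o X i) mA).1 (LXA i).
    by rewrite /L1 restrict_EFin.
  by apply: eq_L1 => // w _; rewrite e.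
- by move=> B hB; exact: (increment_mean hW hF).
Qed.

End SimpleProcess.

Lemma sqr_integral_L1 (f : Omega -> R) : measurable_fun setT f ->
  (\int[P]_w (f w ^+ 2)%:E < +oo)%E -> L1 P setT (fun w => f w ^+ 2).
Proof.
move=> mf hf; apply/integrableP; split.
  by apply/measurable_EFinP; exact: measurable_funX.
by under eq_integral do rewrite /= ger0_norm ?sqr_ge0//.
Qed.

(** A Cauchy-Schwarz inequality for a probability, through
    [`|f| <= e / 2 + f ^+ 2 / (2 * e)]. *)
Lemma sqr_integral_small (f : Omega -> R) (A : set Omega) (e : R) : 0 < e ->
  measurable A -> measurable_fun setT f ->
  (\int[P]_w (f w ^+ 2)%:E < (e ^+ 2)%:E)%E ->
  L1 P setT f /\ `|\int[P]_(w in A) f w| <= e.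
Proof.
move=> e0 mA mf hf.
have L2f : L1 P setT (fun w => f w ^+ 2).
  by apply: sqr_integral_L1 => //; rewrite (lt_le_trans hf)// leey.
have Lc k : L1 P setT (fun=> k) by exact: finite_measure_integrable_cst.
have Lg : L1 P setT (fun w => e / 2 + (2 * e)^-1 * f w ^+ 2).
  by apply: L1D => //; exact: L1Z.
have fg w : `|f w| <= e / 2 + (2 * e)^-1 * f w ^+ 2.
  rewrite -(ler_pM2l (_ : 0 < 2 * e)) ?mulr_gt0// mulrDr mulVKf ?gt_eqF ?mulr_gt0//.
  have -> : 2 * e * (e / 2) = e ^+ 2 by field.
  by rewrite -[f w ^+ 2]real_normK ?num_real//; have := sqr_ge0 (`|f w| - e); nra.
have Lf : L1 P setT f by exact: le_L1 Lg _.
split => //; have LfA := L1S mA measurableT (@subsetT _ A) Lf.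
have Lnf := L1_norm measurableT Lf.
apply: (le_trans (le_normr_Rintegral mA LfA)).
apply: (@le_trans _ _ (\int[P]_w `|f w|)).
  rewrite Rintegral_mkcond; apply: le_Rintegral => //.
    have := (integrable_mkcond (EFin \o (fun w => `|f w|)) mA).1
      (L1S mA measurableT (@subsetT _ A) Lnf).
    by rewrite /L1 restrict_EFin.
  by move=> w _; rewrite patchE; case: ifP => // _; exact: normr_ge0.
apply: (@le_trans _ _ (\int[P]_w (e / 2 + (2 * e)^-1 * f w ^+ 2))).
  exact: le_Rintegral.
rewrite RintegralD//; [|exact: Lc|exact: L1Z].
rewrite [X in _ + X]RintegralZ// Rintegral_cst// -[X in fine X]/(P setT) probability_setT mulr1.
have : \int[P]_w (f w ^+ 2) < e ^+ 2 by rewrite -lte_fin -L1E.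
set x := \int[P]_w _ => hx.
rewrite [leRHS](_ : e = e / 2 + (2 * e)^-1 * e ^+ 2); last by field; rewrite gt_eqF.
by rewrite lerD2l ler_wpM2l ?invr_ge0 ?mulr_ge0 ?ltW.
Qed.

(** Simple integrals are martingales, and convergence in mean square at the times
    [s] and [T] carries the vanishing of the mean to the limit. *)
Lemma ito_martingale (m n : nat) (M I : R -> Omega -> 'M[R]_(m, n)) s A i j :
  ito_integral P F W T M I -> 0 <= s <= T -> <<s F s >> A ->
  \int[P]_(w in A) (I T w i j - I s w i j) = 0.
Proof.
move=> [[pI _] hI] sI hA; have /andP[s0 sT] := sI.
have mA : measurable A by exact: (filtration_sub hF sT).
have TI : 0 <= T <= T by rewrite lexx (le_trans s0).
have [H [_ hH]] := hI i j.
have mI t : 0 <= t <= T -> measurable_fun setT (fun w => I t w i j).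
  move=> tI; have := progressive_adapted pI tI i j.
  by apply: (F_measurable_fun hF); case/andP: tI.
apply/eqP; rewrite -normr_le0; apply/ler_addgt0Pl => e e0; rewrite addr0.
have e20 : 0 < e / 2 by rewrite divr_gt0.
have small t : 0 <= t <= T -> \forall k \near \oo,
    (\int[P]_w ((sp_integral W (H k) t w - I t w i j) ^+ 2)%:E < ((e / 2) ^+ 2)%:E)%E.
  move=> tI; have hc := hH t tI.
  apply: (hc [set y | (y < ((e / 2) ^+ 2)%:E)%E]).
  apply: open_nbhs_nbhs; split.
    exact: open_ereal_lt_ereal.
  by rewrite /= lte_fin exprn_gt0.
have [k [h1 h2]] : exists k,
    (\int[P]_w ((sp_integral W (H k) T w - I T w i j) ^+ 2)%:E < ((e / 2) ^+ 2)%:E)%E /\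
    (\int[P]_w ((sp_integral W (H k) s w - I s w i j) ^+ 2)%:E < ((e / 2) ^+ 2)%:E)%E.
  have [N _ hN] : \forall k \near \oo,
    (\int[P]_w ((sp_integral W (H k) T w - I T w i j) ^+ 2)%:E < ((e / 2) ^+ 2)%:E)%E /\
    (\int[P]_w ((sp_integral W (H k) s w - I s w i j) ^+ 2)%:E < ((e / 2) ^+ 2)%:E)%E.
    have hs := small s sI; have hT := small T TI.
    by near=> k; split; near: k.
  by exists N; apply: hN => /=.
have LS t : 0 <= t <= T -> L1 P setT (sp_integral W (H k) t).
  exact: sp_integral_L1.
have mS t : 0 <= t <= T ->
    measurable_fun setT (fun w => sp_integral W (H k) t w - I t w i j).
  move=> tI; apply: measurable_funB; last exact: mI.
  exact: L1_measurable (LS t tI).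
have [LT bT] := sqr_integral_small e20 mA (mS T TI) h1.
have [Ls bs] := sqr_integral_small e20 mA (mS s sI) h2.
have LA f : L1 P setT f -> L1 P A f by exact: L1S.
have -> : \int[P]_(w in A) (I T w i j - I s w i j) =
  \int[P]_(w in A) ((sp_integral W (H k) T w - sp_integral W (H k) s w) -
   ((sp_integral W (H k) T w - I T w i j) - (sp_integral W (H k) s w - I s w i j))).
  by apply: eq_Rintegral => w _; ring.
rewrite RintegralB//; last 2 first.
- by apply: LA; apply: L1B => //; exact: LS.
- by apply: LA; exact: L1B.
rewrite sp_integral_martingale// sub0r normrN RintegralB//; [|exact: LA..].
rewrite (le_trans (ler_normB _ _))//; lra.
Unshelve. all: by end_near. Qed.

End ItoMartingale.

(** * Matrix algebra of the completed square *)

Section Dotp.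
Context {R : realType}.

Lemma dotpE m (u v : 'cV[R]_m) : dotp u v = \sum_i u i 0 * v i 0.
Proof. by rewrite /dotp mxE; apply: eq_bigr => i _; rewrite mxE. Qed.

Lemma dotpC m (u v : 'cV[R]_m) : dotp u v = dotp v u.
Proof. by rewrite !dotpE; apply: eq_bigr => i _; rewrite mulrC. Qed.

Lemma dotpDl m (u v w : 'cV[R]_m) : dotp (u + v) w = dotp u w + dotp v w.
Proof.
by rewrite !dotpE -big_split; apply: eq_bigr => i _; rewrite mxE mulrDl.
Qed.

Lemma dotpNl m (u v : 'cV[R]_m) : dotp (- u) v = - dotp u v.
Proof. by rewrite !dotpE -sumrN; apply: eq_bigr => i _; rewrite mxE mulNr. Qed.

Lemma dotpDr m (u v w : 'cV[R]_m) : dotp u (v + w) = dotp u v + dotp u w.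
Proof. by rewrite dotpC dotpDl ![dotp _ u]dotpC. Qed.

Lemma dotpNr m (u v : 'cV[R]_m) : dotp u (- v) = - dotp u v.
Proof. by rewrite dotpC dotpNl dotpC. Qed.

Lemma dotp0r m (u : 'cV[R]_m) : dotp u 0 = 0.
Proof. by rewrite /dotp mulmx0 mxE. Qed.

Lemma dotp_mulmx m n (u : 'cV[R]_m) (A : 'M[R]_(m, n)) (v : 'cV[R]_n) :
  dotp u (A *m v) = dotp (A^T *m u) v.
Proof. by rewrite /dotp trmx_mul trmxK mulmxA. Qed.

Lemma dotp_quad m n (u : 'cV[R]_m) (A : 'M[R]_(m, n)) (v : 'cV[R]_n) :
  dotp u (A *m v) = \sum_i \sum_j u i 0 * v j 0 * A i j.
Proof.
rewrite dotpE; apply: eq_bigr => i _; rewrite mxE mulr_sumr.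
by apply: eq_bigr => j _; ring.
Qed.

Lemma dotp_col_mx m n (u1 v1 : 'cV[R]_m) (u2 v2 : 'cV[R]_n) :
  dotp (col_mx u1 u2) (col_mx v1 v2) = dotp u1 v1 + dotp u2 v2.
Proof. by rewrite /dotp tr_col_mx mul_row_col mxE. Qed.

Lemma frob_entry m n (A : 'M[R]_(m, n)) i j : `|A i j| <= frob A.
Proof.
rewrite -sqrtr_sqr /frob ler_wsqrtr// (bigD1 i)//= (bigD1 j)//=.
rewrite -addrA lerDl addr_ge0//.
  by apply: sumr_ge0 => k _; exact: sqr_ge0.
by apply: sumr_ge0 => k _; apply: sumr_ge0 => l _; exact: sqr_ge0.
Qed.

Lemma frob_sqr m n (A : 'M[R]_(m, n)) :
  frob A ^+ 2 = \sum_i \sum_j A i j ^+ 2.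
Proof.
by rewrite sqr_sqrtr// sumr_ge0// => i _; rewrite sumr_ge0// => j _; rewrite sqr_ge0.
Qed.

Lemma pdmx_unit m (A : 'M[R]_m) : pdmx A -> A \in unitmx.
Proof.
move=> [_ pA]; rewrite -row_free_unit -kermx_eq0; apply/negPn/negP.
move=> /rowV0Pn [v /sub_kermxP vA v0].
have : v^T != 0 by apply: contra_neq v0 => h; rewrite -[v]trmxK h trmx0.
move=> /pA; rewrite /dotp trmxK mulmxA vA mul0mx mxE ltxx.
by [].
Qed.

End Dotp.

Section Algebra.
Context {R : realType} {d : nat}.
Variables (Lambda gamma rho Sigma : 'M[R]_d) (p : 'M[R]_(d + d)).
Hypotheses (hL : Lambda \in unitmx) (sL : Lambda^T = Lambda).
Hypotheses (sg : gamma^T = gamma) (sr : rho^T = rho) (sp : p^T = p).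
Variables (x y xi : 'cV[R]_d).

Let B := col_mx (- 1%:M) gamma.
Let E : 'M[R]_(d + d, d) := col_mx 0 1%:M.
Let Dm : 'M[R]_(d + d) := block_mx 0 0 0 (- rho).
Let S : 'M[R]_(d + d) := block_mx Sigma 0 0 0.
Let K := p *m B + E.
Let z := col_mx x y.
Let z' := col_mx (- xi) (- (rho *m y) + gamma *m xi).
Let fb := - (invmx Lambda *m (row_mx (- 1%:M) gamma *m p + row_mx 0 1%:M) *m z).
Let drv := - ((p *m B + E) *m invmx Lambda *m
   (row_mx (- 1%:M) gamma *m p + row_mx 0 1%:M))
  + p *m Dm + Dm *m p + S.

Let KT : row_mx (- 1%:M) gamma *m p + row_mx 0 1%:M = K^T.
Proof.
rewrite /K /B /E linearD /= trmx_mul !tr_col_mx sp sg linearN /= !trmx1 trmx0.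
by [].
Qed.

Let z'E : z' = B *m xi + Dm *m z.
Proof.
rewrite /B /Dm /z /z' mul_col_mx mulNmx mul1mx mul_block_col !mul0mx !addr0 add0r.
by rewrite add_col_mx addr0 mulNmx [- (rho *m y) + _]addrC.
Qed.

Let DmT : Dm^T = Dm.
Proof. by rewrite /Dm tr_block_mx !trmx0 linearN /= sr. Qed.

Let SE : dotp z (S *m z) = dotp x (Sigma *m x).
Proof.
by rewrite /S /z mul_block_col !mul0mx !addr0 dotp_col_mx dotp0r addr0.
Qed.

Let EE : dotp z (E *m xi) = dotp y xi.
Proof.
by rewrite /E /z mul_col_mx mul0mx mul1mx dotp_col_mx dotp0r add0r.
Qed.

(** The pointwise identity behind the theorem. The bracket is the rate of
    [z^T p z] along the state equation when [p] moves with drift [- drv]; the terms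
    in [rho] and [Sigma] cancel, and the Riccati nonlinearity is exactly what
    completes the square of the control around [fb]. *)
Lemma square_identity :
  2^-1 * (dotp z' (p *m z) + dotp z (p *m z') - dotp z (drv *m z)) +
  (2^-1 * dotp xi (Lambda *m xi) + dotp y xi + 2^-1 * dotp x (Sigma *m x)) =
  2^-1 * dotp (xi - fb) (Lambda *m (xi - fb)).
Proof.
rewrite /fb /drv KT.
have -> : dotp z' (p *m z) = dotp z (p *m z') by rewrite dotp_mulmx sp dotpC.
rewrite z'E -EE -SE.
set A1 := invmx Lambda.
have sA1 : A1^T = A1 by rewrite /A1 trmx_inv sL.
have e1 : Lambda *m (A1 *m K^T *m z) = K^T *m z by rewrite !mulmxA mulmxV// mul1mx.
rewrite opprK !mulmxDr e1 !dotpDl !dotpDr.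
have e2 : dotp (A1 *m K^T *m z) (Lambda *m xi) = dotp z (K *m xi).
  by rewrite dotp_mulmx sL e1 -[K in RHS]trmxK dotp_mulmx trmxK.
have e3 : dotp xi (K^T *m z) = dotp z (K *m xi).
  by rewrite dotp_mulmx trmxK dotpC.
have e4 : dotp (A1 *m K^T *m z) (K^T *m z) = dotp z (K *m A1 *m K^T *m z).
  by rewrite dotpC -!mulmxA [RHS]dotp_mulmx.
have e5 : dotp z (Dm *m p *m z) = dotp z (p *m Dm *m z).
  by rewrite dotp_mulmx trmx_mul DmT sp dotpC.
rewrite e2 e3 e4 !mulmxDl !dotpDr mulNmx dotpNr e5 {1 2}/K mulmxDl dotpDr !mulmxA.
by field.
Qed.

Lemma terminal_identity (n : R) :
  2^-1 * dotp z (block_mx n%:M 1%:M 1%:M 0 *m z) =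
  n / 2 * dotp x x + dotp y x.
Proof.
rewrite /z mul_block_col !mul1mx mul0mx addr0 dotp_col_mx dotpDr mul_scalar_mx.
have -> : dotp x (n *: x) = n * dotp x x.
  by rewrite !dotpE mulr_sumr; apply: eq_bigr => i _; rewrite mxE; ring.
by rewrite (dotpC x y); field.
Qed.

End Algebra.

Section Entrywise.
Context {R : realType} {T : Type}.
Variable Q : (T -> R) -> Prop.
Hypothesis Q_cst : forall k, Q (fun=> k).
Hypothesis QD : forall f g, Q f -> Q g -> Q (fun w => f w + g w).
Hypothesis QM : forall f g, Q f -> Q g -> Q (fun w => f w * g w).

(** Boundedness, measurability and square integrability of matrix processes are all
    meant entry by entry; closure under the matrix operations only needs [Q] to
    contain constants and be closed under sums and products. *)
Definition entrywise (m n : nat) (A : T -> 'M[R]_(m, n)) :=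
  forall i j, Q (fun w => A w i j).

Lemma entrywise_cst m n (A : 'M[R]_(m, n)) : entrywise (fun=> A).
Proof. by move=> i j; exact: Q_cst. Qed.

Lemma entrywiseD m n (A B : T -> 'M[R]_(m, n)) :
  entrywise A -> entrywise B -> entrywise (fun w => A w + B w).
Proof.
move=> hA hB i j; under [X in Q X]funext do rewrite mxE.
exact: QD (hA i j) (hB i j).
Qed.

Lemma entrywiseN m n (A : T -> 'M[R]_(m, n)) :
  entrywise A -> entrywise (fun w => - A w).
Proof.
move=> hA i j; under [X in Q X]funext do rewrite mxE -mulN1r.
exact: QM (Q_cst _) (hA i j).
Qed.

Lemma entrywiseM m n k (A : T -> 'M[R]_(m, n)) (B : T -> 'M[R]_(n, k)) :
  entrywise A -> entrywise B -> entrywise (fun w => A w *m B w).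
Proof.
move=> hA hB i j; under [X in Q X]funext do rewrite mxE.
elim: (index_enum _) => [|l s ih].
  by under [X in Q X]funext do rewrite big_nil; exact: Q_cst.
under [X in Q X]funext do rewrite big_cons.
exact: QD (QM (hA i l) (hB l j)) ih.
Qed.

Lemma entrywise_col m1 m2 n (A : T -> 'M[R]_(m1, n)) (B : T -> 'M[R]_(m2, n)) :
  entrywise A -> entrywise B -> entrywise (fun w => col_mx (A w) (B w)).
Proof.
move=> hA hB i j; case: (split_ordP i) => i' ->.
- by under [X in Q X]funext do rewrite col_mxEu.
- by under [X in Q X]funext do rewrite col_mxEd.
Qed.

Lemma entrywise_block m1 m2 n1 n2 (A : T -> 'M[R]_(m1, n1))
    (B : T -> 'M[R]_(m1, n2)) (C : T -> 'M[R]_(m2, n1))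
    (E : T -> 'M[R]_(m2, n2)) :
  entrywise A -> entrywise B -> entrywise C -> entrywise E ->
  entrywise (fun w => block_mx (A w) (B w) (C w) (E w)).
Proof.
move=> hA hB hC hE i j.
case: (split_ordP i) => i' ->; case: (split_ordP j) => j' ->.
- by under [X in Q X]funext do rewrite block_mxEul.
- by under [X in Q X]funext do rewrite block_mxEur.
- by under [X in Q X]funext do rewrite block_mxEdl.
- by under [X in Q X]funext do rewrite block_mxEdr.
Qed.

End Entrywise.

Section MatrixClasses.
Context {d0 : measure_display} {T : measurableType d0} {R : realType}.
Variable mu : {measure set T -> \bar R}.
Variable D : set T.
Hypothesis mD : measurable D.

Definition mx_bounded (m n : nat) (A : T -> 'M[R]_(m, n)) :=
  entrywise (ess_bounded mu D) A.

Definition mx_L2 (m n : nat) (A : T -> 'M[R]_(m, n)) := entrywise (L2 mu D) A.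

Let bc k : ess_bounded mu D (fun=> k) := ess_bounded_cst mu D k.
Let bD (f g : T -> R) (bf : ess_bounded mu D f) (bg : ess_bounded mu D g) :=
  ess_boundedD mD bf bg.
Let bM (f g : T -> R) (bf : ess_bounded mu D f) (bg : ess_bounded mu D g) :=
  ess_boundedM mD bf bg.

Lemma mx_bounded_cst m n (A : 'M[R]_(m, n)) : mx_bounded (fun=> A).
Proof. exact: (entrywise_cst bc). Qed.

Lemma mx_boundedD m n (A B : T -> 'M[R]_(m, n)) :
  mx_bounded A -> mx_bounded B -> mx_bounded (fun w => A w + B w).
Proof. exact: (entrywiseD bD). Qed.

Lemma mx_boundedN m n (A : T -> 'M[R]_(m, n)) :
  mx_bounded A -> mx_bounded (fun w => - A w).
Proof. exact: (entrywiseN bc bM). Qed.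

Lemma mx_boundedM m n k (A : T -> 'M[R]_(m, n)) (B : T -> 'M[R]_(n, k)) :
  mx_bounded A -> mx_bounded B -> mx_bounded (fun w => A w *m B w).
Proof. exact: (entrywiseM bc bD bM). Qed.

Lemma mx_bounded_block m1 m2 n1 n2 (A : T -> 'M[R]_(m1, n1))
    (B : T -> 'M[R]_(m1, n2)) (C : T -> 'M[R]_(m2, n1))
    (E : T -> 'M[R]_(m2, n2)) :
  mx_bounded A -> mx_bounded B -> mx_bounded C -> mx_bounded E ->
  mx_bounded (fun w => block_mx (A w) (B w) (C w) (E w)).
Proof. exact: entrywise_block. Qed.

Lemma mx_L2D m n (A B : T -> 'M[R]_(m, n)) :
  mx_L2 A -> mx_L2 B -> mx_L2 (fun w => A w + B w).
Proof.
move=> hA hB i j; under [X in L2 _ _ X]funext do rewrite mxE.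
exact: L2D (hA i j) (hB i j).
Qed.

Lemma mx_L2N m n (A : T -> 'M[R]_(m, n)) :
  mx_L2 A -> mx_L2 (fun w => - A w).
Proof.
move=> hA i j; under [X in L2 _ _ X]funext do rewrite mxE.
exact: L2N (hA i j).
Qed.

Lemma mx_L2M m n k (A : T -> 'M[R]_(m, n)) (B : T -> 'M[R]_(n, k)) :
  mx_bounded A -> mx_L2 B -> mx_L2 (fun w => A w *m B w).
Proof.
move=> hA hB i j; under [X in L2 _ _ X]funext do rewrite mxE.
by apply: L2_sum => // l; exact: L2_ess_bounded (hA i l) (hB l j).
Qed.

Lemma mx_L2_col m1 m2 n (A : T -> 'M[R]_(m1, n)) (B : T -> 'M[R]_(m2, n)) :
  mx_L2 A -> mx_L2 B -> mx_L2 (fun w => col_mx (A w) (B w)).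
Proof. exact: entrywise_col. Qed.

Lemma L1_dotp m (u v : T -> 'cV[R]_m) : mx_L2 u -> mx_L2 v ->
  L1 mu D (fun w => dotp (u w) (v w)).
Proof.
move=> hu hv; under [X in L1 _ _ X]funext do rewrite dotpE.
by apply: L1_sum => // i; exact: L2M (hu i 0) (hv i 0).
Qed.

End MatrixClasses.

(** * Matrix-valued processes on the slab *)

Section ProcessClasses.
Context {R : realType} {dO : measure_display} {Omega : measurableType dO}.
Variables (P : probability Omega R) (T : R) (W : R -> Omega -> R).
Notation leb := (@lebesgue_measure R).
Notation prod_meas := (leb \x P)%E.
Notation F := (brownian_gen P W).
Hypothesis hF : forall A : set Omega, measurable A <-> <<s F T >> A.
Variable t : R.
Hypothesis t0T : 0 <= t < T.
Notation I := (`[t, T]%classic).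
Notation D := (`[t, T]%classic `*` [set: Omega] : set (measurableTypeR R * Omega)).

Let mI := measurable_time t T.
Let mD : measurable D := measurable_slab t T.
Let tT : t <= T. Proof. by case/andP: t0T => _ /ltW. Qed.
Let t0 : 0 <= t. Proof. by case/andP: t0T. Qed.

Definition uncurry_process m n (f : R -> Omega -> 'M[R]_(m, n))
  (z : measurableTypeR R * Omega) := f z.1 z.2.

(** At the final time the filtration is the whole sigma-algebra of [Omega]. *)
Lemma progressive_slab a m n (f : R -> Omega -> 'M[R]_(m, n)) : a <= t ->
  progressive F a T f ->
  forall i j, measurable_fun D (fun z => uncurry_process f z i j).
Proof.
move=> a_t pf i j.
have aT : a <= T <= T by rewrite (le_trans a_t tT) lexx.
have mf := pf T aT i j.
pose Om := g_sigma_algebraType (F T).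
have mid : measurable_fun setT (fun z : measurableTypeR R * Omega => (z.1, z.2) : R * Om).
  apply: measurable_fun_pair; first exact: measurable_fst.
  have : measurable_fun setT (idfun : Omega -> Om).
    by move=> _ A mA; rewrite setTI; apply/hF.
  move=> h; exact: measurableT_comp h measurable_snd.
have mS : measurable (`[a, T] `*` [set: Om]).
  by apply: measurableX => //; exact: measurable_itv.
apply: (@measurable_comp _ _ _ _ _ _ (`[a, T] `*` [set: Om])
  (fun z : R * Om => f z.1 z.2 i j) D (fun z => (z.1, z.2) : R * Om)) => //.
  move=> _ [z [/= zI _] <-]; split => //=.
  by move: zI; rewrite !in_itv /= => /andP[tz ->]; rewrite (le_trans a_t).
exact: measurable_funTS mid.
Qed.

Lemma slab_section (f : measurableTypeR R * Omega -> R) w :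
  measurable_fun D f -> measurable_fun (I : set (measurableTypeR R)) (fun s => f (s, w)).
Proof.
move=> mf.
apply: (@measurable_comp _ _ _ _ _ _ D f I (fun s => (s, w))) => //.
  by move=> _ [s sI <-].
exact: measurable_funTS (measurable_pair2 w).
Qed.

Lemma Linfty_bounded m n (f : R -> Omega -> 'M[R]_(m, n)) :
  progressive F 0 T f -> (Linfty_norm P T f < +oo)%E ->
  mx_bounded prod_meas D (uncurry_process f).
Proof.
move=> pf hf i j; split; first exact: progressive_slab pf _ _.
have [K hK] : exists K : R, (Linfty_norm P T f <= K%:E)%E.
  case: (Linfty_norm P T f) hf => [r _|//|_]; first by exists r.
  by exists 0; exact: leNye.
exists K; have h := ess_sup_ge prod_meas (patch (cst 0%E) (`[0, T] `*` [set: Omega])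
       (fun z : R * Omega => (frob (f z.1 z.2))%:E)).
apply: filterS h => z hz [/= zI _].
rewrite (le_trans (frob_entry _ _ _))// -lee_fin (le_trans _ hK)//.
apply: le_trans hz; rewrite patchE mem_set//=; split => //=.
by move: zI; rewrite !in_itv /= => /andP[tz ->]; rewrite (le_trans t0).
Qed.

Lemma bounded_cont_bounded m n (f : R -> Omega -> 'M[R]_(m, n)) :
  bounded_cont_process P F T f -> mx_bounded prod_meas D (uncurry_process f).
Proof.
move=> [[pf _] [K hK]] i j; split; first exact: progressive_slab pf _ _.
exists K; have hK' := ae_prod_snd hK.
have FF := ae_filter_ringOfSetsType prod_meas.
apply: filterS hK' => z hz [/= zI _].
rewrite (le_trans (frob_entry _ _ _))// hz//.
by move: zI; rewrite in_itv /= => /andP[tz ->]; rewrite (le_trans t0).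
Qed.

Lemma L2_process_L2 m n (f : R -> Omega -> 'M[R]_(m, n)) :
  L2_process P F t T f -> mx_L2 prod_meas D (uncurry_process f).
Proof.
move=> [mf _ hf] i j.
have mf' k l : measurable_fun D (fun z => uncurry_process f z k l) by exact: mf.
have L1f : L1 prod_meas D (fun z => frob (uncurry_process f z) ^+ 2).
  apply: slab_L1.
    under [X in measurable_fun _ X]funext do rewrite frob_sqr.
    by apply: measurable_sum => k; apply: measurable_sum => l; exact: measurable_funX.
  by under eq_integral do under eq_integral do rewrite ger0_norm ?sqr_ge0//.
split; first exact: mf.
apply: (le_L1 mD _ L1f); first exact: measurable_funX.
move=> z _; rewrite normrX lerXn2r ?nnegrE ?frob_entry//.
exact: sqrtr_ge0.
Qed.

Lemma L2_cst (k : R) : L2 prod_meas D (fun=> k).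
Proof.
split => //.
have Lk : L1 P setT (fun=> k ^+ 2) by exact: finite_measure_integrable_cst.
exact: (slab_L1_snd t T Lk).
Qed.

Lemma L2_L1 (f : measurableTypeR R * Omega -> R) : L2 prod_meas D f -> L1 prod_meas D f.
Proof.
move=> Lf; have := L2M mD Lf (L2_cst 1).
by under [X in L1 _ _ X -> _]funext do rewrite mulr1.
Qed.

(** Cauchy-Schwarz in time: integrate the square of [`|f|] minus its time average. *)
Lemma L2_time_integral (f : measurableTypeR R * Omega -> R) : L2 prod_meas D f ->
  L2 P setT (fun w => \int[leb]_(s in I) `|f (s, w)|).
Proof.
move=> L2f; have Lf := L2_L1 L2f; have Lnf := L1_norm mD Lf.
have Lf2 := L2f.2.
have mi := slab_measurable_integral Lnf.
split; first exact: mi.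
have LT := L1Z (T - t) measurableT (slab_L1_integral Lf2).
apply: (ae_le_L1 measurableT _ LT); first exact: measurable_funX.
have h1 := slab_ae_L1 Lnf; have h2 := slab_ae_L1 Lf2.
apply: filterS2 h1 h2 => w h1 h2 _.
rewrite ger0_norm ?sqr_ge0//.
set m := \int[leb]_(s in I) _; set q := \int[leb]_(s in I) _.
have c0 : 0 < T - t by rewrite subr_gt0; case/andP: t0T.
have : 0 <= \int[leb]_(s in I) (`|f (s, w)| - m / (T - t)) ^+ 2.
  by apply: Rintegral_ge0 => s _; exact: sqr_ge0.
have e s : (`|f (s, w)| - m / (T - t)) ^+ 2 =
    (f (s, w) ^+ 2 - 2 * (m / (T - t)) * `|f (s, w)|) + (m / (T - t)) ^+ 2.
  by rewrite -[in RHS](real_normK (num_real (f (s, w)))); ring.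
under eq_Rintegral do rewrite e.
have Lc := L1_time_cst t T ((m / (T - t)) ^+ 2).
have Lz := L1Z (2 * (m / (T - t))) mI h1.
rewrite (RintegralD mI (L1B mI h2 Lz) Lc) (RintegralB mI h2 Lz) (RintegralZ _ mI h1).
rewrite Rintegral_cst//.
have -> : fine (leb I) = T - t.
  rewrite lebesgue_measure_itv /= lte_fin.
  by case: ifP => [_|]; [rewrite -EFinD|case/andP: t0T => _ ->].
rewrite -/m -/q.
have -> : q - 2 * (m / (T - t)) * m + (m / (T - t)) ^+ 2 * (T - t) =
  (T - t)^-1 * ((T - t) * q - m ^+ 2) by field; rewrite gt_eqF.
by rewrite pmulr_rge0 ?invr_gt0// subr_ge0.
Qed.

(** The pathwise bound of [dissipative_bound] majorises [u] at all times by a single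
    square-integrable random variable. *)
Lemma dissipative_L2 (u r f : R -> Omega -> R) (u0 : R) :
  measurable_fun D (fun z => u z.1 z.2) -> measurable_fun setT (u T) ->
  L2 prod_meas D (fun z => f z.1 z.2) ->
  (forall s w, t <= s <= T -> 0 <= r s w) ->
  {ae P, forall w, u t w = u0} ->
  {ae P, forall w, abs_cont t T (fun s => u s w)
     (fun s => - (r s w * u s w) + f s w)} ->
  L2 prod_meas D (fun z => u z.1 z.2) /\ L2 P setT (u T).
Proof.
move=> mu muT L2f r0 hu0 hu.
have L2H := L2_time_integral L2f.
pose H w := `|u0| + 2 * \int[leb]_(s in I) `|f s w|.
have {}L2H : L2 P setT H.
  apply: L2D => //.
    by split => //; exact: finite_measure_integrable_cst.
  by apply: L2_ess_bounded => //; exact: ess_bounded_cst.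
have L2HD : L2 prod_meas D (fun z => H z.2).
  split; last exact: slab_L1_snd L2H.2.
  by apply: measurable_funTS; exact: measurableT_comp L2H.1 measurable_snd.
have Lf := slab_ae_L1 (L2_L1 L2f).
have uH : {ae P, forall w, forall s, t <= s <= T -> `|u s w| <= H w}.
  apply: filterS3 hu0 hu Lf => w hu0 hu Lf s sI.
  have := dissipative_bound tT hu Lf (fun s sI => r0 s w sI) sI.
  by rewrite hu0.
split.
  apply: (ae_le_L2 mD mu L2HD).
  have uH' := ae_prod_snd uH; have FF := ae_filter_ringOfSetsType prod_meas.
  by apply: filterS uH' => z h [/= zI _]; apply: h; rewrite in_itv in zI.
apply: (ae_le_L2 measurableT muT L2H).
by apply: filterS uH => w h _; apply: h; rewrite tT lexx.
Qed.

End ProcessClasses.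

(** * The controlled state *)

Lemma diag_mulmx (R : realType) m (A : 'M[R]_m) (v : 'cV[R]_m) i :
  is_diag_mx A -> (A *m v) i 0 = A i i * v i 0.
Proof.
move=> /is_diag_mxP hA; rewrite mxE (bigD1 i)//= big1 ?addr0// => j ji.
by rewrite hA ?mul0r// eq_sym.
Qed.

Lemma psdmx_diag_ge0 (R : realType) m (A : 'M[R]_m) i : psdmx A -> 0 <= A i i.
Proof.
move=> [_ /(_ (delta_mx i 0))]; rewrite -colE /dotp trmx_delta -rowE.
by rewrite !mxE.
Qed.

(** Finitely many exceptional sets are turned into countably many by encoding the
    index in the natural numbers. *)
Lemma ae_forall_fin (d : measure_display) (T : measurableType d) (R : realType)
    (mu : {measure set T -> \bar R}) (J : finType) (Q : J -> T -> Prop) :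
  (forall i, {ae mu, forall x, Q i x}) -> {ae mu, forall x, forall i, Q i x}.
Proof.
move=> hQ.
have h : {ae mu, forall x, forall n : nat,
    if unpickle n is Some i then Q i x else True}.
  apply/ae_foralln => n; case: (unpickle n) => [i|]; [exact: hQ|exact: aeW].
by apply: filterS h => x h i; have := h (pickle i); rewrite pickleK.
Qed.

Section State.
Context {R : realType} {dO : measure_display} {Omega : measurableType dO}.
Variables (P : probability Omega R) (T : R) (W : R -> Omega -> R).
Notation leb := (@lebesgue_measure R).
Notation prod_meas := (leb \x P)%E.
Notation F := (brownian_gen P W).
Hypothesis hF : forall A : set Omega, measurable A <-> <<s F T >> A.
Variable t : R.
Hypothesis t0T : 0 <= t < T.
Notation I := (`[t, T]%classic).
Notation D := (`[t, T]%classic `*` [set: Omega] : set (measurableTypeR R * Omega)).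
Variables (d : nat) (gamma : 'M[R]_d) (rho : R -> Omega -> 'M[R]_d).
Hypothesis gamma_diag : is_diag_mx gamma.
Hypothesis hrho : progressive F 0 T rho.
Hypothesis hrho_diag : forall s w, 0 <= s <= T ->
  is_diag_mx (rho s w) /\ psdmx (rho s w).
Hypothesis hrho_bdd : (Linfty_norm P T rho < +oo)%E.
Variables (x y : 'cV[R]_d) (xi X Y : R -> Omega -> 'cV[R]_d).
Hypothesis hxi : L2_process P F t T xi.
Hypothesis hst : state_process P F T gamma rho t x y xi X Y.

Let mI := measurable_time t T.
Let mD : measurable D := measurable_slab t T.
Let tT : t <= T. Proof. by case/andP: t0T => _ /ltW. Qed.
Let t0 : 0 <= t. Proof. by case/andP: t0T. Qed.

Let sub s : t <= s <= T -> 0 <= s <= T.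
Proof. by move=> /andP[ts ->]; rewrite (le_trans t0). Qed.

Lemma cont_process_terminal m n (f : R -> Omega -> 'M[R]_(m, n)) i j :
  cont_process F t T f -> measurable_fun setT (fun w => f T w i j).
Proof.
move=> [pf _]; have TT : t <= T <= T by rewrite tT lexx.
exact: (F_measurable_fun hF (lexx T) (progressive_adapted pf TT i j)).
Qed.

Let L2xi : mx_L2 prod_meas D (uncurry_process xi).
Proof. exact: (L2_process_L2 hxi). Qed.

Lemma state_start : {ae P, forall w, X t w = x /\ Y t w = y}.
Proof.
case: hst => _ _; apply: filterS => w /(_ t); rewrite lexx tT => /(_ isT) [-> ->].
by split; apply/matrixP => i j; rewrite !mxE prim_start ?addr0 ?subr0.
Qed.

Let xi_section : {ae P, forall w, forall i, L1 leb I (fun s => xi s w i 0)}.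
Proof.
apply: ae_forall_fin => i.
exact: (slab_ae_L1 (L2_L1 (L2xi i 0))).
Qed.

Let rho_section : {ae P, forall w, forall i,
  ess_bounded leb I (fun s => rho s w i i)}.
Proof.
apply: ae_forall_fin => i.
have [mr [K hK]] := Linfty_bounded hF t0T hrho hrho_bdd i i.
apply: filterS (ae_prod_section hK) => w hw.
split; first exact: (slab_section w mr).
exists K; have FF := ae_filter_ringOfSetsType leb.
by apply: filterS hw => s hs sI; apply: hs; split.
Qed.

(** Both components solve scalar equations with a nonnegative damping rate, zero for
    [X] and a diagonal entry of [rho] for [Y]; this is where diagonality of [rho] and
    [gamma] decouples the coordinates. *)
Lemma state_abs_cont : {ae P, forall w, forall i,
  abs_cont t T (fun s => X s w i 0) (fun s => - (0 * X s w i 0) + - xi s w i 0) /\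
  abs_cont t T (fun s => Y s w i 0)
    (fun s => - (rho s w i i * Y s w i 0) + gamma i i * xi s w i 0)}.
Proof.
case: hst => cX cY; have hs := state_start.
move=> hE; have h4 : {ae P, forall w, (X t w = x /\ Y t w = y) /\
   forall i, L1 leb I (fun s => xi s w i 0) /\
             ess_bounded leb I (fun s => rho s w i i)}.
  by apply: filterS3 hs xi_section rho_section => w h1 h2 h3; split.
apply: filterS2 hE h4 => w hE [[Xt Yt] h] i.
have [Lxi brho] := h i.
split; split.
- apply: (eq_L1 mI _ (L1N mI Lxi)) => s _; ring.
- move=> s sI; have [-> _] := hE s sI; rewrite Xt !mxE; congr (_ + _).
  have Lxis : L1 leb `[t, s] (fun r => xi r w i 0).
    by apply: L1_subitv Lxi => //; case/andP: sI.
  rewrite -RintegralN//.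
  by apply: eq_Rintegral => r _; ring.
- have LY : L1 leb I (fun s => Y s w i 0).
    apply: continuous_compact_integrable; first exact: segment_compact.
    by case: cY => _ /(_ w i 0).
  apply: L1D => //; last exact: L1Z.
  apply: L1N => //; exact: L1_ess_bounded.
move=> s sI; have [_ ->] := hE s sI; rewrite Yt !mxE; congr (_ + _).
apply: eq_Rintegral => r /set_mem /=; rewrite in_itv /= => /andP[tr rs].
have rI : 0 <= r <= T by apply: sub; rewrite tr (le_trans rs)//; case/andP: sI.
have [hd _] := hrho_diag w rI.
by rewrite mxE [in LHS]mxE !diag_mulmx.
Qed.

Lemma state_L2 : mx_L2 prod_meas D (uncurry_process X) /\
  mx_L2 prod_meas D (uncurry_process Y) /\
  (forall i, L2 P setT (fun w => X T w i 0)) /\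
  (forall i, L2 P setT (fun w => Y T w i 0)).
Proof.
case: (hst) => cX cY _; have hac := state_abs_cont; have hs := state_start.
have hX i := dissipative_L2 t0T (u := fun s w => X s w i 0) (r := fun _ _ => 0)
   (f := fun s w => - xi s w i 0) (u0 := x i 0)
   (progressive_slab hF t0T (lexx t) cX.1 i 0) (cont_process_terminal i 0 cX)
   (L2N mD (L2xi i 0)) (fun _ _ _ => lexx 0).
have hY i := dissipative_L2 t0T (u := fun s w => Y s w i 0)
   (r := fun s w => rho s w i i)
   (f := fun s w => gamma i i * xi s w i 0) (u0 := y i 0)
   (progressive_slab hF t0T (lexx t) cY.1 i 0) (cont_process_terminal i 0 cY)
   (L2_ess_bounded mD (ess_bounded_cst prod_meas D (gamma i i)) (L2xi i 0))
   (fun s w sI => psdmx_diag_ge0 i (hrho_diag w (sub sI)).2).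
have {}hX i : L2 prod_meas D (fun z => X z.1 z.2 i 0) /\ L2 P setT (fun w => X T w i 0).
  apply: hX; first by apply: filterS hs => w [->].
  by apply: filterS hac => w /(_ i) [].
have {}hY i : L2 prod_meas D (fun z => Y z.1 z.2 i 0) /\ L2 P setT (fun w => Y T w i 0).
  apply: hY; first by apply: filterS hs => w [_ ->].
  by apply: filterS hac => w /(_ i) [].
split; first by move=> i j; rewrite ord1; exact: (hX i).1.
split; first by move=> i j; rewrite ord1; exact: (hY i).1.
by split => i; [exact: (hX i).2|exact: (hY i).2].
Qed.

End State.

(** * Completing the square *)

(** The excess of the running cost over the optimal one. *)
Definition regret (R : realType) (dO : measure_display)
    (Omega : measurableType dO) (d : nat) (Lambda gamma : 'M[R]_d)
    (p : R -> Omega -> 'M[R]_(d + d)) (xi X Y : R -> Omega -> 'cV[R]_d)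
    (s : R) (w : Omega) : R :=
  let dev := xi s w - feedback Lambda gamma p s w (X s w) (Y s w) in
  2^-1 * dotp dev (Lambda *m dev).

Section SquareCompletion.
Context {R : realType} {dO : measure_display} {Omega : measurableType dO}.
Variables (P : probability Omega R) (T : R) (W : R -> Omega -> R).
Notation leb := (@lebesgue_measure R).
Notation prod_meas := (leb \x P)%E.
Notation F := (brownian_gen P W).
Hypothesis hW : std_brownian P F T W.
Hypothesis hF : forall A : set Omega, measurable A <-> <<s F T >> A.
Variable t : R.
Hypothesis t0T : 0 <= t < T.
Notation I := (`[t, T]%classic).
Notation D := (`[t, T]%classic `*` [set: Omega] : set (measurableTypeR R * Omega)).
Variables (d : nat) (Lambda gamma : 'M[R]_d).
Variables (rho Sigma : R -> Omega -> 'M[R]_d).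
Hypothesis hLambda : pdmx Lambda.
Hypothesis hgamma : is_diag_mx gamma /\ pdmx gamma.
Hypothesis hrho : progressive F 0 T rho.
Hypothesis hrho_diag : forall s w, 0 <= s <= T ->
  is_diag_mx (rho s w) /\ psdmx (rho s w).
Hypothesis hrho_bdd : (Linfty_norm P T rho < +oo)%E.
Hypothesis hSigma : progressive F 0 T Sigma.
Hypothesis hSigma_bdd : (Linfty_norm P T Sigma < +oo)%E.
Variables (n : R) (p M : R -> Omega -> 'M[R]_(d + d)).
Hypothesis hp : bsrde_solution P F T Lambda gamma rho Sigma W n p M.
Variables (x y : 'cV[R]_d) (xi X Y : R -> Omega -> 'cV[R]_d).
Hypothesis hxi : L2_process P F t T xi.
Hypothesis hst : state_process P F T gamma rho t x y xi X Y.

Let mI := measurable_time t T.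
Let mD : measurable D := measurable_slab t T.
Let tT : t <= T. Proof. by case/andP: t0T => _ /ltW. Qed.
Let t0 : 0 <= t. Proof. by case/andP: t0T. Qed.
Let TI : t <= T <= T. Proof. by rewrite tT lexx. Qed.
Let tI : t <= t <= T. Proof. by rewrite lexx tT. Qed.

Let sub s : t <= s <= T -> 0 <= s <= T.
Proof. by move=> /andP[ts ->]; rewrite (le_trans t0). Qed.

Let z0 := col_mx x y.
Let z s w := col_mx (X s w) (Y s w).
Let zd s w := col_mx (- xi s w) (- (rho s w *m Y s w) + gamma *m xi s w).
Let g s w := bsrde_driver Lambda gamma rho Sigma (p s w) s w.
Let fb s w := feedback Lambda gamma p s w (X s w) (Y s w).
Let loss (v : measurableTypeR R * Omega) := regret Lambda gamma p xi X Y v.1 v.2.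
Let run (v : measurableTypeR R * Omega) :=
  2^-1 * dotp (xi v.1 v.2) (Lambda *m xi v.1 v.2) + dotp (Y v.1 v.2) (xi v.1 v.2)
  + 2^-1 * dotp (X v.1 v.2) (Sigma v.1 v.2 *m X v.1 v.2).

Let L2xi : mx_L2 prod_meas D (uncurry_process xi).
Proof. exact: L2_process_L2 hxi. Qed.

Let hstate := state_L2 hF t0T hgamma.1 hrho hrho_diag hrho_bdd hxi hst.

Let L2X : mx_L2 prod_meas D (uncurry_process X). Proof. by case: hstate. Qed.
Let L2Y : mx_L2 prod_meas D (uncurry_process Y).
Proof. by case: hstate => _ []. Qed.
Let brho := Linfty_bounded hF t0T hrho hrho_bdd.
Let bSigma := Linfty_bounded hF t0T hSigma hSigma_bdd.

Let bp : mx_bounded prod_meas D (uncurry_process p).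
Proof. by apply: (bounded_cont_bounded hF t0T); case: hp. Qed.

Let L2z : mx_L2 prod_meas D (uncurry_process z).
Proof. exact: (mx_L2_col L2X L2Y). Qed.

Let L2zd : mx_L2 prod_meas D (uncurry_process zd).
Proof.
apply: (mx_L2_col (A := fun v => - uncurry_process xi v)
  (B := fun v => - (uncurry_process rho v *m uncurry_process Y v)
     + gamma *m uncurry_process xi v)).
  exact: mx_L2N.
apply: mx_L2D => //; first by apply: mx_L2N => //; exact: mx_L2M.
apply: (mx_L2M mD (A := fun=> gamma)) => //.
exact: mx_bounded_cst.
Qed.

Let bfbmx : mx_bounded prod_meas D
  (fun v => row_mx (- 1%:M) gamma *m uncurry_process p v + row_mx 0 1%:M).
Proof.
apply: mx_boundedD => //; last exact: mx_bounded_cst.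
by apply: (mx_boundedM mD) => //; exact: mx_bounded_cst.
Qed.

Let bg : mx_bounded prod_meas D (uncurry_process g).
Proof.
rewrite /g /uncurry_process /bsrde_driver.
have bc m k (A : 'M[R]_(m, k)) := mx_bounded_cst prod_meas D A.
have bN : mx_bounded prod_meas D (fun v => - uncurry_process rho v) by exact: mx_boundedN.
have bb : mx_bounded prod_meas D
    (fun v => block_mx (0 : 'M[R]_d) (0 : 'M[R]_d) (0 : 'M[R]_d) (- uncurry_process rho v)).
  by apply: mx_bounded_block => //; exact: bc.
apply: (mx_boundedD mD); last by apply: mx_bounded_block => //; exact: bc.
apply: (mx_boundedD mD); last exact: (mx_boundedM mD).
apply: (mx_boundedD mD); last exact: (mx_boundedM mD).
apply: (mx_boundedN mD); apply: (mx_boundedM mD); last exact: bfbmx.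
apply: (mx_boundedM mD); last exact: bc.
apply: (mx_boundedD mD); last exact: bc.
by apply: (mx_boundedM mD) => //; exact: bc.
Qed.

Let L2dev : mx_L2 prod_meas D (fun v => xi v.1 v.2 - fb v.1 v.2).
Proof.
apply: (mx_L2D mD L2xi); apply: (mx_L2N mD).
rewrite /fb /feedback.
apply: (mx_L2N mD); apply: (mx_L2M mD _ L2z).
by apply: (mx_boundedM mD) => //; exact: mx_bounded_cst.
Qed.

Lemma regret_L1 : L1 prod_meas D loss.
Proof.
apply: (L1Z _ mD); apply: (L1_dotp mD L2dev).
by apply: (mx_L2M mD) => //; exact: mx_bounded_cst.
Qed.

Let run_L1 : L1 prod_meas D run.
Proof.
apply: (L1D mD); last first.
  by apply: (L1Z _ mD); apply: (L1_dotp mD L2X); exact: (mx_L2M mD bSigma L2X).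
apply: (L1D mD); last exact: (L1_dotp mD L2Y L2xi).
apply: (L1Z _ mD); apply: (L1_dotp mD L2xi).
by apply: (mx_L2M mD _ L2xi); exact: mx_bounded_cst.
Qed.

Lemma cost_L1 : L1 P setT (cost T Lambda Sigma n t xi X Y).
Proof.
have [_ [_ [LX LY]]] := hstate.
have LX' : mx_L2 P setT (fun w => X T w) by move=> i j; rewrite ord1; exact: LX.
have LY' : mx_L2 P setT (fun w => Y T w) by move=> i j; rewrite ord1; exact: LY.
rewrite /cost; apply: L1D => //; last exact: (slab_L1_integral run_L1).
apply: L1D => //; last exact: L1_dotp.
by apply: L1Z => //; exact: L1_dotp.
Qed.

Let z_abs_cont : {ae P, forall w, forall i,
  abs_cont t T (fun s => z s w i 0) (fun s => zd s w i 0)}.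
Proof.
have h := state_abs_cont hF t0T hgamma.1 hrho hrho_diag hrho_bdd hxi hst.
apply: filterS h => w h i; case: (split_ordP i) => k ->.
  apply: eq_abs_cont tT _ _ (h k).1 => s sI; first by rewrite /z col_mxEu.
  by rewrite /zd col_mxEu mxE mul0r oppr0 add0r.
apply: eq_abs_cont tT _ _ (h k).2 => s sI; first by rewrite /z col_mxEd.
apply/esym; rewrite /zd col_mxEd mxE [X in X + _]mxE.
have [hd _] := hrho_diag w (sub sI).
by rewrite !diag_mulmx//; case: hgamma.
Qed.

Let z_start : {ae P, forall w, z t w = z0}.
Proof. by apply: filterS (state_start t0T hst) => w [h1 h2]; rewrite /z h1 h2. Qed.

Let z_adapted s i : t <= s <= T -> F_measurable F s (fun w => z s w i 0).
Proof.
move=> sI; case: hst => cX cY _.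
case: (split_ordP i) => k ->.
  under [X in F_measurable _ _ X]funext do rewrite /z col_mxEu.
  exact: (progressive_adapted cX.1 sI k 0).
under [X in F_measurable _ _ X]funext do rewrite /z col_mxEd.
exact: (progressive_adapted cY.1 sI k 0).
Qed.

Let zd_adapted s i : t <= s <= T -> F_measurable F s (fun w => zd s w i 0).
Proof.
move=> sI; case: hst => cX cY _; case: hxi => _ axi _.
have mxi k : F_measurable F s (fun w => xi s w k 0) by exact: axi.
case: (split_ordP i) => k ->.
  under [X in F_measurable _ _ X]funext do rewrite /zd col_mxEu mxE.
  by apply: measurableT_comp => //; exact: mxi.
have -> : (fun w => zd s w (rshift d k) 0) =
    (fun w => - (rho s w k k * Y s w k 0) + gamma k k * xi s w k 0).
  apply/funext => w; rewrite /zd col_mxEd mxE [X in X + _]mxE.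
  have [hd _] := hrho_diag w (sub sI).
  by rewrite !diag_mulmx//; case: hgamma.
apply: measurable_funD; last first.
  by apply: measurable_funM => //; exact: mxi.
apply: measurableT_comp => //; apply: measurable_funM.
  exact: (progressive_adapted hrho (sub sI) k k).
exact: (progressive_adapted cY.1 sI k 0).
Qed.

Section WithIto.
Variable Ito : R -> Omega -> 'M[R]_(d + d).
Hypothesis hIto : ito_integral P F W T M Ito.
Hypothesis p_eq : {ae P, forall w, forall s, 0 <= s <= T ->
  p s w = p T w + time_int s T (fun r => g r w) - (Ito T w - Ito s w)}.

Let J s w := Ito T w - Ito s w.

Let q i j (v : measurableTypeR R * Omega) :=
  zd v.1 v.2 i 0 * z v.1 v.2 j 0 + z v.1 v.2 i 0 * zd v.1 v.2 j 0.

Let q_L1 i j : L1 prod_meas D (q i j).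
Proof.
by apply: (L1D mD); [exact: (L2M mD (L2zd i 0) (L2z j 0))
                    |exact: (L2M mD (L2z i 0) (L2zd j 0))].
Qed.

Let g_L1 i j : L1 prod_meas D (fun v => g v.1 v.2 i j).
Proof.
have := L1_ess_bounded mD (bg i j) (L2_L1 (L2_cst P T t 1)).
by under [X in L1 _ _ X -> _]funext do rewrite mulr1.
Qed.

Let J_eq : {ae P, forall w, forall i j s, t <= s <= T ->
  p s w i j = p T w i j + \int[leb]_(r in `[s, T]) g r w i j - J s w i j}.
Proof.
apply: filterS p_eq => w h i j s sI; rewrite (h s (sub sI)) /J !mxE.
by [].
Qed.

(** The Riccati equation expresses the martingale increment through [p] and its
    drift, both of which are bounded. This bound is what allows integrating it
    against [q], which is only integrable. *)
Let J_le i j : exists K, {ae P, forall w, forall s, t <= s <= T -> `|J s w i j| <= K}.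
Proof.
have [[_ [K hK]] _ _ _ _] := hp.
have [mg [B hB]] := bg i j.
have hg := slab_ae_L1 (g_L1 i j).
exists (K + K + B * fine (leb I)).
have hB' := ae_prod_section hB.
have hall : {ae P, forall w, L1 leb I (fun s => g s w i j) /\
   {ae leb, forall s, D (s, w) -> `|g s w i j| <= B}}.
  by apply: filterS2 hg hB' => w h1 h2; split.
apply: filterS3 hK J_eq hall => w hK hJ [Lg hB''] s sI.
have /andP[ts sT] := sI.
have -> : J s w i j = p T w i j - p s w i j + \int[leb]_(r in `[s, T]) g r w i j.
  by rewrite (hJ i j s sI); ring.
have hKs u : t <= u <= T -> `|p u w i j| <= K.
  by move=> uI; apply: le_trans (hK u (sub uI)); exact: frob_entry.
rewrite (le_trans (ler_normD _ _))// lerD//.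
  by rewrite (le_trans (ler_normB _ _))// lerD// hKs.
have Lgs := L1_subitv ts (lexx T) Lg.
apply: (le_trans (le_normr_Rintegral (measurable_time s T) Lgs)).
have Lng := L1_norm mI Lg.
apply: (@le_trans _ _ (\int[leb]_(r in I) `|g r w i j|)).
  by rewrite (Rintegral_itv_split sI Lng) lerDr; exact: Rintegral_ge0.
rewrite -Rintegral_cst//.
apply: ae_le_Rintegral => //; first exact: L1_time_cst.
have FF := ae_filter_ringOfSetsType leb.
by apply: filterS hB'' => r h rI; apply: h; split.
Qed.

Let J_measurable s i j : 0 <= s <= T -> measurable_fun setT (fun w => J s w i j).
Proof.
move=> sI; have [pI _] := hIto.1.
have mIto u : 0 <= u <= T -> measurable_fun setT (fun w => Ito u w i j).
  move=> uI; apply: (F_measurable_fun hF _ (progressive_adapted pI uI i j)).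
  by case/andP: uI.
have -> : (fun w => J s w i j) = (fun w => Ito T w i j - Ito s w i j).
  by apply/funext => w; rewrite /J !mxE.
by apply: measurable_funB; apply: mIto => //; exact: sub.
Qed.

Let J_L1 s i j : t <= s <= T -> L1 P setT (fun w => J s w i j).
Proof.
move=> sI; have [K hK] := J_le i j.
have LK : L1 P setT (fun=> K) by exact: finite_measure_integrable_cst.
apply: (ae_le_L1 measurableT _ LK); first exact: J_measurable (sub sI).
by apply: filterS hK => w /(_ s sI).
Qed.

Let bJ : mx_bounded prod_meas D (uncurry_process J).
Proof.
move=> i j; have [pI _] := hIto.1; split.
  have -> : (fun v => uncurry_process J v i j) =
      (fun v => Ito T v.2 i j - uncurry_process Ito v i j).
    by apply/funext => v; rewrite /uncurry_process /J !mxE.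
  apply: measurable_funB; last exact: (progressive_slab hF t0T t0 pI).
  have mT : measurable_fun setT (fun w => Ito T w i j).
    exact: (F_measurable_fun hF (lexx T) (progressive_adapted pI (sub TI) i j)).
  by apply: measurable_funTS; exact: (measurableT_comp mT measurable_snd).
have [K hK] := J_le i j; exists K.
have hK' := ae_prod_snd hK; have FF := ae_filter_ringOfSetsType prod_meas.
by apply: filterS hK' => v h [/= vI _]; apply: h; rewrite in_itv in vI.
Qed.

Let J_mean s i j A : t <= s <= T -> <<s F s >> A ->
  \int[P]_(w in A) J s w i j = 0.
Proof.
move=> sI hA; rewrite -(ito_martingale hW hF i j hIto (sub sI) hA).
by apply: eq_Rintegral => w _; rewrite /J !mxE.
Qed.

Let qJ_L1 i j : L1 prod_meas D (fun v => q i j v * J v.1 v.2 i j).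
Proof.
apply: (eq_L1 mD _ (L1_ess_bounded mD (bJ i j) (q_L1 i j))) => v _.
by rewrite mulrC.
Qed.

(** The martingale part of [z^T p z / 2] between [t] and [T], in the form given by
    [abs_cont_ito]. *)
Let noise w := 2^-1 * \sum_i \sum_j (z0 i 0 * z0 j 0 * J t w i j +
  \int[leb]_(s in I) (q i j (s, w) * J s w i j)).

Let noise_term_L1 i j : L1 P setT (fun w => z0 i 0 * z0 j 0 * J t w i j +
  \int[leb]_(s in I) (q i j (s, w) * J s w i j)).
Proof.
by apply: L1D => //; [apply: L1Z => //; exact: J_L1|exact: (slab_L1_integral (qJ_L1 i j))].
Qed.

Let noise_L1 : L1 P setT noise.
Proof.
by apply: L1Z => //; apply: L1_sum => // i; apply: L1_sum => // j.
Qed.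

(** At each time [s] the factor [q i j (s, w)] is known while the increment [J s] has
    mean zero given the past of [s]. *)
Let noise_mean A : <<s F t >> A -> \int[P]_(w in A) noise w = 0.
Proof.
move=> hA; have mA : measurable A by exact: (filtration_sub hF tT hA).
have LA f : L1 P setT f -> L1 P A f by exact: L1S.
rewrite RintegralZ//; last first.
  apply: LA; apply: L1_sum => // i; apply: L1_sum => // j; exact: noise_term_L1.
rewrite Rintegral_sum//; last first.
  by move=> i; apply: LA; apply: L1_sum => // j; exact: noise_term_L1.
rewrite big1 ?mulr0// => i _.
rewrite Rintegral_sum//; last by move=> j; apply: LA; exact: noise_term_L1.
rewrite big1// => j _.
rewrite RintegralD//; last 2 first.
- by apply: LA; apply: L1Z => //; exact: J_L1.
- by apply: LA; exact: (slab_L1_integral (qJ_L1 i j)).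
rewrite RintegralZ//; last by apply: LA; exact: J_L1.
rewrite J_mean// mulr0 add0r Rintegral_mkcond.
have bA : ess_bounded prod_meas D (fun v => \1_A v.2).
  split.
    have mi : measurable_fun setT (\1_A : Omega -> R) by exact: measurable_indic.
    by apply: measurable_funTS; exact: (measurableT_comp mi measurable_snd).
  exists 1; apply: aeW => v _; rewrite indicE.
  by case: (_ \in _); rewrite ?normr1 ?normr0.
have L1AqJ := L1_ess_bounded mD bA (qJ_L1 i j).
rewrite -[RHS](slab_integral_eq0 L1AqJ).
  apply: eq_Rintegral => w _ /=; rewrite patchE indicE.
  case: ifP => _; first by apply: eq_Rintegral => s _; rewrite mul1r.
  by under eq_Rintegral do rewrite mul0r; rewrite Rintegral_cst// mul0r.
have hae := slab_ae_L1_omega L1AqJ.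
have FF := ae_filter_ringOfSetsType leb.
apply: filterS hae => s hs /= sI.
have sI' : t <= s <= T by rewrite in_itv in sI.
have sT : s <= T by case/andP: sI'.
transitivity (\int[P]_w ((\1_A w * q i j (s, w)) * J s w i j)).
  by apply: eq_Rintegral => w _; rewrite mulrA.
apply: (integral_mul_eq0 (filtration_sub hF sT)).
- exact: J_L1.
- apply: measurable_funM.
    by apply: measurable_indic; apply: filtration_mono hA; case/andP: sI'.
  apply: measurable_funD; apply: measurable_funM.
  + exact: zd_adapted.
  + exact: z_adapted.
  + exact: z_adapted.
  + exact: zd_adapted.
- by apply: (eq_L1 measurableT _ (hs sI)) => w _; rewrite mulrA.
- by move=> B hB; exact: J_mean.
Qed.

Let drift i j (v : measurableTypeR R * Omega) :=
  q i j v * p v.1 v.2 i j - z v.1 v.2 i 0 * z v.1 v.2 j 0 * g v.1 v.2 i j.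

Let drift_L1 i j : L1 prod_meas D (drift i j).
Proof.
apply: (L1B mD).
  apply: (eq_L1 mD _ (L1_ess_bounded mD (bp i j) (q_L1 i j))) => v _.
  by rewrite mulrC.
have Lzz := L2M mD (L2z i 0) (L2z j 0).
apply: (eq_L1 mD _ (L1_ess_bounded mD (bg i j) Lzz)) => v _.
by rewrite mulrC.
Qed.

Let quadratic_ito : {ae P, forall w, forall i j,
  z T w i 0 * z T w j 0 * p T w i j =
  z0 i 0 * z0 j 0 * p t w i j + \int[leb]_(s in I) drift i j (s, w) +
  (z0 i 0 * z0 j 0 * J t w i j + \int[leb]_(s in I) (q i j (s, w) * J s w i j))}.
Proof.
have hg : {ae P, forall w, forall i j, L1 leb I (fun s => g s w i j)}.
  by apply: ae_forall_fin => i; apply: ae_forall_fin => j; exact: slab_ae_L1 (g_L1 i j).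
have hqJ : {ae P, forall w, forall i j, L1 leb I (fun s => q i j (s, w) * J s w i j)}.
  by apply: ae_forall_fin => i; apply: ae_forall_fin => j; exact: slab_ae_L1 (qJ_L1 i j).
have hzz : {ae P, forall w, (forall i, abs_cont t T (fun s => z s w i 0)
    (fun s => zd s w i 0)) /\ z t w = z0}.
  by apply: filterS2 z_abs_cont z_start.
have hgqJ : {ae P, forall w, (forall i j, L1 leb I (fun s => g s w i j)) /\
    (forall i j, L1 leb I (fun s => q i j (s, w) * J s w i j))}.
  by apply: filterS2 hg hqJ.
apply: filterS3 hgqJ hzz J_eq => w [hg' hqJ'] [hac <-] hJ i j.
have hphi := abs_cont_mul tT (hac i) (hac j).
pose nu := p T w i j + \int[leb]_(r in I) g r w i j.
apply: (abs_cont_ito (nu := nu) tT hphi (hg' i j) (hqJ' i j)).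
  move=> s sI; rewrite (hJ i j s sI) /nu (Rintegral_itv_split sI (hg' i j)); ring.
by rewrite /J subrr mxE.
Qed.

(** Summing [quadratic_ito] over the entries turns the terminal cost into the
    claimed value plus an integral over time and the noise; [square_identity]
    recognises the sum of that integral with the running cost. *)
Let cost_decomposition : {ae P, forall w,
  cost T Lambda Sigma n t xi X Y w =
  2^-1 * dotp z0 (p t w *m z0) + \int[leb]_(s in I) loss (s, w) + noise w}.
Proof.
have [_ _ hsym hpT _] := hp.
have hd : {ae P, forall w, forall i j, L1 leb I (fun s => drift i j (s, w))}.
  by apply: ae_forall_fin => i; apply: ae_forall_fin => j; exact: slab_ae_L1 (drift_L1 i j).
have hr : {ae P, forall w, L1 leb I (fun s => run (s, w))}.
  exact: slab_ae_L1 run_L1.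
have hdr : {ae P, forall w, (forall i j, L1 leb I (fun s => drift i j (s, w))) /\
    L1 leb I (fun s => run (s, w))}.
  by apply: filterS2 hd hr.
apply: filterS3 hdr quadratic_ito hpT => w [hdrift hrun] hito hpTw.
have LS i : L1 leb I (fun s => \sum_j drift i j (s, w)).
  by apply: L1_sum.
have LSS : L1 leb I (fun s => \sum_i \sum_j drift i j (s, w)).
  by apply: L1_sum.
rewrite /cost -(terminal_identity (X T w) (Y T w) n) -hpTw.
rewrite -[col_mx (X T w) (Y T w)]/(z T w) (dotp_quad (z T w)).
under eq_bigr do under eq_bigr do rewrite hito.
under eq_bigr do rewrite !big_split /=.
rewrite !big_split /= -dotp_quad.
have -> : \sum_i \sum_j \int[leb]_(s in I) drift i j (s, w) =
    \int[leb]_(s in I) \sum_i \sum_j drift i j (s, w).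
  rewrite Rintegral_sum//; apply: eq_bigr => i _.
  by rewrite Rintegral_sum.
have -> : \int[leb]_(s in I) loss (s, w) = \int[leb]_(s in I)
    (2^-1 * (\sum_i \sum_j drift i j (s, w)) + run (s, w)).
  apply: eq_Rintegral => s /set_mem /=; rewrite in_itv /= => sI.
  have [sp _] := hsym s w (sub sI).
  have [_ [sr _]] := hrho_diag w (sub sI).
  rewrite /loss /regret /run /fb /feedback /=.
  rewrite -(@square_identity _ _ Lambda gamma (rho s w) (Sigma s w) (p s w)
    (pdmx_unit hLambda) hLambda.1 hgamma.2.1 sr sp (X s w) (Y s w) (xi s w)).
  congr (2^-1 * _ + _); rewrite !dotp_quad /drift /q /=.
  rewrite -big_split -sumrB; apply: eq_bigr => i _ /=.
  rewrite -big_split -sumrB; apply: eq_bigr => j _ /=.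
  by rewrite mulrDl.
rewrite (RintegralD mI (L1Z _ mI LSS) hrun) (RintegralZ _ mI LSS).
have -> : noise w = 2^-1 * ((\sum_i \sum_j z0 i 0 * z0 j 0 * J t w i j) +
    \sum_i \sum_j \int[leb]_(s in I) (q i j (s, w) * J s w i j)).
  congr (_ * _); rewrite -big_split; apply: eq_bigr => i _.
  by rewrite -big_split.

ring.
Qed.

Lemma square_completion_ito : exists N : Omega -> R,
  [/\ L1 P setT N, forall A, <<s F t >> A -> \int[P]_(w in A) N w = 0
    & {ae P, forall w, cost T Lambda Sigma n t xi X Y w =
        2^-1 * dotp z0 (p t w *m z0) +
        \int[leb]_(s in I) regret Lambda gamma p xi X Y s w + N w}].
Proof. by exists noise; split; [exact: noise_L1|exact: noise_mean|exact: cost_decomposition]. Qed.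

End WithIto.

(** The cost of every admissible control is the claimed value, plus the accumulated
    regret, plus a term whose mean given the past of [t] is zero. *)
Lemma square_completion : exists N : Omega -> R,
  [/\ L1 P setT N, forall A, <<s F t >> A -> \int[P]_(w in A) N w = 0
    & {ae P, forall w, cost T Lambda Sigma n t xi X Y w =
        2^-1 * dotp (col_mx x y) (p t w *m col_mx x y) +
        \int[leb]_(s in I) regret Lambda gamma p xi X Y s w + N w}].
Proof. by case: hp => _ _ _ _ [Ito hI hE]; exact: square_completion_ito hI hE. Qed.

End SquareCompletion.

(** * Progressive measurability of time integrals *)

Section ExponentialWeight.
Context {R : realType}.
Notation leb := (@lebesgue_measure R).
Variables (t l : R).
Hypothesis l0 : 0 < l.

Let w (r : R) : R := expR (l * (r - t)).

Let dw (x : R) : is_derive x 1 (fun r : R => l^-1 * w r) (w x).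
Proof.
have h1 : is_derive x 1 (fun r : R => l * (r - t)) l.
  by apply: is_derive_eq; rewrite subr0 -[LHS]/(_ * _) mulr1.
have h2 := @is_derive1_comp R expR (fun r => l * (r - t)) x _ _ (is_derive_expR _) h1.
have h3 : is_derive x 1 (fun r : R => l^-1 * w r)
    (l^-1 *: (expR (l * (x - t)) * l)) by exact: (is_deriveZ l^-1 h2).
apply: (is_derive_eq h3).
by rewrite -[_ *: _]/(_ * _) mulrCA mulVf ?gt_eqF// mulr1.
Qed.

Let cw : continuous w.
Proof.
move=> x; apply: (@continuous_comp _ _ _ (fun r : R => l * (r - t)) expR).
  by apply: cvgM; [exact: cvg_cst|apply: cvgB; [exact: cvg_id|exact: cvg_cst]].
exact: continuous_expR.
Qed.

Lemma exp_weight_L1 s : L1 leb `[t, s] w.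
Proof.
apply: continuous_compact_integrable; first exact: segment_compact.
exact: continuous_subspaceT.
Qed.

(** Measured against the weight [w], integration from [t] contracts by the factor
    [l^-1]; Picard iteration then converges on the whole interval at once. *)
Lemma integral_exp_weight s : t <= s ->
  \int[leb]_(r in `[t, s]) w r <= l^-1 * w s.
Proof.
rewrite le_eqVlt => /predU1P[<-|ts].
  by rewrite set_itv1 Rintegral_set1 mulr_ge0 ?expR_ge0// invr_ge0 ltW.
rewrite /Rintegral (@continuous_FTC2 _ w (fun r => l^-1 * w r))//.
- by rewrite -EFinB /= gerDl oppr_le0 mulr_ge0 ?expR_ge0// invr_ge0 ltW.
- exact: continuous_subspaceT.
- have cF : continuous (fun r => l^-1 * w r).
    by move=> x; apply: cvgM; [exact: cvg_cst|exact: cw].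
  split.
  + by move=> x _; have dx := dw x; exact: ex_derive.
  + exact: cvg_at_right_filter (cF _).
  + exact: cvg_at_left_filter (cF _).
- by move=> x _; have dx := dw x; rewrite derive1E; exact: derive_val.
Qed.

End ExponentialWeight.

Section ProgressiveIntegral.
Context {R : realType} {dO : measure_display} {Omega : measurableType dO}.
Notation leb := (@lebesgue_measure R).
Variables (F : R -> set (set Omega)) (a T : R).

Definition scalar_progressive (f : R -> Omega -> R) :=
  forall s, a <= s <= T ->
    measurable_fun (`[a, s] `*` [set: g_sigma_algebraType (F s)])
      (fun z : R * g_sigma_algebraType (F s) => f z.1 z.2).

(** The integral up to time [u] is a section integral of the jointly measurable
    function [f r w] restricted to [r <= u], so Tonelli's theorem applies. *)
Let ge0_progressive_integral (f : R -> Omega -> R) :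
  (forall s w, 0 <= f s w) -> scalar_progressive f ->
  scalar_progressive (fun s w => \int[leb]_(r in `[a, s]) f r w).
Proof.
move=> f0 pf s sI; pose Om := g_sigma_algebraType (F s).
have mS : measurable (`[a, s] `*` [set: Om] : set (R * Om)).
  by apply: measurableX => //; exact: measurable_itv.
have mf : measurable_fun setT
    ((fun z : R * Om => f z.1 z.2) \_ (`[a, s] `*` [set: Om])).
  exact: (measurable_restrictT _ mS).1 (pf s sI).
set fs := (_ \_ _) in mf.
pose h (v : (R * Om) * measurableTypeR R) : R :=
  fs ((v.2 : R), v.1.2) * (((v.2 : R) <= v.1.1)%R)%:R.
have mh : measurable_fun setT h.
  apply: measurable_funM.
    apply: (measurableT_comp mf); apply: measurable_fun_pair.
      exact: measurable_snd.
    exact: measurableT_comp measurable_snd measurable_fst.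
  have mle : measurable_fun setT (fun v : (R * Om) * measurableTypeR R =>
      ((v.2 : R) <= v.1.1)%R).
    apply: measurable_fun_ler; first exact: measurable_snd.
    exact: measurableT_comp measurable_fst measurable_fst.
  rewrite (_ : (fun v => _) = (fun v => if ((v.2 : R) <= v.1.1)%R then 1 else 0)).
    exact: measurable_fun_ifT.
  by apply/funext => v; case: ifP.
have h0 v : 0 <= h v.
  rewrite /h mulr_ge0// /fs patchE; case: ifP => // _; exact: f0.
have mG := @measurable_fun_fubini_tonelli_F _ _ _ _ R leb (EFin \o h)
  ((measurable_EFinP _ _).2 mh) (fun v => h0 v).
have mG' : measurable_fun setT (fine \o fubini_F leb (EFin \o h)).
  exact: measurableT_comp (fine_measurable measurableT) mG.
apply: (eq_measurable_fun (fine \o fubini_F leb (EFin \o h))); last first.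
  exact: measurable_funTS mG'.
move=> [u w] /set_mem [/= + _]; rewrite in_itv /= => /andP[au us].
rewrite /fubini_F -[LHS]/(\int[leb]_r h ((u, w), r)) [RHS]Rintegral_mkcond.
apply: eq_Rintegral => r _; rewrite /h /fs !patchE /=.
have [ru|ur] := leP r u; rewrite ?mulr1 ?mulr0.
  have -> : ((r, w) \in `[a, s] `*` [set: Om]) = (r \in `[a, u]%classic).
    apply/idP/idP; rewrite !inE /= !in_itv /=.
      by move=> [/andP[-> _] _].
    by move=> /andP[-> _]; split => //; exact: le_trans us.
  by [].
by rewrite memNset//= in_itv /= => /andP[_]; rewrite leNgt ur.
Qed.

Lemma progressive_integral (f : R -> Omega -> R) :
  (forall w, L1 leb `[a, T] (fun s => f s w)) -> scalar_progressive f ->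
  scalar_progressive (fun s w => \int[leb]_(r in `[a, s]) f r w).
Proof.
move=> Lf pf.
have pp : scalar_progressive (fun s w => Num.max (f s w) 0).
  by move=> s sI; apply: measurable_maxr => //; exact: pf.
have pn : scalar_progressive (fun s w => Num.max (- f s w) 0).
  by move=> s sI; apply: measurable_maxr => //; apply: measurableT_comp => //; exact: pf.
have ip := ge0_progressive_integral (fun s w => _ : 0 <= Num.max (f s w) 0) pp.
have in_ := ge0_progressive_integral (fun s w => _ : 0 <= Num.max (- f s w) 0) pn.
move=> s sI.
have max0 (x : R) : 0 <= Num.max x 0 by rewrite le_max lexx orbT.
apply: (eq_measurable_fun (fun z : R * g_sigma_algebraType (F s) =>
  \int[leb]_(r in `[a, z.1]) Num.max (f r z.2) 0 -
  \int[leb]_(r in `[a, z.1]) Num.max (- f r z.2) 0)); last first.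
  by apply: measurable_funB; [exact: ip|exact: in_].
move=> [u w] /set_mem [/= + _]; rewrite in_itv /= => /andP[au us].
have uT : u <= T by rewrite (le_trans us)//; case/andP: sI.
have Lfu := L1_subitv (lexx a) uT (Lf w).
have mfu := L1_measurable (measurable_time a u) Lfu.
have Ln := L1_norm (measurable_time a u) Lfu.
rewrite -RintegralB//.
- by apply: eq_Rintegral => r _; rewrite /Num.max; case: ifP; case: ifP; lra.
- apply: (le_L1 _ _ Ln) => //; first exact: measurable_maxr.
  by move=> r _; rewrite /Num.max; case: ifP; rewrite ?normr0.
- apply: (le_L1 _ _ Ln) => //.
    by apply: measurable_maxr => //; exact: measurableT_comp.
  by move=> r _; rewrite -[leRHS]normrN /Num.max; case: ifP; rewrite ?normr0.
Qed.

End ProgressiveIntegral.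

(** * Linear differential equations with random coefficients *)

Lemma geometric_increments_cvg (R : realType) (u : nat -> R) (c : R) :
  (forall k, `|u k.+1 - u k| <= c * 2^-1 ^+ k) ->
  cvgn u /\ forall k, `|u k| <= `|u 0%N| + 2 * c.
Proof.
move=> hu; have c0 : 0 <= c by have := hu 0%N; rewrite expr0 mulr1; exact: le_trans.
split.
  have -> : u = (fun k => u 0%N + series (telescope u) k).
    by apply/funext => k; exact: eq_sum_telescope.
  apply: is_cvgD; first exact: is_cvg_cst.
  apply: normed_cvg.
  apply: (@series_le_cvg _ _ (geometric c 2^-1)).
  - by move=> k; exact: normr_ge0.
  - by move=> k; rewrite /geometric /= mulr_ge0// exprn_ge0.
  - by move=> k; exact: hu.
  apply: is_cvg_geometric_series.
  by rewrite ger0_norm ?invr_ge0// invf_lt1// ltr1n.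
move=> k; suff h : `|u k - u 0%N| <= 2 * c * (1 - 2^-1 ^+ k).
  rewrite -[u k](subrK (u 0%N)) addrC (le_trans (ler_normD _ _))// lerD2l.
  rewrite (le_trans h)// ler_piMr ?mulr_ge0// gerBl exprn_ge0//.
elim: k => [|k ih]; first by rewrite subrr normr0 expr0 subrr mulr0.
have -> : u k.+1 - u 0%N = (u k.+1 - u k) + (u k - u 0%N) by ring.
rewrite (le_trans (ler_normD _ _))// (le_trans (lerD (hu k) ih))// exprS.
lra.
Qed.

Lemma cvg_finite_sum (R : realType) (I : Type) (r : seq I) (u : I -> nat -> R)
    (l : I -> R) : (forall i, u i @ \oo --> l i) ->
  (fun k => \sum_(i <- r) u i k) @ \oo --> \sum_(i <- r) l i.
Proof.
move=> ul; elim: r => [|i r ih].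
  by rewrite big_nil; under eq_fun do rewrite big_nil; exact: cvg_cst.
rewrite big_cons; under eq_fun do rewrite big_cons.
by apply: cvgD; [exact: ul|exact: ih].
Qed.

Lemma progressive_mulmx (R : realType) (dO : measure_display)
    (Omega : measurableType dO) (F : R -> set (set Omega)) (t T : R) (m n : nat)
    (A : R -> Omega -> 'M[R]_(m, n)) (v : R -> Omega -> 'cV[R]_n) i :
  progressive F t T A -> (forall j, scalar_progressive F t T (fun s w => v s w j 0)) ->
  scalar_progressive F t T (fun s w => (A s w *m v s w) i 0).
Proof.
move=> pA pv s sI; under [X in measurable_fun _ X]funext do rewrite mxE.
apply: measurable_sum => j; apply: measurable_funM; first exact: pA.
exact: pv.
Qed.

Section Picard.
Context {R : realType} {dO : measure_display} {Omega : measurableType dO}.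
Notation leb := (@lebesgue_measure R).
Variables (F : R -> set (set Omega)) (t T : R).
Hypothesis tT : t <= T.
Variables (m : nat) (A : R -> Omega -> 'M[R]_m) (K : R) (v0 : 'cV[R]_m).
Hypothesis K0 : 0 <= K.
Hypothesis pA : progressive F t T A.
Hypothesis A_le : forall s w i j, t <= s <= T -> `|A s w i j| <= K.

Notation prog := (scalar_progressive F t T).

Lemma progressive_section (f : R -> Omega -> R) w : prog f ->
  measurable_fun (`[t, T] : set (measurableTypeR R)) (fun s => f s w).
Proof.
move=> pf; have TI : t <= T <= T by rewrite tT lexx.
pose Om := g_sigma_algebraType (F T).
have mS : measurable (`[t, T] `*` [set: Om] : set (R * Om)).
  by apply: measurableX => //; exact: measurable_itv.
apply: (@measurable_comp _ _ _ _ _ _ (`[t, T] `*` [set: Om])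
  (fun z : R * Om => f z.1 z.2) `[t, T] (fun s => (s, w))) => //.
- by move=> _ [s sI <-].
- exact: pf.
- exact: measurable_funTS (measurable_pair2 (w : Om)).
Qed.

Lemma bounded_progressive_L1 (f : R -> Omega -> R) (B : R) w : prog f ->
  (forall s, t <= s <= T -> `|f s w| <= B) -> L1 leb `[t, T] (fun s => f s w).
Proof.
move=> pf fB; have mI := measurable_time t T.
apply: (le_L1 mI _ (L1_time_cst t T B)); first exact: progressive_section.
by move=> s /=; rewrite in_itv; exact: fB.
Qed.

Lemma mulmx_le (v : 'cV[R]_m) s w i (B : R) : t <= s <= T ->
  (forall j, `|v j 0| <= B) -> `|(A s w *m v) i 0| <= m%:R * K * B.
Proof.
move=> sI vB; rewrite mxE (le_trans (ler_norm_sum _ _ _))//.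
apply: (@le_trans _ _ (\sum_(j < m) K * B)).
  by apply: ler_sum => j _; rewrite normrM ler_pM// ?A_le.
by rewrite sumr_const card_ord -[leLHS]mulr_natl mulrA.
Qed.

Fixpoint picard (k : nat) (s : R) (w : Omega) : 'cV[R]_m :=
  if k is k'.+1 then
    \col_i (v0 i 0 + \int[leb]_(r in `[t, s]) (A r w *m picard k' r w) i 0)
  else v0.

Lemma picard_progressive k :
  (forall i, prog (fun s w => picard k s w i 0)) /\
  exists B, forall s w i, t <= s <= T -> `|picard k s w i 0| <= B.
Proof.
elim: k => [|k [pk [B hB]]].
  split; first by move=> i s sI; exact: measurable_cst.
  exists (\sum_i `|v0 i 0|) => s w i _ /=.
  by rewrite (bigD1 i)//= lerDl sumr_ge0.
have pf i := progressive_mulmx i pA pk.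
have fB w i s : t <= s <= T -> `|(A s w *m picard k s w) i 0| <= m%:R * K * B.
  by move=> sI; apply: mulmx_le => // j; exact: hB.
have Lf i w := bounded_progressive_L1 (pf i) (fB w i).
split.
  move=> i s sI /=; under [X in measurable_fun _ X]funext do rewrite mxE.
  apply: measurable_funD => //.
  exact: (progressive_integral (fun w => Lf i w) (pf i) sI).
exists (\sum_i `|v0 i 0| + m%:R * K * B * fine (leb `[t, T])) => s w i sI /=.
rewrite mxE (le_trans (ler_normD _ _))// lerD//.
  by rewrite (bigD1 i)//= lerDl sumr_ge0.
have /andP[ts sT] := sI.
apply: (le_trans (prim_bound (Lf i w) sT)).
rewrite -Rintegral_cst//; apply: le_Rintegral => //.
- exact: (L1_norm (measurable_time t T) (Lf i w)).
- exact: L1_time_cst.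
- by move=> r /=; rewrite in_itv; exact: fB.
Qed.

Let l := 2 * (m%:R * K + 1).
Let l0 : 0 < l. Proof. by rewrite mulr_gt0// ltr_wpDl// mulr_ge0. Qed.
Let e (s : R) := expR (l * (s - t)).
Let N0 := \sum_i `|v0 i 0|.

(** The exponent [l] is chosen so that one step at least halves the weighted
    bound. *)
Let contraction (v : R -> 'cV[R]_m) (b : R) w s i : t <= s <= T -> 0 <= b ->
  measurable_fun (`[t, s] : set (measurableTypeR R)) (fun r => (A r w *m v r) i 0) ->
  (forall r j, t <= r <= T -> `|v r j 0| <= b * e r) ->
  `|\int[leb]_(r in `[t, s]) (A r w *m v r) i 0| <= b * 2^-1 * e s.
Proof.
move=> /andP[ts sT] b0 mv vb; have mS := measurable_time t s.
have Le := exp_weight_L1 t l s.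
have LE := L1Z (m%:R * K * b) mS Le.
have vle r : t <= r <= s -> `|(A r w *m v r) i 0| <= m%:R * K * b * e r.
  move=> /andP[tr rs]; have rI : t <= r <= T by rewrite tr (le_trans rs).
  by rewrite -[leRHS]mulrA; apply: mulmx_le => // j; exact: vb.
have Lv : L1 leb `[t, s] (fun r => (A r w *m v r) i 0).
  by apply: (le_L1 mS mv LE) => r /=; rewrite in_itv; exact: vle.
apply: (le_trans (le_normr_Rintegral mS Lv)).
apply: (@le_trans _ _ (\int[leb]_(r in `[t, s]) (m%:R * K * b * e r))).
  apply: (le_Rintegral mS (L1_norm mS Lv) LE) => r /=.
  by rewrite in_itv; exact: vle.
rewrite RintegralZ//.
have he := integral_exp_weight l0 ts; rewrite -/(e s) in he.
have mK0 : 0 <= m%:R * K by rewrite mulr_ge0.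
apply: (le_trans (ler_wpM2l (mulr_ge0 mK0 b0) he)).
rewrite mulrA ler_wpM2r ?expR_ge0//.
rewrite [leLHS]mulrAC mulrC ler_wpM2l//.
rewrite ler_pdivrMr// /l mulrA mulVf// mul1r lerDl//.
Qed.

Let section_sub f s w : prog f -> s <= T ->
  measurable_fun (`[t, s] : set (measurableTypeR R)) (fun r => f r w).
Proof.
move=> pf sT; apply: measurable_funS (progressive_section w pf).
  exact: measurable_time.
by move=> r /=; rewrite !in_itv /= => /andP[-> rs]; rewrite (le_trans rs).
Qed.

Let picard_L1 k i w s : s <= T ->
  L1 leb `[t, s] (fun r => (A r w *m picard k r w) i 0).
Proof.
move=> sT; have [pk [B hB]] := picard_progressive k.
apply: (L1_subitv (lexx t) sT).
apply: (bounded_progressive_L1 (B := m%:R * K * B) (progressive_mulmx i pA pk)).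
by move=> r rI; apply: mulmx_le => // j; exact: hB.
Qed.

Let e1 s : t <= s -> 1 <= e s.
Proof. by move=> ts; rewrite -expR0 ler_expR mulr_ge0 ?subr_ge0// ltW. Qed.

Lemma picard_increment k s w i : t <= s <= T ->
  `|picard k.+1 s w i 0 - picard k s w i 0| <= N0 * 2^-1 ^+ k.+1 * e s.
Proof.
have N00 : 0 <= N0 by exact: sumr_ge0.
elim: k s w i => [|k ih] s w i sI; have /andP[ts sT] := sI.
  rewrite /= mxE addrC addKr expr1; apply: contraction => //.
    have [p0 _] := picard_progressive 0.
    apply: (section_sub (f := fun r w => (A r w *m picard 0 r w) i 0)) => //.
    exact: (progressive_mulmx i pA p0).
  move=> r j /andP[tr _]; apply: (@le_trans _ _ N0).
    by rewrite /N0 (bigD1 j)//= lerDl sumr_ge0.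
  by rewrite ler_peMr// e1.
have -> : picard k.+2 s w i 0 - picard k.+1 s w i 0 =
    \int[leb]_(r in `[t, s]) (A r w *m (picard k.+1 r w - picard k r w)) i 0.
  rewrite [picard k.+2]lock /= -lock /= !mxE opprD addrACA subrr add0r.
  rewrite -RintegralB//; [|exact: (picard_L1 k.+1)|exact: picard_L1].
  by apply: eq_Rintegral => r _; rewrite mulmxBr [in RHS]mxE [X in _ = _ + X]mxE.
have -> : N0 * 2^-1 ^+ k.+2 * e s = (N0 * 2^-1 ^+ k.+1) * 2^-1 * e s.
  by rewrite (exprS _ k.+1); ring.
apply: contraction => //; first by rewrite mulr_ge0// exprn_ge0.
  have [p1 _] := picard_progressive k.+1; have [p2 _] := picard_progressive k.
  apply: (section_sub (f := fun r w => (A r w *m (picard k.+1 r w - picard k r w)) i 0)) => //.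
  apply: (progressive_mulmx (v := fun r w => picard k.+1 r w - picard k r w)) => // j.
  move=> u uI; under [X in measurable_fun _ X]funext do rewrite mxE [X in _ + X]mxE.
  by apply: measurable_funB; [exact: p1|exact: p2].
by move=> r j rI; rewrite mxE [X in _ + X]mxE; exact: ih.
Qed.

Definition picard_limit s w : 'cV[R]_m := \col_i limn (fun k => picard k s w i 0).

Let C := N0 * e T.

Let picard_cvg s w i : t <= s <= T ->
  (fun k => picard k s w i 0) @ \oo --> picard_limit s w i 0 /\
  forall k, `|picard k s w i 0| <= N0 + 2 * C.
Proof.
move=> sI; have /andP[ts sT] := sI.
have N00 : 0 <= N0 by exact: sumr_ge0.
have [|cv bd] := @geometric_increments_cvg _ (fun k => picard k s w i 0) C.
  move=> k; apply: (le_trans (picard_increment k w i sI)).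
  have -> : N0 * 2^-1 ^+ k.+1 * e s = (N0 * e s) * (2^-1 ^+ k.+1) by ring.
  rewrite exprS /C; apply: ler_pM.
  - by rewrite mulr_ge0// expR_ge0.
  - by rewrite mulr_ge0 ?invr_ge0// exprn_ge0.
  - by rewrite ler_wpM2l// ler_expR (ler_pM2l l0) lerD2r.
  - by rewrite ler_piMl ?exprn_ge0// invf_le1// ler1n.
split; first by rewrite mxE.
move=> k; apply: (le_trans (bd k)); rewrite lerD2r.
by rewrite /= /N0 (bigD1 i)//= lerDl sumr_ge0.
Qed.

(** The iterates converge geometrically at every time for every [w], and they share
    one bound, so dominated convergence passes to the limit in the integral
    equation. Continuity of the limit is then that of an indefinite integral. *)
Lemma linear_ode : exists Z : R -> Omega -> 'cV[R]_m,
  [/\ cont_process F t T Z,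
      exists B, forall s w i, t <= s <= T -> `|Z s w i 0| <= B
    & forall s w i, t <= s <= T -> Z s w i 0 =
        v0 i 0 + \int[leb]_(r in `[t, s]) (A r w *m Z r w) i 0].
Proof.
exists picard_limit.
have pZ j : prog (fun s w => picard_limit s w j 0).
  move=> s sI.
  apply: (measurable_fun_cvg (h := fun k (z : R * g_sigma_algebraType (F s)) => picard k z.1 z.2 j 0)).
    by move=> k; exact: ((picard_progressive k).1 j s sI).
  move=> [u w] [/= + _]; rewrite in_itv /= => /andP[tu us].
  have uI : t <= u <= T by rewrite tu (le_trans us)//; case/andP: sI.
  exact: (picard_cvg w j uI).1.
have Z_le s w i : t <= s <= T -> `|picard_limit s w i 0| <= N0 + 2 * C.
  move=> sI; have [cv bd] := picard_cvg w i sI.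
  have cvn : (fun k => `|picard k s w i 0|) @ \oo --> `|picard_limit s w i 0|.
    exact: cvg_norm cv.
  rewrite -(cvg_lim (@Rhausdorff R) cvn); apply: limr_le.
    by apply/cvg_ex; eexists; exact: cvn.
  by apply: nearW => k; exact: bd.
have eqZ s w i : t <= s <= T -> picard_limit s w i 0 =
   v0 i 0 + \int[leb]_(r in `[t, s]) (A r w *m picard_limit r w) i 0.
  move=> sI; have /andP[ts sT] := sI; have mS := measurable_time t s.
  have subI r : t <= r <= s -> t <= r <= T.
    by move=> /andP[-> rs]; rewrite (le_trans rs).
  pose B := m%:R * K * (N0 + 2 * C).
  have L1p k : L1 leb `[t, s] (fun r => (A r w *m picard k r w) i 0).
    exact: picard_L1.
  have L1l : L1 leb `[t, s] (fun r => (A r w *m picard_limit r w) i 0).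
    apply: (L1_subitv (lexx t) sT).
    apply: (bounded_progressive_L1 (B := B) (progressive_mulmx i pA pZ)).
    by move=> r rI; apply: mulmx_le => // k; exact: Z_le.
  have cf r : t <= r <= s ->
      (fun k => (A r w *m picard k r w) i 0) @ \oo --> (A r w *m picard_limit r w) i 0.
    move=> /subI rI; rewrite mxE; under eq_fun do rewrite mxE.
    apply: cvg_finite_sum => j; apply: cvgM; first exact: cvg_cst.
    exact: (picard_cvg w j rI).1.
  have dom : {ae leb, forall r k, `[t, s]%classic r ->
      (`|((A r w *m picard k r w) i 0)%:E| <= B%:E)%E}.
    apply: aeW => r k /=; rewrite in_itv /= => /subI rI; rewrite lee_fin.
    by apply: mulmx_le => // j; exact: (picard_cvg w j rI).2.
  have cfe : {ae leb, forall r, `[t, s]%classic r ->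
      (fun k => ((A r w *m picard k r w) i 0)%:E) @ \oo -->
      ((A r w *m picard_limit r w) i 0)%:E}.
    apply: aeW => r /=; rewrite in_itv /= => rI.
    by apply: cvg_EFin; [exact: nearW|exact: cf].
  have [_ _ h] := @dominated_convergence _ _ _ leb _ mS
    (fun k r => ((A r w *m picard k r w) i 0)%:E)
    (fun r => ((A r w *m picard_limit r w) i 0)%:E) (fun=> B%:E)
    (fun k => measurable_int leb (L1p k)) (measurable_int leb L1l)
    cfe (L1_time_cst t s B) dom.
  have hi : (fun k => \int[leb]_(r in `[t, s]) (A r w *m picard k r w) i 0) @ \oo -->
      \int[leb]_(r in `[t, s]) (A r w *m picard_limit r w) i 0.
    apply: fine_cvg; rewrite -L1E//; exact: h.
  have c1 : (fun k => picard k.+1 s w i 0) @ \oo -->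
      v0 i 0 + \int[leb]_(r in `[t, s]) (A r w *m picard_limit r w) i 0.
    rewrite /=; under eq_fun do rewrite mxE.
    by apply: cvgD => //; exact: cvg_cst.
  have c2 : (fun k => picard k.+1 s w i 0) @ \oo --> picard_limit s w i 0.
    by rewrite (cvg_shiftS (fun k => picard k s w i 0)); exact: (picard_cvg w i sI).1.
  exact: (cvg_unique (@Rhausdorff R) c2 c1).
split => //; last by exists (N0 + 2 * C).
split; first by move=> s sI i j; rewrite ord1; exact: pZ.
move=> w i j; rewrite ord1.
apply: (@abs_cont_continuous _ _ _ _ (fun r => (A r w *m picard_limit r w) i 0)) => //.
split.
  apply: (bounded_progressive_L1 (B := m%:R * K * (N0 + 2 * C)) (progressive_mulmx i pA pZ)).
  by move=> r rI; apply: mulmx_le => // k; exact: Z_le.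
move=> s sI; rewrite eqZ// (eqZ t) ?prim_start ?addr0 ?lexx//.
Qed.

End Picard.

(** * The closed-loop system *)

Lemma progressive_restrict (R : realType) (dO : measure_display)
    (Omega : measurableType dO) (F : R -> set (set Omega)) (a b T : R) (m n : nat)
    (f : R -> Omega -> 'M[R]_(m, n)) : a <= b ->
  progressive F a T f -> progressive F b T f.
Proof.
move=> ab pf s /andP[bs sT] i j.
have sI : a <= s <= T by rewrite (le_trans ab bs) sT.
apply: measurable_funS (pf s sI i j).
  by apply: measurableX => //; exact: measurable_itv.
move=> z [/= zI _]; split => //.
by move: zI; rewrite !in_itv /= => /andP[bz ->]; rewrite (le_trans ab).
Qed.

Section ClosedLoop.
Context {R : realType} {dO : measure_display} {Omega : measurableType dO}.
Variables (P : probability Omega R) (T : R) (W : R -> Omega -> R).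
Notation leb := (@lebesgue_measure R).
Notation prod_meas := (leb \x P)%E.
Notation F := (brownian_gen P W).
Hypothesis hF : forall A : set Omega, measurable A <-> <<s F T >> A.
Variable t : R.
Hypothesis t0T : 0 <= t < T.
Notation I := (`[t, T]%classic).
Notation D := (`[t, T]%classic `*` [set: Omega] : set (measurableTypeR R * Omega)).
Variables (d : nat) (Lambda gamma : 'M[R]_d) (rho : R -> Omega -> 'M[R]_d).
Hypothesis hrho : progressive F 0 T rho.
Hypothesis hrho_bdd : (Linfty_norm P T rho < +oo)%E.
Variable p : R -> Omega -> 'M[R]_(d + d).
Hypothesis hp : bounded_cont_process P F T p.
Variables (x y : 'cV[R]_d).

Let mI := measurable_time t T.
Let mD : measurable D := measurable_slab t T.
Let tT : t <= T. Proof. by case/andP: t0T => _ /ltW. Qed.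
Let t0 : 0 <= t. Proof. by case/andP: t0T. Qed.

Let gain s w := - (invmx Lambda *m (row_mx (- 1%:M) gamma *m p s w + row_mx 0 1%:M)).

Let dyn s w : 'M[R]_(d + d) :=
  col_mx (- 1%:M) gamma *m gain s w + block_mx 0 0 0 (- rho s w).

Let dyn_entrywise (T' : Type) (Q : (T' -> R) -> Prop) (a : T' -> R) (b : T' -> Omega) :
  (forall k, Q (fun=> k)) ->
  (forall f g, Q f -> Q g -> Q (fun w => f w + g w)) ->
  (forall f g, Q f -> Q g -> Q (fun w => f w * g w)) ->
  entrywise Q (fun v => p (a v) (b v)) -> entrywise Q (fun v => rho (a v) (b v)) ->
  entrywise Q (fun v => gain (a v) (b v)) /\ entrywise Q (fun v => dyn (a v) (b v)).
Proof.
move=> Qc QD QM Qp Qr.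
have ec m n (A : 'M[R]_(m, n)) : entrywise Q (fun=> A) by exact: entrywise_cst.
have eg : entrywise Q (fun v => gain (a v) (b v)).
  apply: (entrywiseN Qc QM); apply: (entrywiseM Qc QD QM); first exact: ec.
  apply: (entrywiseD QD); last exact: ec.
  by apply: (entrywiseM Qc QD QM) => //; exact: ec.
split => //; apply: (entrywiseD QD).
  by apply: (entrywiseM Qc QD QM) => //; exact: ec.
apply: entrywise_block; try exact: ec.
exact: (entrywiseN Qc QM).
Qed.

Let bp := bounded_cont_bounded hF t0T hp.
Let brho := Linfty_bounded hF t0T hrho hrho_bdd.

Let bgain_dyn : mx_bounded prod_meas D (uncurry_process gain) /\
  mx_bounded prod_meas D (uncurry_process dyn).
Proof.
apply: dyn_entrywise => //.
- exact: ess_bounded_cst.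
- by move=> f g; exact: ess_boundedD.
- by move=> f g; exact: ess_boundedM.
Qed.

Let gain_dyn_progressive : progressive F t T gain /\ progressive F t T dyn.
Proof.
suff h s : t <= s <= T -> entrywise (measurable_fun
      (`[t, s] `*` [set: g_sigma_algebraType (F s)]))
      (fun z : R * g_sigma_algebraType (F s) => gain z.1 z.2) /\
    entrywise (measurable_fun (`[t, s] `*` [set: g_sigma_algebraType (F s)]))
      (fun z : R * g_sigma_algebraType (F s) => dyn z.1 z.2).
  by split => s sI; have [] := h s sI.
move=> sI; apply: dyn_entrywise => //.
- by move=> f g; exact: measurable_funD.
- by move=> f g; exact: measurable_funM.
- exact: (progressive_restrict t0 hp.1.1 sI).
- exact: (progressive_restrict t0 hrho sI).
Qed.

Let dyn_mulmx s w (u v : 'cV[R]_d) :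
  dyn s w *m col_mx u v = col_mx (- (gain s w *m col_mx u v))
    (- (rho s w *m v) + gamma *m (gain s w *m col_mx u v)).
Proof.
rewrite /dyn mulmxDl mul_block_col !mul0mx !add0r -mulmxA mul_col_mx.
by rewrite (mulNmx 1%:M) mul1mx (mulNmx (rho s w)) add_col_mx addr0 [in RHS]addrC.
Qed.

Let dyn_bound : exists2 K : R, 0 <= K &
  {ae prod_meas, forall v, D v -> forall i j, `|dyn v.1 v.2 i j| <= K}.
Proof.
have [_ hb] := bgain_dyn.
have hb' ij : exists K, {ae prod_meas, forall v, D v ->
    `|uncurry_process dyn v ij.1 ij.2| <= K}.
  by case: (hb ij.1 ij.2).
have [K hK] := choice hb'.
exists (\sum_ij `|K ij|); first exact: sumr_ge0.
have h := ae_forall_fin hK; have FF := ae_filter_ringOfSetsType prod_meas.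
apply: filterS h => v h Dv i j.
apply: (le_trans (h (i, j) Dv)); apply: (le_trans (ler_norm _)).
by rewrite (bigD1 (i, j))//= lerDl sumr_ge0.
Qed.

(** In closed loop the state solves a linear equation whose matrix is bounded only
    almost everywhere, whereas continuity of all paths is required. The equation is
    therefore solved with its entries clipped at [K]; for almost every [w] this
    changes them at almost no time, so the equation is unaffected. The control is
    defined from the resulting state by the feedback law itself, at all times. *)
Lemma closed_loop : exists xi X Y,
  [/\ L2_process P F t T xi, state_process P F T gamma rho t x y xi X Y
    & forall s w, xi s w = feedback Lambda gamma p s w (X s w) (Y s w)].
Proof.
have [K K0 hK] := dyn_bound.
pose A s w : 'M[R]_(d + d) := \matrix_(i, j) Num.max (- K) (Num.min K (dyn s w i j)).
have pA : progressive F t T A.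
  move=> s sI i j; under [X in measurable_fun _ X]funext do rewrite mxE.
  apply: measurable_maxr => //; apply: measurable_minr => //.
  exact: gain_dyn_progressive.2.
have A_le s w i j : t <= s <= T -> `|A s w i j| <= K.
  move=> _; rewrite mxE ler_norml le_max lexx /= ge_max ge_min lexx /=.
  by rewrite andbT lerNl (le_trans _ K0)// lerNl oppr0.
have [Z [cZ [B hB] hZ]] := linear_ode tT (col_mx x y) K0 pA A_le.
pose X s w := usubmx (Z s w); pose Y s w := dsubmx (Z s w).
have ZE s w : col_mx (X s w) (Y s w) = Z s w by rewrite vsubmxK.
pose xi s w := feedback Lambda gamma p s w (X s w) (Y s w).
have xiE s w : xi s w = gain s w *m Z s w.
  by rewrite /xi /feedback ZE /gain mulNmx.
have pZ := cZ.1.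
have bZ : mx_bounded prod_meas D (uncurry_process Z).
  move=> i j; split; first exact: (progressive_slab hF t0T (lexx t) pZ).
  exists B; apply: aeW => v [/= vI _]; rewrite ord1; apply: hB.
  by rewrite in_itv in vI.
have [bgain _] := bgain_dyn.
have bxi : mx_bounded prod_meas D (uncurry_process xi).
  rewrite (_ : uncurry_process xi =
    (fun v => uncurry_process gain v *m uncurry_process Z v)).
    exact: mx_boundedM.
  by apply/funext => v; exact: xiE.
have pxi : progressive F t T xi.
  move=> s sI i j; rewrite ord1.
  have : scalar_progressive F t T (fun s w => (gain s w *m Z s w) i 0).
    by apply: progressive_mulmx; [exact: gain_dyn_progressive.1|move=> k u uI; exact: pZ].
  by move=> /(_ s sI); under [X in measurable_fun _ X -> _]funext do rewrite -xiE.
have L2xi : mx_L2 prod_meas D (uncurry_process xi).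
  move=> i j; have := L2_ess_bounded mD (bxi i j) (L2_cst P T t 1).
  by under [X in L2 _ _ X -> _]funext do rewrite mulr1.
exists xi, X, Y; split => //.
- split.
  + by move=> i j; exact: (bxi i j).1.
  + by apply: progressive_adapted.
  have Lf : L1 prod_meas D (fun v => frob (uncurry_process xi v) ^+ 2).
    under [X in L1 _ _ X]funext do rewrite frob_sqr.
    by apply: L1_sum => // i; apply: L1_sum => // j; exact: (L2xi i j).2.
  apply: le_lt_trans (slab_L1_lty Lf).
  rewrite le_eqVlt; apply/orP; left; apply/eqP.
  by apply: eq_integral => w _; apply: eq_integral => s _; rewrite ger0_norm ?sqr_ge0.
split.
- split.
    by move=> s sI i j; under [G in measurable_fun _ G]funext do rewrite /X mxE; exact: pZ.
  move=> w i j; have := cZ.2 w (lshift d i) j.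
  by apply: subspace_eq_continuous => s _; rewrite /from_subspace /X mxE.
- split.
    by move=> s sI i j; under [G in measurable_fun _ G]funext do rewrite /Y mxE; exact: pZ.
  move=> w i j; have := cZ.2 w (rshift d i) j.
  by apply: subspace_eq_continuous => s _; rewrite /from_subspace /Y mxE.
have hLxi : {ae P, forall w, forall i, L1 leb I (fun s => xi s w i 0)}.
  by apply: ae_forall_fin => i; exact: (slab_ae_L1 (L2_L1 (L2xi i 0))).
have hK' := ae_prod_section hK.
apply: filterS2 hLxi hK' => w Lxi bw s sI; have /andP[ts sT] := sI.
have ZdynE i : Z s w i 0 = col_mx x y i 0 +
    \int[leb]_(r in `[t, s]) (dyn r w *m Z r w) i 0.
  rewrite hZ//; congr (_ + _).
  have msec (G : R -> Omega -> 'M[R]_(d + d)) : progressive F t T G ->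
      measurable_fun (`[t, s] : set (measurableTypeR R)) (fun r => (G r w *m Z r w) i 0).
    move=> pG; apply: (measurable_funS (measurable_time t T)).
      by move=> r /=; rewrite !in_itv /= => /andP[-> rs]; rewrite (le_trans rs).
    apply: (progressive_section tT w (f := fun r w => (G r w *m Z r w) i 0)).
    by apply: (progressive_mulmx i pG) => k u uI; exact: (pZ u uI k 0).
  apply: ae_eq_Rintegral.
  - exact: measurable_time.
  - exact: msec.
  - exact: (msec _ gain_dyn_progressive.2).
  have FF := ae_filter_ringOfSetsType leb.
  apply: filterS bw => r br /=; rewrite in_itv /= => /andP[tr rs].
  rewrite !mxE; apply: eq_bigr => k _; congr (_ * _); rewrite mxE.
  have : `|dyn r w i k| <= K.
    by apply: br; split => //=; rewrite in_itv /= tr (le_trans rs).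
  by rewrite ler_norml => /andP[h1 h2]; rewrite (min_idPr h2) (max_idPr h1).
have dynZ r i : (dyn r w *m Z r w) i 0 = col_mx (- xi r w)
    (- (rho r w *m Y r w) + gamma *m xi r w) i 0.
  by rewrite -ZE dyn_mulmx ZE -xiE.
split; apply/matrixP => i j; rewrite ord1 !mxE ZdynE.
  rewrite col_mxEu; congr (_ + _).
  rewrite -RintegralN//; last exact: L1_subitv (lexx t) sT (Lxi i).
  by apply: eq_Rintegral => r _; rewrite dynZ col_mxEu mxE.
rewrite col_mxEd; congr (_ + _).
by apply: eq_Rintegral => r _; rewrite dynZ col_mxEd.
Qed.

End ClosedLoop.

(** * Optimality and uniqueness *)

Lemma Rintegral_eq0_ae (d : measure_display) (T : measurableType d) (R : realType)
    (mu : {measure set T -> \bar R}) (D : set T) (f : T -> R) :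
  measurable D -> L1 mu D f -> (forall x, D x -> 0 <= f x) ->
  \int[mu]_(x in D) f x <= 0 -> {ae mu, forall x, D x -> f x = 0}.
Proof.
move=> mD Lf f0 If; have mf := L1_measurable mD Lf.
have If0 : \int[mu]_(x in D) f x = 0.
  by apply/eqP; rewrite eq_le If Rintegral_ge0.
have : ae_eq mu D (EFin \o f) (cst 0%E).
  apply/(ae_eq_integral_abs mu mD).
    exact/measurable_EFinP.
  rewrite -[RHS]/(0%R%:E) -If0 -(L1E mD Lf).
  by apply: eq_integral => x /set_mem Dx /=; rewrite ger0_norm ?f0.
by apply: filterS => x /= h Dx; have [] := h Dx.
Qed.

(** Test the event where [f] is negative. *)
Lemma sub_sigma_ge0_ae (R : realType) (dO : measure_display)
    (Omega : measurableType dO) (P : probability Omega R)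
    (G0 : set (set Omega)) (f : Omega -> R) :
  (forall A, <<s G0 >> A -> measurable A) -> L1 P setT f ->
  measurable_fun [set: g_sigma_algebraType G0] (f : g_sigma_algebraType G0 -> R) ->
  (forall A, <<s G0 >> A -> 0 <= \int[P]_(w in A) f w) ->
  {ae P, forall w, 0 <= f w}.
Proof.
move=> GM Lf mf f0; pose A := [set w | f w < 0].
have GA : <<s G0 >> A.
  have -> : A = f @^-1` `]-oo, 0[ by apply/seteqP; split => w; rewrite /A /= in_itv.
  have := mf measurableT _ (measurable_itv `]-oo, 0[).
  by rewrite setTI.
have mA := GM _ GA.
have LA := L1S mA measurableT (@subsetT _ A) Lf.
have h : {ae P, forall w, A w -> - f w = 0}.
  apply: Rintegral_eq0_ae => //.
  - exact: L1N.
  - by move=> w /= fw; rewrite oppr_ge0 ltW.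
  - by rewrite RintegralN// oppr_le0 f0.
apply: filterS h => w h; rewrite leNgt; apply/negP => fw.
by have := h fw; lra.
Qed.

Section StateUniqueness.
Context {R : realType} {dO : measure_display} {Omega : measurableType dO}.
Variables (P : probability Omega R) (T : R) (W : R -> Omega -> R).
Notation leb := (@lebesgue_measure R).
Notation F := (brownian_gen P W).
Hypothesis hF : forall A : set Omega, measurable A <-> <<s F T >> A.
Variable t : R.
Hypothesis t0T : 0 <= t < T.
Variables (d : nat) (gamma : 'M[R]_d) (rho : R -> Omega -> 'M[R]_d).
Hypothesis gamma_diag : is_diag_mx gamma.
Hypothesis hrho : progressive F 0 T rho.
Hypothesis hrho_diag : forall s w, 0 <= s <= T ->
  is_diag_mx (rho s w) /\ psdmx (rho s w).
Hypothesis hrho_bdd : (Linfty_norm P T rho < +oo)%E.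
Variables (x y : 'cV[R]_d) (xi X Y X' Y' : R -> Omega -> 'cV[R]_d).
Hypothesis hxi : L2_process P F t T xi.

(** The difference of two solutions satisfies the undriven damped equation with zero
    initial value, so [dissipative_bound] makes it vanish. *)
Lemma state_unique : state_process P F T gamma rho t x y xi X Y ->
  state_process P F T gamma rho t x y xi X' Y' ->
  {ae P, forall w, forall s, t <= s <= T -> X s w = X' s w /\ Y s w = Y' s w}.
Proof.
move=> h h'; have tT : t <= T by case/andP: t0T => _ /ltW.
have t0 : 0 <= t by case/andP: t0T.
have zero u u' r : abs_cont t T u (fun s => - (r s * u s) + 0) ->
    (forall s, t <= s <= T -> 0 <= r s) -> u' = 0 -> u t = u' ->
    forall s, t <= s <= T -> u s = 0.
  move=> hu r0 u'0 ut s sI.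
  have L0 : L1 leb `[t, T] (fun=> 0 : R) by exact: L10.
  have := dissipative_bound tT hu L0 r0 sI.
  rewrite ut u'0 normr0 add0r.
  rewrite Rintegral_cst; last exact: measurable_time.
  by rewrite mul0r mulr0 normr_le0 => /eqP.
have a1 := state_abs_cont hF t0T gamma_diag hrho hrho_diag hrho_bdd hxi h.
have a2 := state_abs_cont hF t0T gamma_diag hrho hrho_diag hrho_bdd hxi h'.
have s1 := state_start t0T h; have s2 := state_start t0T h'.
have s12 : {ae P, forall w, (X t w = x /\ Y t w = y) /\ (X' t w = x /\ Y' t w = y)}.
  by apply: filterS2 s1 s2.
apply: filterS3 a1 a2 s12 => w a1 a2 [[e1 e2] [e3 e4]] s sI.
have sub u v f g r : abs_cont t T u (fun s => - (r s * u s) + f s) ->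
    abs_cont t T v (fun s => - (r s * v s) + g s) -> f = g ->
    abs_cont t T (fun s => u s - v s) (fun s => - (r s * (u s - v s)) + 0).
  move=> [Lu hu] [Lv hv] fg; subst g.
  have mI q : measurable (`[t, q] : set (measurableTypeR R)) by exact: measurable_time.
  have e q : - (r q * (u q - v q)) + 0 =
      (- (r q * u q) + f q) - (- (r q * v q) + f q) by ring.
  split; first by apply: (eq_L1 (mI T) _ (L1B (mI T) Lu Lv)) => q _; rewrite e.
  move=> q qI; have qT : q <= T by case/andP: qI.
  under eq_Rintegral do rewrite e.
  rewrite RintegralB//; last 2 first.
  - exact: L1_subitv (lexx t) qT Lu.
  - exact: L1_subitv (lexx t) qT Lv.
  by rewrite (hu q qI) (hv q qI); ring.
split; apply/matrixP => i j; rewrite ord1; apply/eqP; rewrite -subr_eq0; apply/eqP.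
  apply: (zero _ _ _ (sub _ _ _ _ _ (a1 i).1 (a2 i).1 erefl) _ erefl _ s sI) => //.
  by rewrite e1 e3 subrr.
apply: (zero _ _ _ (sub _ _ _ _ _ (a1 i).2 (a2 i).2 erefl) _ erefl _ s sI).
  move=> q /andP[tq qT]; apply: psdmx_diag_ge0; apply: (hrho_diag w _).2.
  by rewrite qT (le_trans t0).
by rewrite e2 e4 subrr.
Qed.

End StateUniqueness.

Theorem theorem2p3 (R : realType) (dO : measure_display)
    (Omega : measurableType dO) (P : probability Omega R)
    (T : R) (hT : 0 < T) (d : nat) (hd : (0 < d)%N)
    (W : R -> Omega -> R)
    (hW : std_brownian P (brownian_gen P W) T W)
    (hF : forall A : set Omega, measurable A <-> <<s brownian_gen P W T >> A)
    (Lambda gamma : 'M[R]_d) (rho Sigma : R -> Omega -> 'M[R]_d)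
    (hLambda : pdmx Lambda)
    (hgamma : is_diag_mx gamma /\ pdmx gamma)
    (hrho : progressive (brownian_gen P W) 0 T rho)
    (hrho_diag : forall t w, 0 <= t <= T ->
       is_diag_mx (rho t w) /\ psdmx (rho t w))
    (hrho_bdd : (Linfty_norm P T rho < +oo)%E)
    (hSigma : progressive (brownian_gen P W) 0 T Sigma)
    (hSigma_psd : forall t w, 0 <= t <= T -> psdmx (Sigma t w))
    (hSigma_bdd : (Linfty_norm P T Sigma < +oo)%E)
    (n : R) (hn : n0 P T Lambda gamma rho Sigma < n)
    (Pn Mn : R -> Omega -> 'M[R]_(d + d))
    (hPn : bsrde_solution P (brownian_gen P W) T Lambda gamma rho Sigma W n
             Pn Mn) :
  forall (t : R) (x y : 'cV[R]_d), 0 <= t < T ->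
  [/\ {ae P, forall w,
         value_function P (brownian_gen P W) T Lambda gamma rho Sigma n t x y w
         = (2^-1 * dotp (col_mx x y) (Pn t w *m col_mx x y))%:E},
      exists xi X Y,
        [/\ optimal_control P (brownian_gen P W) T Lambda gamma rho Sigma n t
              x y xi,
            state_process P (brownian_gen P W) T gamma rho t x y xi X Y
          & forall s w, t <= s <= T ->
              xi s w = feedback Lambda gamma Pn s w (X s w) (Y s w)]
    & forall xi X Y,
        optimal_control P (brownian_gen P W) T Lambda gamma rho Sigma n t
          x y xi ->
        state_process P (brownian_gen P W) T gamma rho t x y xi X Y ->
        {ae (lebesgue_measure \x P)%E, forall z : R * Omega, t <= z.1 <= T ->
           xi z.1 z.2
           = feedback Lambda gamma Pn z.1 z.2 (X z.1 z.2) (Y z.1 z.2)}].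
Proof.
move=> t x y t0T.
have t0 : 0 <= t by case/andP: t0T.
have tT : t <= T by case/andP: t0T => _ /ltW.
have FM := filtration_sub hF tT.
have mI := measurable_time t T.
pose z := col_mx x y; pose v w := 2^-1 * dotp z (Pn t w *m z).
have bPn : bounded_cont_process P (brownian_gen P W) T Pn by case: hPn.
have tI : 0 <= t <= T by rewrite t0 tT.
have Pn_meas i j : F_measurable (brownian_gen P W) t (fun w => Pn t w i j).
  exact: (progressive_adapted bPn.1.1 tI i j).
have v_meas : F_measurable (brownian_gen P W) t v.
  rewrite /v; under [X in F_measurable _ _ X]funext do rewrite dotp_quad.
  apply: measurable_funM => //; apply: measurable_sum => i; apply: measurable_sum => j.
  by apply: measurable_funM => //; exact: Pn_meas.
have Lv : L1 P setT v.
  rewrite /v; under [X in L1 _ _ X]funext do rewrite dotp_quad.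
  apply: L1Z => //; apply: L1_sum => // i; apply: L1_sum => // j; apply: L1Z => //.
  have [K hK] := bPn.2.
  have LK : L1 P setT (fun=> K) by exact: finite_measure_integrable_cst.
  apply: (ae_le_L1 measurableT _ LK).
    exact: (F_measurable_fun hF tT (Pn_meas i j)).
  by apply: filterS hK => w hK _; exact: le_trans (frob_entry _ _ _) (hK t tI).
have regret_ge0 xi X Y s w : 0 <= regret Lambda gamma Pn xi X Y s w.
  rewrite /regret mulr_ge0// ?invr_ge0//.
  set u := xi s w - _; have [->|u0] := eqVneq u 0; first by rewrite mulmx0 dotp0r.
  exact/ltW/hLambda.2.
(* Conditional expectations are only ever used through their integrals over events
   of the past, on which the noise vanishes. *)
have cost_formula xi X Y C A : L2_process P (brownian_gen P W) t T xi ->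
    state_process P (brownian_gen P W) T gamma rho t x y xi X Y ->
    cond_exp P (brownian_gen P W) t (cost T Lambda Sigma n t xi X Y) C ->
    <<s brownian_gen P W t >> A ->
    \int[P]_(w in A) C w = \int[P]_(w in A) v w +
      \int[P]_(w in A) \int[lebesgue_measure]_(s in `[t, T]) regret Lambda gamma Pn xi X Y s w.
  move=> hxi hst [Lc LC _ hC] hA; have mA := FM _ hA.
  have LA f : L1 P setT f -> L1 P A f by exact: L1S.
  have Lr := regret_L1 hF t0T hgamma hrho hrho_diag hrho_bdd hPn hxi hst.
  have LIr := slab_L1_integral Lr.
  have [N [LN N0 hN]] := square_completion hW hF t0T hLambda hgamma hrho hrho_diag
    hrho_bdd hSigma hSigma_bdd hPn hxi hst.
  have -> : \int[P]_(w in A) C w = \int[P]_(w in A) cost T Lambda Sigma n t xi X Y w.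
    by rewrite /Rintegral hC.
  rewrite -RintegralD//; [|exact: LA|exact: LA].
  rewrite -[LHS]subr0 -(N0 A hA) -RintegralB//; [|exact: LA..].
  apply: ae_eq_Rintegral => //.
  - by apply: L1_measurable => //; apply: L1B => //; exact: LA.
  - by apply: L1_measurable => //; apply: L1D => //; exact: LA.
  by apply: filterS hN => w -> _; rewrite addrK.
(* The regret is nonnegative because [Lambda] is positive definite. *)
have v_le C : admissible_costs P (brownian_gen P W) T Lambda gamma rho Sigma n t x y C ->
    {ae P, forall w, v w <= C w}.
  move=> [xi [X [Y [hxi hst hC]]]]; have [_ LC mC _] := hC.
  have h : {ae P, forall w, 0 <= C w - v w}.
    apply: (sub_sigma_ge0_ae FM).
    - exact: L1B.
    - exact: measurable_funB.
    - move=> A hA; have mA := FM _ hA.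
      rewrite RintegralB//; [|exact: (L1S mA measurableT (@subsetT _ A))..].
      rewrite (cost_formula xi X Y C A)// addrC addKr.
      by apply: Rintegral_ge0 => w _; apply: Rintegral_ge0.
  by apply: filterS h => w; rewrite subr_ge0.
(* In closed loop the regret vanishes, so the lower bound is itself an admissible
   cost. *)
have [xi [X [Y [hxi hst hfb]]]] := closed_loop hF t0T Lambda gamma hrho hrho_bdd bPn x y.
have v_cond : cond_exp P (brownian_gen P W) t (cost T Lambda Sigma n t xi X Y) v.
  have Lc := cost_L1 hF t0T Lambda hgamma hrho hrho_diag hrho_bdd hSigma hSigma_bdd n hxi hst.
  split => // A hA; have mA := FM _ hA.
  have LA f : L1 P setT f -> L1 P A f by exact: L1S.
  have [N [LN N0 hN]] := square_completion hW hF t0T hLambda hgamma hrho hrho_diag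
    hrho_bdd hSigma hSigma_bdd hPn hxi hst.
  rewrite (L1E mA (LA _ Lv)) (L1E mA (LA _ Lc)); congr (_%:E).
  rewrite -[RHS]subr0 -(N0 A hA) -RintegralB//; [|exact: LA..].
  apply: ae_eq_Rintegral => //.
  - by apply: L1_measurable => //; exact: LA.
  - by apply: L1_measurable => //; apply: L1B => //; exact: LA.
  apply: filterS hN => w -> _; rewrite addrK.
  rewrite (_ : \int[_]_(s in _) _ = 0) ?addr0//.
  under eq_Rintegral do rewrite /regret hfb subrr mulmx0 dotp0r mulr0.
  by rewrite Rintegral_cst// mul0r.
have v_adm : admissible_costs P (brownian_gen P W) T Lambda gamma rho Sigma n t x y v.
  by exists xi, X, Y.
have mv : measurable_fun setT (EFin \o v).
  exact/measurable_EFinP/(L1_measurable _ Lv).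
have v_inf : is_ess_inf P
    (admissible_costs P (brownian_gen P W) T Lambda gamma rho Sigma n t x y) (EFin \o v).
  split; first exact: mv.
    by move=> C hC; have := v_le C hC; apply: filterS => w; rewrite lee_fin.
  by move=> U mU /(_ v v_adm).
have value_eq : {ae P, forall w,
    value_function P (brownian_gen P W) T Lambda gamma rho Sigma n t x y w = (v w)%:E}.
  have : is_ess_inf P
    (admissible_costs P (brownian_gen P W) T Lambda gamma rho Sigma n t x y)
    (value_function P (brownian_gen P W) T Lambda gamma rho Sigma n t x y).
    rewrite /value_function /ess_inf_family.
    by apply: (@xgetPex _ (cst +oo%E) [set V | is_ess_inf P _ V]); exists (EFin \o v).
  move=> [mV V1 V2].
  have [_ v_lb _] := v_inf.
  have le1 := V1 v v_adm; have le2 := V2 _ mv v_lb.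
  by apply: filterS2 le1 le2 => w h1 h2; apply/eqP; rewrite eq_le h1.
split => //.
  exists xi, X, Y; split => //; split => //.
  by exists X, Y, v.
move=> xi' X' Y' [hxi' [X'' [Y'' [C [hst'' hC hVC]]]]] hst'.
have Lr := regret_L1 hF t0T hgamma hrho hrho_diag hrho_bdd hPn hxi' hst''.
have mD := measurable_slab t T (Omega := Omega).
have [_ LC _ _] := hC.
(* The cost of an optimal control has the same mean as the value, which leaves no
   room for regret. *)
have Cv : \int[P]_w C w = \int[P]_w v w.
  apply: ae_eq_Rintegral => //; [exact: L1_measurable LC|exact: L1_measurable Lv|].
  by apply: filterS2 value_eq hVC => w -> [->].
have FT : <<s brownian_gen P W t >> setT.
  exact: (@measurableT _ (g_sigma_algebraType (brownian_gen P W t))).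
have reg0 := cost_formula xi' X'' Y'' C setT hxi' hst'' hC FT.
have dev0 : {ae (lebesgue_measure \x P)%E, forall u : measurableTypeR R * Omega,
    (`[t, T]%classic `*` setT) u -> regret Lambda gamma Pn xi' X'' Y'' u.1 u.2 = 0}.
  apply: (Rintegral_eq0_ae mD Lr) => //.
  rewrite (slab_integralE Lr) /=.
  by rewrite -(lerD2l (\int[P]_w v w)) -reg0 Cv addr0.
have uniq := ae_prod_snd (state_unique hF t0T hgamma.1 hrho hrho_diag hrho_bdd hxi' hst' hst'').
have FF := ae_filter_ringOfSetsType (lebesgue_measure \x P)%E.
apply: filterS2 dev0 uniq => u h1 h2 uI.
have {h2} [-> ->] := h2 u.1 uI.
have {h1} := h1 (conj (_ : `[t, T]%classic u.1) Logic.I).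
rewrite /= in_itv /= => /(_ uI).
rewrite /regret; set e := xi' u.1 u.2 - _ => e0.
apply/eqP; rewrite -subr_eq0 -/e; apply/negPn/negP => /hLambda.2; lra.
Qed.
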